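(* Let $k$ be an algebraically closed field, let $X$ be a variety over $k$, and let $f: X\to X$ be a flat and finite endomorphism. Assume that the field extension $k(X)/f^*k(X)$ is separable. Let $x\in X(k)$ be a point such that $\bigcup_{i\geq 0}f^{-i}(x)$ is Zariski dense in $X$. For $c\in(0,1]$ and $n\geq 0$, define $$S^n_c:=\min\Big\{\#S \;\Big|\; S\subseteq f^{-n}(x),\ \sum_{y\in S}m_{f^n}(y)\geq c\,d_f^n\Big\}.$$ Then for every $c\in(0,1]$ we have $$\lim_{n\to\infty}(S^n_c)^{1/n}=d_f.$$
   Context: A variety is an irreducible, reduced, separated scheme of finite type over a field. $d_f:=[k(X):f^*k(X)]$ is the topological degree of $f$. For a flat finite endomorphism $g$ of $X$ and $y\in X$, the multiplicity of $g$ at $y$ is $m_g(y):=\dim_{\kappa(g(y))}(\mathcal{O}_{X,y}/\mathfrak{m}_{g(y)}\mathcal{O}_{X,y})\in\mathbb{Z}_{\ge1}$, where $\mathcal{O}_{X,y}$ is viewed as an $\mathcal{O}_{X,g(y)}$-module via $g$; one has $\sum_{y\in g^{-1}(x)}m_g(y)=d_g$ for all $x\in X$. Here $f^{-n}(x)$ is the set-theoretic preimage of $x$ under $f^n$. *)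

(* Defs.v *)
(* Schemes over a field are not in these libraries; they are set up here.
   - A sheaf of rings is given by its etale space: the family of its stalks,
     and the predicate singling out, among the families of germs over an open
     set U, those that are sections over U.
   - "U is isomorphic to Spec A" is [affine_chart U A]: a homeomorphism from U
     onto the set of prime ideals of A with its Zariski topology, stalks that
     are the localizations A_p, and sections that are the families of germs
     which are locally fractions of elements of A. *)
From HB Require Import structures.
From mathcomp Require Import all_boot all_order all_algebra finmap.
From mathcomp Require Import all_classical all_reals all_analysis.
From mathcomp Require mpoly.

Set Implicit Arguments.
Unset Strict Implicit.
Unset Printing Implicit Defensive.

Import Order.TTheory GRing.Theory Num.Theory.
Import numFieldNormedType.Exports.

Local Open Scope classical_set_scope.
Local Open Scope ring_scope.

(** * Commutative algebra *)

Definition invertible (A : comPzRingType) (a : A) : Prop :=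
  exists b : A, a * b = 1.

Record prime_ideal (A : comPzRingType) (p : set A) : Prop := PrimeIdeal {
  prime_ideal0 : p 0;
  prime_idealD : forall a b, p a -> p b -> p (a + b);
  prime_idealM : forall a b, p b -> p (a * b);
  prime_ideal1 : ~ p 1;
  prime_ideal_prime : forall a b, p (a * b) -> p a \/ p b }.

(* [h : A -> L] is a ring morphism that makes L the localization of A at the
   prime ideal p. *)
Record localization_at (A : comPzRingType) (p : set A)
    (L : comPzRingType) (h : A -> L) : Prop := LocalizationAt {
  localization_nmod : nmod_morphism h;
  localization_monoid : monoid_morphism h;
  localization_invertible : forall b, ~ p b -> invertible (h b);
  localization_fraction :
    forall l : L, exists a b, ~ p b /\ h b * l = h a;
  localization_kernel :
    forall a, h a = 0 -> exists b, ~ p b /\ b * a = 0 }.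

Definition finitely_generated_algebra (k : fieldType) (A : comAlgType k) : Prop :=
  exists (n : nat) (t : 'I_n -> A),
    forall a : A, exists P : mpoly.mpoly n k, a = mpoly.mmap (in_alg A) t P.

Definition finite_morphism_of_rings (A B : comPzRingType)
    (phi : {rmorphism A -> B}) : Prop :=
  exists (n : nat) (e : 'I_n -> B),
    forall b, exists a : 'I_n -> A, b = \sum_(i < n) phi (a i) * e i.

(* Biadditive maps M x B -> T that are balanced over A, where B is an A-module
   through phi. *)
Record balanced (A B : comNzRingType) (phi : {rmorphism A -> B})
    (M : lmodType A) (T : zmodType) (tau : M -> B -> T) : Prop := Balanced {
  balancedDl : forall m m' b, tau (m + m') b = tau m b + tau m' b;
  balancedDr : forall m b b', tau m (b + b') = tau m b + tau m b';
  balancedZ : forall a m b, tau (a *: m) b = tau m (phi a * b) }.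

(* [T], with [tau], is the tensor product of M and B over A. *)
Definition is_tensor (A B : comNzRingType) (phi : {rmorphism A -> B})
    (M : lmodType A) (T : zmodType) (tau : M -> B -> T) : Prop :=
  balanced phi tau /\
  forall (T' : zmodType) (tau' : M -> B -> T'), balanced phi tau' ->
    exists! h : T -> T',
      zmod_morphism h /\ forall m b, h (tau m b) = tau' m b.

Definition flat_morphism_of_rings (A B : comNzRingType)
    (phi : {rmorphism A -> B}) : Prop :=
  forall (M N : lmodType A) (u : {linear M -> N}), injective u ->
  forall (T T' : zmodType) (tau : M -> B -> T) (tau' : N -> B -> T'),
    is_tensor phi tau -> is_tensor phi tau' ->
  forall h : T -> T', zmod_morphism h ->
    (forall m b, h (tau m b) = tau' (u m) b) -> injective h.

(* The ideal of B generated by the image under phi of the nonunits of A, i.e.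
   m_A B when A is local. *)
Definition extended_maximal_ideal (A B : comNzRingType)
    (phi : {rmorphism A -> B}) : set B :=
  [set b | exists (n : nat) (a : 'I_n -> A) (b' : 'I_n -> B),
     (forall i, ~ invertible (a i)) /\ b = \sum_(i < n) phi (a i) * b' i].

(* For A local with residue field K: B / m_A B has a K-basis with n elements
   (e is a lift to B of such a basis). *)
Definition fiber_dim (A B : comNzRingType) (phi : {rmorphism A -> B})
    (n : nat) : Prop :=
  exists e : 'I_n -> B,
    (forall b, exists a : 'I_n -> A,
       extended_maximal_ideal phi (b - \sum_(i < n) phi (a i) * e i)) /\
    (forall a : 'I_n -> A,
       extended_maximal_ideal phi (\sum_(i < n) phi (a i) * e i) ->
       forall i, ~ invertible (a i)).

(* In the next three definitions, A and B are meant to be fields (stalks at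
   generic points), so that phi is injective. *)
Definition field_degree (A B : comNzRingType) (phi : {rmorphism A -> B})
    (n : nat) : Prop :=
  exists e : 'I_n -> B,
    forall b, exists! a : {ffun 'I_n -> A}, b = \sum_(i < n) phi (a i) * e i.

Definition minimal_polynomial (A B : comNzRingType) (phi : {rmorphism A -> B})
    (b : B) (P : {poly A}) : Prop :=
  [/\ P \is monic, (map_poly phi P).[b] = 0 &
      forall Q : {poly A}, Q != 0 -> (map_poly phi Q).[b] = 0 ->
        (size P <= size Q)%N].

Definition separable_extension (A B : comNzRingType)
    (phi : {rmorphism A -> B}) : Prop :=
  forall b : B, exists P : {poly A},
    minimal_polynomial phi b P /\
    exists u v : {poly A}, u * P + v * P^`() = 1.

(** * Locally ringed spaces over a field *)

(* [is_section U] is only meaningful for U open, and only depends on the values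
   on U of the family of germs. *)
Record kspace (k : fieldType) := KSpace {
  point_space :> topologicalType;
  stalk : point_space -> comAlgType k;
  is_section : set point_space -> (forall x, stalk x) -> Prop;
  section_scalar : forall (U : set point_space) (a : k), open U ->
    is_section U (fun x => a%:A);
  section_sub : forall (U : set point_space) s t, open U ->
    is_section U s -> is_section U t -> is_section U (fun x => s x - t x);
  section_mul : forall (U : set point_space) s t, open U ->
    is_section U s -> is_section U t -> is_section U (fun x => s x * t x);
  section_ext : forall (U : set point_space) s t, open U ->
    (forall x, U x -> s x = t x) -> is_section U s -> is_section U t;
  section_restr : forall (U V : set point_space) s, open U -> open V ->
    V `<=` U -> is_section U s -> is_section V s;
  section_glue : forall (U : set point_space) s, open U ->
    (forall x, U x ->
       exists V, [/\ open V, V x, V `<=` U & is_section V s]) ->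
    is_section U s;
  germ_surj : forall x (a : stalk x),
    exists U s, [/\ open U, U x, is_section U s & s x = a];
  germ_inj : forall (U : set point_space) s t x, open U -> U x ->
    is_section U s -> is_section U t -> s x = t x ->
    exists V, [/\ open V, V x, V `<=` U & forall y, V y -> s y = t y];
  stalk_local : forall x (a : stalk x), invertible a \/ invertible (1 - a) }.

(* Local morphisms of locally ringed spaces over k. *)
Record kmor (k : fieldType) (X Y : kspace k) := KMor {
  mor_fun :> X -> Y;
  mor_stalk : forall x, {lrmorphism stalk (mor_fun x) -> stalk x};
  mor_continuous : continuous mor_fun;
  mor_section : forall (U : set Y) t, open U -> is_section U t ->
    is_section (mor_fun @^-1` U) (fun x => mor_stalk x (t (mor_fun x)));
  mor_local : forall x a, invertible (mor_stalk x a) -> invertible a }.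

(* Equality of morphisms: same map on points, same maps on sections. *)
Definition mor_eq (k : fieldType) (X Y : kspace k) (f g : kmor X Y) : Prop :=
  (forall x, f x = g x) /\
  forall (U : set Y) t, open U -> is_section U t -> forall x, U (f x) ->
    mor_stalk f x (t (f x)) = mor_stalk g x (t (g x)).

Section Composition.
Variable k : fieldType.

Lemma id_mor_section (X : kspace k) (U : set X) t : open U -> is_section U t ->
  is_section (idfun @^-1` U) (fun x => (idfun : {lrmorphism _ -> _}) (t x)).
Proof. by []. Qed.

Lemma id_mor_continuous (X : kspace k) : continuous (idfun : X -> X).
Proof. by move=> x; exact: cvg_id. Qed.

Definition id_mor (X : kspace k) : kmor X X :=
  @KMor k X X idfun (fun x => (idfun : {lrmorphism stalk x -> stalk x}))
    (@id_mor_continuous X) (@id_mor_section X) (fun x a inv_a => inv_a).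

Variables (X Y Z : kspace k) (g : kmor Y Z) (f : kmor X Y).

Definition comp_mor_stalk (x : X) : {lrmorphism stalk (g (f x)) -> stalk x} :=
  (mor_stalk f x \o mor_stalk g (f x) : {lrmorphism _ -> _}).

Lemma comp_mor_continuous : continuous (g \o f).
Proof.
by move=> x; apply: continuous_comp; [exact: mor_continuous|exact: mor_continuous].
Qed.

Lemma comp_mor_section (U : set Z) t : open U -> is_section U t ->
  is_section ((g \o f) @^-1` U) (fun x => comp_mor_stalk x (t (g (f x)))).
Proof.
move=> oU Ut; have oV : open (g @^-1` U).
  by apply: open_comp => // x _; exact: mor_continuous.
exact: (mor_section f oV (mor_section g oU Ut)).
Qed.

Lemma comp_mor_local x a : invertible (comp_mor_stalk x a) -> invertible a.
Proof. by move=> inv_a; exact: mor_local (mor_local inv_a). Qed.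

Definition comp_mor : kmor X Z :=
  @KMor k X Z (g \o f) comp_mor_stalk
    comp_mor_continuous comp_mor_section comp_mor_local.

End Composition.

Fixpoint iter_mor (k : fieldType) (X : kspace k) (n : nat) (f : kmor X X) :
    kmor X X :=
  if n is m.+1 then comp_mor f (iter_mor m f) else id_mor X.

(** * Schemes *)

(* [pt] is the identification of U with Spec A and [theta x] the map from A to
   the stalk at x; both are irrelevant outside U. *)
Record affine_chart (k : fieldType) (X : kspace k) (U : set X)
    (A : comPzRingType) (pt : X -> set A) (theta : forall x, A -> stalk x) :
    Prop := AffineChart {
  chart_open : open U;
  chart_bij : set_bij U [set p | prime_ideal p] pt;
  chart_topology : forall V : set X, V `<=` U ->
    (open V <-> exists E : set A, V = [set x | U x /\ ~ E `<=` pt x]);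
  chart_stalk : forall x, U x -> localization_at (pt x) (theta x);
  chart_section : forall (V : set X) s, open V -> V `<=` U ->
    (is_section V s <->
     forall x, V x -> exists W, [/\ open W, W x, W `<=` V &
       exists a b : A, forall y, W y ->
         ~ pt y b /\ theta y b * s y = theta y a]) }.

Definition is_scheme (k : fieldType) (X : kspace k) : Prop :=
  forall x : X, exists (U : set X) (A : comPzRingType) (pt : X -> set A)
    (theta : forall x, A -> stalk x), U x /\ affine_chart U pt theta.

(* Finite cover by spectra of finitely generated k-algebras; comAlgType algebras
   are nonzero, i.e. the members of the cover are nonempty. *)
Definition finite_type (k : fieldType) (X : kspace k) : Prop :=
  exists (n : nat) (U : 'I_n -> set X), (forall x, exists i, U i x) /\
    forall i, exists (A : comAlgType k) (pt : X -> set A)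
      (theta : forall x, A -> stalk x),
      [/\ affine_chart (U i) pt theta,
          forall x (a : k), U i x -> theta x a%:A = a%:A &
          finitely_generated_algebra A].

Definition irreducible_space (T : topologicalType) : Prop :=
  [set: T] !=set0 /\
  forall U V : set T, open U -> open V -> U !=set0 -> V !=set0 ->
    U `&` V !=set0.

Definition reduced (k : fieldType) (X : kspace k) : Prop :=
  forall (U : set X) s, open U -> is_section U s ->
  forall n : nat, (forall x, U x -> s x ^+ n = 0) -> forall x, U x -> s x = 0.

Record closed_immersion (k : fieldType) (X Y : kspace k) (i : kmor X Y) :
    Prop := ClosedImmersion {
  closed_immersion_inj : injective i;
  closed_immersion_closed : forall C : set X, closed C -> closed (i @` C);
  closed_immersion_stalk : forall x (a : stalk x),
    exists b, mor_stalk i x b = a }.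

(* (P, p1, p2) is a product of X and Y in the category of k-schemes, that is, a
   fibre product of X and Y over Spec k. *)
Definition is_product (k : fieldType) (X Y P : kspace k)
    (p1 : kmor P X) (p2 : kmor P Y) : Prop :=
  is_scheme P /\
  forall (Z : kspace k) (a : kmor Z X) (b : kmor Z Y), is_scheme Z ->
    exists h : kmor Z P,
      [/\ mor_eq (comp_mor p1 h) a, mor_eq (comp_mor p2 h) b &
          forall h' : kmor Z P,
            mor_eq (comp_mor p1 h') a -> mor_eq (comp_mor p2 h') b ->
            mor_eq h' h].

Definition separated (k : fieldType) (X : kspace k) : Prop :=
  exists (P : kspace k) (p1 p2 : kmor P X) (delta : kmor X P),
    [/\ is_product p1 p2, mor_eq (comp_mor p1 delta) (id_mor X),
        mor_eq (comp_mor p2 delta) (id_mor X) & closed_immersion delta].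

Record is_variety (k : fieldType) (X : kspace k) : Prop := IsVariety {
  variety_scheme : is_scheme X;
  variety_finite_type : finite_type X;
  variety_separated : separated X;
  variety_reduced : reduced X;
  variety_irreducible : irreducible_space X }.

(** * Morphisms *)

Definition flat_mor (k : fieldType) (X Y : kspace k) (f : kmor X Y) : Prop :=
  forall x, flat_morphism_of_rings (mor_stalk f x).

Definition finite_mor (k : fieldType) (X Y : kspace k) (f : kmor X Y) : Prop :=
  forall y : Y, exists (V : set Y)
    (A : comPzRingType) (ptA : Y -> set A) (thetaA : forall y, A -> stalk y)
    (B : comPzRingType) (ptB : X -> set B) (thetaB : forall x, B -> stalk x)
    (phi : {rmorphism A -> B}),
    [/\ V y, affine_chart V ptA thetaA, affine_chart (f @^-1` V) ptB thetaB,
        forall x a, V (f x) ->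
          thetaB x (phi a) = mor_stalk f x (thetaA (f x) a) &
        finite_morphism_of_rings phi].

Definition generic_point (T : topologicalType) (eta : T) : Prop :=
  closure [set eta] = [set: T].

(* k(X) is the stalk at the generic point eta. For f dominant f eta = eta, so
   the image of [mor_stalk f eta] is the subfield f^* k(X) of k(X). *)
Definition topological_degree (k : fieldType) (X : kspace k) (f : kmor X X) :
    nat :=
  xget 0%N [set d | exists2 eta : X,
    generic_point eta & field_degree (mor_stalk f eta) d].

Definition separable_mor (k : fieldType) (X : kspace k) (f : kmor X X) : Prop :=
  forall eta : X, generic_point eta -> separable_extension (mor_stalk f eta).

Definition multiplicity (k : fieldType) (X : kspace k) (g : kmor X X) (y : X) :
    nat :=
  xget 0%N [set m | fiber_dim (mor_stalk g y) m].

(* The points of X(k): those whose residue field is k. *)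
Definition rational_point (k : fieldType) (X : kspace k) (x : X) : Prop :=
  forall a : stalk x, exists c : k, ~ invertible (a - c%:A).

Definition preimage_iter (k : fieldType) (X : kspace k) (f : kmor X X)
    (n : nat) (x : X) : set X :=
  iter_mor n f @^-1` [set x].

Definition heavy_card (R : realType) (k : fieldType) (X : kspace k)
    (f : kmor X X) (x : X) (c : R) (n : nat) : set nat :=
  [set N | exists S : {fset X},
     [/\ [set` S] `<=` preimage_iter f n x,
         c * (topological_degree f)%:R ^+ n
           <= (\sum_(y <- S) multiplicity (iter_mor n f) y)%N%:R &
         N = #|` S|%fset]].

Definition min_heavy_card (R : realType) (k : fieldType) (X : kspace k)
    (f : kmor X X) (x : X) (c : R) (n : nat) : nat :=
  xget 0%N [set N | heavy_card f x c n N /\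
                    forall M, heavy_card f x c n M -> (N <= M)%N].

(* Main.v *)
(* Let a backward random walk start at x and move from z to a point y of f^-1(z)
   with probability m_f(y)/d_f; its law after n steps gives the mass
   m_{f^n}(y)/d_f^n to y in f^-n(x). Separability makes f unramified over a dense
   open set, so the points where m_f > 1 lie on a proper closed subset r. The walk
   spends asymptotically no time in r. Otherwise a limit A of the Cesaro means of
   its laws along an ultrafilter is a finitely additive measure, invariant under
   f, that charges r. As f is closed, it maps minimal charged closed sets to such
   sets; their almost disjointness forces a cycle, and as f is open the union of
   this cycle is completely invariant, hence contains x and the whole backward orbit. By
   density and irreducibility the space itself is then minimal charged, which
   contradicts A(r) > 0. By multiplicativity of m, a point whose orbit meets r
   fewer than t times has mass at most d_f^(t-n), so by Markov's inequality a
   part of f^-n(x) of mass c has at least d_f^(n - o(n)) points.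

   The multiplicity formula and the topology of f come from the fibre algebra: a
   flat morphism satisfies the equational criterion, hence a basis of the finite
   algebra over the residue field lifts to a basis over the local ring. *)
Require Import Defs.
From HB Require Import structures.
From mathcomp Require Import all_boot all_order all_algebra finmap.
From mathcomp Require Import all_classical all_reals all_analysis.
From mathcomp Require Import generic_quotient ring_quotient ring lra.
From mathcomp Require mpoly.

Set Implicit Arguments.
Unset Strict Implicit.
Unset Printing Implicit Defensive.

Import Order.TTheory GRing.Theory Num.Theory.
Import numFieldNormedType.Exports.

Local Open Scope classical_set_scope.
Local Open Scope ring_scope.

(** The limit must exist for all sets at once and be exactly invariant. An ultrafilter gives both,
    because shifting the walk by one step changes a mean over N + 1 times by at most 1 / (N + 1).
    Only finite additivity survives the limit; minimal charged sets come from Noetherianity instead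
    of countable additivity. Invariance gives A(Z) <= A(f(Z)), and every transition probability
    being at least 1 / d_f gives A(f(Z)) <= d_f A(Z), so charge passes both ways along f.

    The local analysis of fibres is done at points with residue field k. The backward orbit of x
    consists of such points, so closed sets are replaced by their traces on the rational points.

    X being integral, all stalks embed in the function field. The localization of the finite algebra
    along a fibre is a subring of it, and there coordinates over neighbouring points, and the degree
    itself, can be compared.

    Flatness, stated for arbitrary tensor products, can be exploited only by exhibiting one; I
    tensor B is built for a finitely generated ideal I. In the final estimate Markov's threshold is
    t = delta n, which time o(n) in r permits. *)

Lemma sum_enum_val (T : nmodType) (I : finType) (F : I -> T) :
  \sum_(i < #|I|) F (enum_val i) = \sum_i F i.
Proof.
by rewrite [RHS](reindex (@enum_val _ I)) //; exact: onW_bij (@enum_val_bij I).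
Qed.

Lemma sum_tagged (T : nmodType) (s : nat) (d : 'I_s -> nat)
    (F : {i : 'I_s & 'I_(d i)} -> T) :
  \sum_x F x = \sum_(i < s) \sum_(j < d i) F (Tagged (fun i => 'I_(d i)) j).
Proof.
rewrite (@sig_big_dep _ _ _ _ (fun i => 'I_(d i)) xpredT (fun _ _ => true)
  (fun i j => F (Tagged (fun i => 'I_(d i)) j))) /=.
by apply: eq_bigr => -[].
Qed.

(** * Linear algebra modulo a subspace *)

Section LinearAlgebraModulo.
Variables (k : fieldType) (V : lmodType k).
Implicit Types (S : set V) (I J : finType).

Record ksubspace S : Prop := KSubspace {
  ksubspace0 : S 0;
  ksubspaceD : forall u v, S u -> S v -> S (u + v);
  ksubspaceZ : forall c u, S u -> S (c *: u) }.

(** Bases of V / S are described by lifts to V, so that no quotient space has to be formed. In the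
    applications S is the extended maximal ideal. *)
Definition spans S I (g : I -> V) : Prop :=
  forall v, exists c : I -> k, S (v - \sum_i c i *: g i).

Definition indep S I (g : I -> V) : Prop :=
  forall c : I -> k, S (\sum_i c i *: g i) -> forall i, c i = 0.

Lemma ksubspaceN S u : ksubspace S -> S u -> S (- u).
Proof. by move=> sS Su; rewrite -scaleN1r; exact: ksubspaceZ. Qed.

Lemma ksubspaceB S u v : ksubspace S -> S u -> S v -> S (u - v).
Proof. by move=> sS Su Sv; apply: ksubspaceD => //; exact: ksubspaceN. Qed.

Lemma ksubspace_sum S I (P : pred I) (F : I -> V) : ksubspace S ->
  (forall i, P i -> S (F i)) -> S (\sum_(i | P i) F i).
Proof.
by move=> sS SF; apply: big_ind => // [|u v]; [exact: ksubspace0|exact: ksubspaceD].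
Qed.

(** The matrix expressing g through h modulo S would otherwise have more rows than columns; a
    nonzero row vector killing it is a nontrivial relation between the g i modulo S. *)
Lemma indep_leq_spans S I J (g : I -> V) (h : J -> V) : ksubspace S ->
  indep S g -> spans S h -> (#|I| <= #|J|)%N.
Proof.
move=> sS gI hS; have [c hc] := choice (fun i => hS (g i)).
 rewrite leqNgt; apply/negP => ltJI.
pose M : 'M[k]_(#|I|, #|J|) := \matrix_(i, j) c (enum_val i) (enum_val j).
have : kermx M != 0.
  by rewrite kermx_eq0 -row_leq_rank -ltnNge (leq_ltn_trans (rank_leq_col _)).
case/rowV0Pn => v /sub_kermxP vM v0.
have vM0 j : \sum_i v 0 (enum_rank i) * c i j = 0.
  transitivity ((v *m M) 0 (enum_rank j)); last by rewrite vM mxE.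
  rewrite mxE (reindex (@enum_val _ I)) /=; last exact: onW_bij (@enum_val_bij I).
  by apply: eq_bigr => i _; rewrite mxE enum_valK enum_rankK.
have : S (\sum_i v 0 (enum_rank i) *: g i).
  rewrite (_ : \sum_i _ = \sum_i v 0 (enum_rank i) *: (g i - \sum_j c i j *: h j)).
    by apply: ksubspace_sum => // i _; apply: ksubspaceZ.
  under [RHS]eq_bigr do rewrite scalerBr.
  rewrite sumrB [X in _ - X](_ : _ = 0) ?subr0 //.
  under eq_bigr do rewrite scaler_sumr; rewrite exchange_big /= big1 // => j _.
  by under eq_bigr do rewrite scalerA; rewrite -scaler_suml vM0 scale0r.
move=> /gI v00; case/eqP: v0; apply/rowP => i.
by rewrite mxE -(v00 (enum_val i)) enum_valK.
Qed.

Lemma spans_ord S I (g : I -> V) : spans S g ->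
  spans S (fun i : 'I_#|I| => g (enum_val i)).
Proof.
move=> gS v; have [c Sc] := gS v; exists (c \o enum_val).
by move: Sc; rewrite (reindex (@enum_val _ I)) //; exact: onW_bij (@enum_val_bij I).
Qed.

Lemma spans_drop S m (g : 'I_m.+1 -> V) (i : 'I_m.+1) c : ksubspace S ->
  spans S g -> S (\sum_i c i *: g i) -> c i != 0 -> spans S (g \o lift i).
Proof.
move=> sS gS Sc ci v; have [b Sb] := gS v.
exists (fun j => b (lift i j) - b i / c i * c (lift i j)).
have := ksubspaceD sS Sb (ksubspaceZ sS (b i / c i) Sc).
rewrite (bigD1_ord i) //= (bigD1_ord i (F := fun j => c j *: g j)) //=.
rewrite scalerDr scalerA divfK // scaler_sumr.
rewrite -addrA [X in v + X](_ : _ = - \sum_(j < m)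
  (b (lift i j) - b i / c i * c (lift i j)) *: g (lift i j)) //.
rewrite opprD addrACA addNr add0r -!sumrN -big_split /=.
under [X in _ -> S (_ + X)]eq_bigr do rewrite scalerBl opprB addrC -scalerA.
exact.
Qed.

(** A spanning family of least size is independent: a relation with a nonzero coefficient would let
    one member be dropped. *)
Lemma basis_of_spans S I (g : I -> V) : ksubspace S -> spans S g ->
  exists m (h : 'I_m -> V), spans S h /\ indep S h.
Proof.
move=> sS gS.
have ex : exists m, `[< exists h : 'I_m -> V, spans S h >].
  by exists #|I|; apply/asboolP; eexists; exact: spans_ord gS.
case: (ex_minnP ex) => m /asboolP[h hS] mmin; exists m, h; split=> // c Sc i.
apply: contrapT => /eqP ci; case: m => [|m] in h hS mmin c Sc i ci *; first by case: i ci.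
have : (m < m)%N by apply/mmin/asboolP; eexists; exact: spans_drop hS Sc ci.
by rewrite ltnn.
Qed.

Definition kbasis S I (g : I -> V) := spans S g /\ indep S g.

Lemma kbasis_ord S I n (g : I -> V) : #|I| = n -> kbasis S g ->
  exists h : 'I_n -> V, kbasis S h.
Proof.
move=> <- [gS gI]; exists (g \o enum_val); split; first exact: spans_ord.
move=> c Sc i; have := gI (fun x => c (enum_rank x)) _ (enum_val i).
rewrite enum_valK => -> //; rewrite -sum_enum_val; congr S: Sc.
by apply: eq_bigr => j _; rewrite enum_valK.
Qed.

Lemma kbasis_card S I J (g : I -> V) (h : J -> V) : ksubspace S ->
  kbasis S g -> kbasis S h -> #|I| = #|J|.
Proof.
move=> sS [gS gI] [hS hI]; apply/eqP.
by rewrite eqn_leq (indep_leq_spans sS gI hS) (indep_leq_spans sS hI gS).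
Qed.

End LinearAlgebraModulo.

(** * Units, residue maps and the extended maximal ideal *)

Section Invertible.
Variable A : comPzRingType.
Implicit Types a b : A.

Lemma invertibleM a b : invertible a -> invertible b -> invertible (a * b).
Proof. by move=> [u au] [v bv]; exists (u * v); rewrite mulrACA au bv mulr1. Qed.

Lemma invertibleMl a b : invertible (a * b) -> invertible a.
Proof. by move=> [u au]; exists (b * u); rewrite mulrA. Qed.

Lemma invertibleMr a b : invertible (a * b) -> invertible b.
Proof. by rewrite mulrC; exact: invertibleMl. Qed.

Lemma invertible1 : invertible (1 : A).
Proof. by exists 1; rewrite mulr1. Qed.

Lemma invertible_lreg a b c : invertible a -> a * b = a * c -> b = c.
Proof.
by move=> [u au] e; rewrite -[b]mul1r -[c]mul1r -au mulrAC e mulrAC.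
Qed.

Lemma invertible_rmorph (B : comPzRingType) (h : {rmorphism A -> B}) a :
  invertible a -> invertible (h a).
Proof. by move=> [u au]; exists (h u); rewrite -rmorphM au rmorph1. Qed.

End Invertible.

Section Residue.
Variables (k : fieldType) (A : comAlgType k).

Definition residue (chi : {rmorphism A -> k}) : Prop :=
  (forall c : k, chi c%:A = c) /\ (forall a, chi a != 0 -> invertible a).

Lemma scalar_invertible (c : k) : c != 0 -> invertible (c%:A : A).
Proof. by move=> c0; exists (c^-1)%:A; rewrite -scalerAl mul1r scalerA divff // scale1r. Qed.

Lemma residue_invertible (chi : {rmorphism A -> k}) a :
  residue chi -> invertible a <-> chi a != 0.
Proof.
move=> [_ chiV]; split=> [[b ab]|]; last exact: chiV.
apply: contra_neq (oner_neq0 k) => chia.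
by rewrite -(rmorph1 chi) -ab rmorphM chia mul0r.
Qed.

Lemma residue_noninvertible (chi : {rmorphism A -> k}) a :
  residue chi -> ~ invertible a <-> chi a = 0.
Proof.
move=> rchi; split=> [na|chia /(residue_invertible _ rchi)]; last by rewrite chia eqxx.
by apply: contrapT => /eqP chia; apply/na/(residue_invertible _ rchi).
Qed.

(** In a local ring the nonunits form an ideal, so the scalar c for which a - c is a nonunit is
    unique. Uniqueness makes a |-> c a ring morphism. *)
Lemma residue_exists :
  (forall a : A, invertible a \/ invertible (1 - a)) ->
  (forall a : A, exists c : k, ~ invertible (a - c%:A)) ->
  exists chi : {rmorphism A -> k}, residue chi.
Proof.
move=> loc rat; have [f fP] := choice rat.
have nD (a b : A) : ~ invertible a -> ~ invertible b -> ~ invertible (a + b).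
  move=> na nb [u abu]; case: (loc (a * u)) => [/invertibleMl//|].
  by rewrite -abu mulrDl addrC addKr => /invertibleMl.
have nM (a b : A) : ~ invertible b -> ~ invertible (a * b) by move=> nb /invertibleMr.
have fU a c : ~ invertible (a - c%:A) -> f a = c.
  move=> nc; apply/eqP; rewrite -subr_eq0; apply: contrapT => /negP.
  move=> /scalar_invertible; have -> : (f a - c)%:A = (a - c%:A) + (-1) * (a - (f a)%:A).
    by rewrite mulN1r opprB [RHS]addrC subrKA scalerBl.
  by apply: nD => //; apply: nM; exact: fP.
have fB : zmod_morphism f.
  move=> a b; apply: fU.
  have -> : a - b - (f a - f b)%:A = (a - (f a)%:A) + (-1) * (b - (f b)%:A).
    by rewrite mulN1r !opprB scalerBl opprB addrACA [RHS]addrACA; congr (_ + _); rewrite addrC.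
  by apply: nD; [exact: fP|apply: nM; exact: fP].
have fM : monoid_morphism f.
  split; first by apply: fU; rewrite scale1r subrr => -[b] /eqP; rewrite mul0r eq_sym oner_eq0.
  move=> a b; apply: fU.
  have -> : a * b - (f a * f b)%:A = b * (a - (f a)%:A) + (f a)%:A * (b - (f b)%:A).
    by rewrite !mulrBr -scalerAl mul1r -scalerAr mulr1 -scalerAl mul1r scalerA mulrC addrA subrK.
  by apply: nD; apply: nM; exact: fP.
pose F : {rmorphism A -> k} := HB.pack f
  (GRing.isZmodMorphism.Build _ _ f fB) (GRing.isMonoidMorphism.Build _ _ f fM).
exists F; split=> [c|a fa].
  by apply: fU; rewrite subrr => -[b] /eqP; rewrite mul0r eq_sym oner_eq0.
by apply: contrapT => na; move/eqP: fa; apply; apply: fU; rewrite scale0r subr0.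
Qed.

End Residue.

Section ExtendedMaximalIdeal.
Variables (A B : comNzRingType) (phi : {rmorphism A -> B}).
Local Notation mB := (extended_maximal_ideal phi).

Lemma emi_gen a b : ~ invertible a -> mB (phi a * b).
Proof. by move=> na; exists 1%N, (fun=> a), (fun=> b); rewrite big_ord1. Qed.

Lemma emiD x y : mB x -> mB y -> mB (x + y).
Proof.
move=> [n [a [b [na ->]]]] [m [c [d [nc ->]]]].
exists (n + m)%N, (fun i => match fintype.split i with inl j => a j | inr j => c j end),
  (fun i => match fintype.split i with inl j => b j | inr j => d j end).
split=> [i|]; first by case: (fintype.split i).
by rewrite big_split_ord /=; congr (_ + _); apply: eq_bigr => i _;
  [rewrite (unsplitK (inl i))|rewrite (unsplitK (inr i))].
Qed.

Lemma emi0 : mB 0.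
Proof. by exists 0%N, (fun=> 0), (fun=> 0); split=> [[]|]//; rewrite big_ord0. Qed.

Lemma emiM b x : mB x -> mB (b * x).
Proof.
move=> [n [a [c [na ->]]]]; exists n, a, (fun i => b * c i); split=> //.
by rewrite mulr_sumr; apply: eq_bigr => i _; rewrite mulrCA.
Qed.

Lemma emiN x : mB x -> mB (- x).
Proof. by rewrite -mulN1r; exact: emiM. Qed.

Lemma emi_min (P : set B) : P 0 -> (forall x y, P x -> P y -> P (x + y)) ->
  (forall a b, ~ invertible a -> P (phi a * b)) -> mB `<=` P.
Proof.
move=> P0 PD Pg x [n [a [c [na ->]]]].
by apply: big_ind => // i _; exact: Pg.
Qed.

End ExtendedMaximalIdeal.

(** The equational criterion of flatness: every A-linear relation in B is a consequence of relations
    in A. All later uses of flatness go through this form. *)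
Definition equational (A B : comNzRingType) (phi : A -> B) : Prop :=
  forall (I : finType) (a : I -> A) (b : I -> B),
    \sum_i phi (a i) * b i = 0 ->
    exists (m : nat) (c : I -> 'I_m -> A) (b' : 'I_m -> B),
      (forall j, \sum_i a i * c i j = 0) /\
      (forall i, b i = \sum_j phi (c i j) * b' j).

Lemma equational_ord (A B : comNzRingType) (phi : A -> B) :
  (forall n (a : 'I_n -> A) (b : 'I_n -> B), \sum_i phi (a i) * b i = 0 ->
    exists (m : nat) (c : 'I_n -> 'I_m -> A) (b' : 'I_m -> B),
      (forall j, \sum_i a i * c i j = 0) /\
      (forall i, b i = \sum_j phi (c i j) * b' j)) ->
  equational phi.
Proof.
move=> EC I a b; rewrite -sum_enum_val => /EC[m [c [b' [ac bc]]]].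
exists m, (fun i => c (enum_rank i)), b'; split=> [j|i].
  by rewrite -sum_enum_val -[RHS](ac j); apply: eq_bigr => i _; rewrite enum_valK.
by rewrite -bc enum_rankK.
Qed.

Lemma equational_id (A : comNzRingType) (phi : A -> A) : phi =1 id -> equational phi.
Proof.
move=> phiE; apply: equational_ord => n a b ab.
exists 1%N, (fun i _ => b i), (fun=> 1); split=> [_|i].
  by rewrite -[RHS]ab; apply: eq_bigr => i _; rewrite phiE.
by rewrite big_ord1 phiE mulr1.
Qed.

(** Trivializing a relation through psi leaves m relations with coefficients in B, and each of them
    is trivialized through phi. The new index set is the disjoint union over these m relations. *)
Lemma equational_comp (A B C : comNzRingType) (phi : {rmorphism A -> B})
    (psi : {rmorphism B -> C}) :
  equational phi -> equational psi -> equational (psi \o phi).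
Proof.
move=> Ephi Epsi; apply: equational_ord => n a b /=.
move=> /(Epsi _ (phi \o a))[m [c [b' [ac bc]]]].
have /choice[p pP] : forall j : 'I_m, exists (p : {q : nat & ('I_n -> 'I_q -> A) * ('I_q -> B)}%type),
    (forall l, \sum_i a i * (projT2 p).1 i l = 0) /\
    (forall i, c i j = \sum_l phi ((projT2 p).1 i l) * (projT2 p).2 l).
  by move=> j; have [q [g [h gh]]] := Ephi _ _ _ (ac j); exists (existT _ q (g, h)).
pose J : finType := {j : 'I_m & 'I_(projT1 (p j))}.
pose g i (x : J) := (projT2 (p (tag x))).1 i (tagged x).
pose h (x : J) := psi ((projT2 (p (tag x))).2 (tagged x)) * b' (tag x).
exists #|J|, (fun i x => g i (enum_val x)), (fun x => h (enum_val x)); split=> [x|i].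
  by rewrite (pP _).1.
rewrite bc (sum_enum_val (fun x : J => psi (phi (g i x)) * h x)).
rewrite -(@sig_big_dep _ _ _ _ (fun j => 'I_(projT1 (p j))) xpredT (fun _ _ => true)
  (fun j l => psi (phi ((projT2 (p j)).1 i l)) * (psi ((projT2 (p j)).2 l) * b' j))) /=.
apply: eq_bigr => j _; rewrite (pP j).2 rmorph_sum mulr_suml.
by apply: eq_bigr => l _; rewrite rmorphM mulrA.
Qed.

(** * Flatness *)

Section FlatEquational.
Import Quotient.
Local Open Scope quotient_scope.

Variables (A B : comNzRingType) (phi : {rmorphism A -> B}).
Variables (n : nat) (a : 'I_n -> A).

Definition gen_ideal : {pred A^o} :=
  fun x => `[< exists c : 'I_n -> A, x = \sum_i c i * a i >].

Lemma gen_ideal_closed : submod_closed gen_ideal.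
Proof.
split; first by apply/asboolP; exists (fun=> 0); rewrite big1 // => i _; rewrite mul0r.
move=> r x y /asboolP[c ->] /asboolP[d ->]; apply/asboolP.
exists (fun i => r * c i + d i); rewrite scaler_sumr -big_split /=.
by apply: eq_bigr => i _; rewrite mulrDl -mulrA.
Qed.
HB.instance Definition _ := GRing.isSubmodClosed.Build A A^o gen_ideal gen_ideal_closed.

Definition gen_ideal_mod := {x : A^o | x \in gen_ideal}.
HB.instance Definition _ := SubChoice.on gen_ideal_mod.
HB.instance Definition _ := [SubChoice_isSubLmodule of gen_ideal_mod by <:].

(** The image in B^n of (relations between the a i) tensor B. By right exactness, B^n modulo this
    subgroup is I tensor B for I the ideal generated by a. *)
Definition syzygies : {pred {ffun 'I_n -> B}} :=
  fun v => `[< exists (m : nat) (c : 'I_n -> 'I_m -> A) (b' : 'I_m -> B),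
      (forall j, \sum_i a i * c i j = 0) /\
      (forall i, v i = \sum_j phi (c i j) * b' j) >].

Lemma syzygies_closed : zmod_closed syzygies.
Proof.
split.
  apply/asboolP; exists 0%N, (fun _ _ => 0), (fun=> 0); split=> [[]//|i].
  by rewrite ffunE big_ord0.
move=> u v /asboolP[m [c [b [ac ub]]]] /asboolP[q [d [e [ad ve]]]]; apply/asboolP.
exists (m + q)%N, (fun i j => match fintype.split j with inl l => c i l | inr l => d i l end),
  (fun j => match fintype.split j with inl l => b l | inr l => - e l end); split=> [j|i].
  by case: (fintype.split j) => l; [exact: ac|exact: ad].
rewrite !ffunE ub ve big_split_ord /= -sumrN; congr (_ + _); apply: eq_bigr => j _.
  by rewrite (unsplitK (inl j)).
by rewrite (unsplitK (inr j)) mulrN.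
Qed.
HB.instance Definition _ := GRing.isZmodClosed.Build _ syzygies syzygies_closed.

Definition ideal_tensor := quot syzygies.
HB.instance Definition _ := GRing.Zmodule.on ideal_tensor.

Let coef_exists (x : gen_ideal_mod) : exists c : 'I_n -> A, val x = \sum_i c i * a i.
Proof. by have /asboolP := valP x. Qed.

Let coef x := sval (cid (coef_exists x)).

Let coefE x : val x = \sum_i coef x i * a i.
Proof. exact: svalP (cid (coef_exists x)). Qed.

Let scol (x : gen_ideal_mod) (b : B) : {ffun 'I_n -> B} :=
  [ffun i => phi (coef x i) * b].

Definition ideal_tau (x : gen_ideal_mod) (b : B) : ideal_tensor :=
  \pi_(quot syzygies) (scol x b).

Let tensor_eq (u v : {ffun 'I_n -> B}) :
  u - v \in syzygies -> \pi_(quot syzygies) u = \pi_(quot syzygies) v.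
Proof. by rewrite idealrBE => /eqP. Qed.

Let syz1 (c : 'I_n -> A) b : \sum_i a i * c i = 0 ->
  [ffun i => phi (c i) * b] \in syzygies.
Proof.
move=> ac; apply/asboolP; exists 1%N, (fun i _ => c i), (fun=> b).
by split=> // i; rewrite big_ord1 ffunE.
Qed.

(** Two ways of writing x on the generators differ by a relation between them, so the coefficients
    chosen in [ideal_tau] do not matter. *)
Lemma ideal_tau_eq (x : gen_ideal_mod) (b : B) c : val x = \sum_i c i * a i ->
  ideal_tau x b = \pi_(quot syzygies) [ffun i => phi (c i) * b].
Proof.
move=> xc; apply: tensor_eq.
rewrite (_ : _ - _ = [ffun i => phi (coef x i - c i) * b]).
  apply: syz1; under eq_bigr do rewrite mulrC mulrBl.
  by rewrite sumrB -(coefE x) xc subrr.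
by apply/ffunP => i; rewrite !ffunE rmorphB mulrBl.
Qed.

Lemma ideal_tau_balanced : balanced phi ideal_tau.
Proof.
split=> [x y b|x b b'|r x b].
- rewrite (@ideal_tau_eq (x + y) b (fun i => coef x i + coef y i)).
    rewrite /ideal_tau -raddfD /=; congr (\pi _); apply/ffunP => i.
    by rewrite !ffunE rmorphD mulrDl.
  rewrite raddfD /= (coefE x) (coefE y) -big_split /=.
  by apply: eq_bigr => i _; rewrite mulrDl.
- rewrite /ideal_tau -raddfD /=; congr (\pi _); apply/ffunP => i.
  by rewrite !ffunE mulrDr.
- rewrite (@ideal_tau_eq (r *: x) b (fun i => r * coef x i)).
    rewrite /ideal_tau; congr (\pi _); apply/ffunP => i.
    by rewrite !ffunE rmorphM mulrA (mulrC (phi r)).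
  rewrite linearZ /= (coefE x) scaler_sumr.
  by apply: eq_bigr => i _; rewrite -mulrA.
Qed.

Let gen_in i : (a i : A^o) \in gen_ideal.
Proof.
apply/asboolP; exists (fun j => (j == i)%:R).
by rewrite (bigD1 i) //= eqxx mul1r big1 ?addr0 // => j /negPf->; rewrite mul0r.
Qed.

Let gen i : gen_ideal_mod := exist _ (a i : A^o) (gen_in i).

Let pi_gen (v : {ffun 'I_n -> B}) :
  \pi_(quot syzygies) v = \sum_i ideal_tau (gen i) (v i).
Proof.
under eq_bigr => i _.
  rewrite (@ideal_tau_eq (gen i) (v i) (fun j => (j == i)%:R)); last first.
    by rewrite (bigD1 i) //= eqxx mul1r big1 ?addr0 // => j /negPf->; rewrite mul0r.
  over.
rewrite -raddf_sum /=; congr (\pi _); apply/ffunP => i; rewrite sum_ffunE.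
rewrite (bigD1 i) //= ffunE eqxx rmorph1 mul1r big1 ?addr0 // => j /negPf ji.
by rewrite ffunE eq_sym ji rmorph0 mul0r.
Qed.

Let balanced_sum (M : lmodType A) (T : zmodType) (tau : M -> B -> T) :
  balanced phi tau -> (forall b, tau 0 b = 0) /\ (forall m, tau m 0 = 0).
Proof.
move=> [Dl Dr Z]; split=> [b|m].
  by apply: (addrI (tau 0 b)); rewrite -Dl !addr0.
by apply: (addrI (tau m 0)); rewrite -Dr !addr0.
Qed.

Lemma ideal_tau_tensor : is_tensor phi ideal_tau.
Proof.
split; first exact: ideal_tau_balanced.
move=> T' tau' bal'; have [Dl' Dr' Z'] := bal'.
have [tau'0l tau'0r] := balanced_sum bal'.
have taul (I : finType) (F : I -> gen_ideal_mod) b :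
    tau' (\sum_i F i) b = \sum_i tau' (F i) b.
  by apply: (big_morph (fun x => tau' x b)) => [x y|]; rewrite ?Dl'.
have taur (I : finType) x (F : I -> B) :
    tau' x (\sum_i F i) = \sum_i tau' x (F i).
  by apply: (big_morph (tau' x)) => [b b'|]; rewrite ?Dr'.
(* The factorization is defined on representatives; [hK] says that it vanishes on syzygies, and
   [hpi] that any representative may be used. *)
pose h (t : ideal_tensor) : T' := \sum_i tau' (gen i) ((repr (t : quot syzygies)) i).
have hK v : v \in syzygies -> \sum_i tau' (gen i) (v i) = 0.
  move=> /asboolP[m [c [b [ac vb]]]].
  under eq_bigr do rewrite vb taur; rewrite exchange_big big1 //= => j _.
  under eq_bigr do rewrite -Z'; rewrite -taul [X in tau' X _](_ : _ = 0) //.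
  apply: val_inj; rewrite raddf_sum /= -[RHS](ac j).
  by apply: eq_bigr => i _; rewrite mulrC.
have tauB x b b' : tau' x (b - b') = tau' x b - tau' x b'.
  by apply/eqP; rewrite eq_sym subr_eq -Dr' subrK.
have hpi v : h (\pi_(quot syzygies) v) = \sum_i tau' (gen i) (v i).
  apply/eqP; rewrite /h -subr_eq0 -sumrB; apply/eqP.
  rewrite -[RHS](hK (repr (\pi_(quot syzygies) v) - v)).
    by apply: eq_bigr => i _; rewrite !ffunE tauB.
  by rewrite idealrBE reprK.
exists h; split; first split.
- move=> s t; rewrite -[s]reprK -[t]reprK -raddfB /= !hpi -sumrB.
  by apply: eq_bigr => i _; rewrite !ffunE tauB.
- move=> x b; rewrite /ideal_tau hpi.
  under eq_bigr do rewrite ffunE -Z'; rewrite -taul; congr (tau' _ b).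
  by apply: val_inj; rewrite raddf_sum /= (coefE x).
- move=> h' [h'B h'tau]; apply/funext => t; rewrite -[t]reprK hpi pi_gen.
  pose H : {additive ideal_tensor -> T'} := HB.pack h' (GRing.isZmodMorphism.Build _ _ h' h'B).
  by rewrite -[h']/(H : _ -> _) raddf_sum; apply: eq_bigr => i _; rewrite -h'tau.
Qed.

Lemma regular_tensor : is_tensor phi (fun (x : A^o) (b : B) => phi x * b).
Proof.
split; first by split=> *; rewrite ?rmorphD ?mulrDl ?mulrDr ?rmorphM ?mulrA // (mulrC (phi _)).
move=> T' tau' bal'; have [Dl' Dr' Z'] := bal'.
have tauB x b b' : tau' x (b - b') = tau' x b - tau' x b'.
  by apply/eqP; rewrite eq_sym subr_eq -Dr' subrK.
exists (tau' 1); split; first by split=> [b b'|x b]; rewrite ?tauB // -Z'; congr (tau' _ b); exact: mulr1.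
by move=> h [_ ht]; apply/funext => b; rewrite -ht rmorph1 mul1r.
Qed.

(** Flatness for the inclusion of I in A makes I tensor B -> A tensor B = B injective. The relation
    says that the class of b is sent to 0, hence b is a syzygy. *)
Lemma flat_equational_aux (b : 'I_n -> B) : flat_morphism_of_rings phi ->
  \sum_i phi (a i) * b i = 0 -> [ffun i => b i] \in syzygies.
Proof.
move=> flat ab.
have bal : balanced phi (fun (x : gen_ideal_mod) (c : B) => phi (val x) * c).
  split=> [x y c|x c c'|r x c].
  - by rewrite -mulrDl -rmorphD.
  - by rewrite mulrDr.
  - by rewrite mulrA [X in _ = X * c]mulrC -rmorphM.
have [h [[hB htau] _]] := ideal_tau_tensor.2 _ _ bal.
have hinj := flat _ _ (val : {linear gen_ideal_mod -> A^o}) val_inj _ _ _ _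
  ideal_tau_tensor regular_tensor h hB htau.
rewrite -[X in X \in _]subr0 idealrBE; apply/eqP/hinj; rewrite !pi_gen.
pose H : {additive ideal_tensor -> B} := HB.pack h (GRing.isZmodMorphism.Build _ _ h hB).
rewrite -[h]/(H : _ -> _) !raddf_sum [RHS]big1 => [|i _].
  by rewrite -[RHS]ab; apply: eq_bigr => i _; rewrite ffunE /= htau.
by rewrite /= htau ffunE mulr0.
Qed.

End FlatEquational.

Lemma flat_equational (A B : comNzRingType) (phi : {rmorphism A -> B}) :
  flat_morphism_of_rings phi -> equational phi.
Proof.
move=> flat; apply: equational_ord => n a b /(flat_equational_aux flat)/asboolP.
by move=> [m [c [b' [ac bc]]]]; exists m, c, b'; split=> // i; rewrite -bc ffunE.
Qed.

(** * Finite algebras over a local ring with residue field k *)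

Section AlgebraMorphisms.
Variable k : fieldType.

Lemma scale_alg (A : comAlgType k) (c : k) (x : A) : c *: x = c%:A * x.
Proof. by rewrite -scalerAl mul1r. Qed.

Lemma lrmorph_alg (A B : comAlgType k) (h : {lrmorphism A -> B}) (c : k) :
  h c%:A = c%:A.
Proof. by rewrite linearZ /= rmorph1. Qed.

Lemma lrmorph_horner (A B : comAlgType k) (h : {lrmorphism A -> B}) P x :
  h (horner_alg x P) = horner_alg (h x) P.
Proof.
elim/poly_ind: P => [|P c IH]; first by rewrite !rmorph0.
by rewrite !rmorphD !rmorphM /= IH !horner_algX !horner_algC lrmorph_alg.
Qed.

Lemma residue_horner (A : comAlgType k) (chi : {rmorphism A -> k}) P x :
  residue chi -> chi (horner_alg x P) = P.[chi x].
Proof.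
move=> [chiA _]; elim/poly_ind: P => [|P c IH]; first by rewrite horner0 !rmorph0.
rewrite rmorphD rmorphM /= horner_algX horner_algC rmorphD rmorphM /= chiA IH.
by rewrite hornerD hornerM hornerX hornerC.
Qed.

Lemma emi_lgen (A B : comAlgType k) (phi : {lrmorphism A -> B}) a b :
  ~ invertible a -> extended_maximal_ideal phi (phi a * b).
Proof. exact: emi_gen. Qed.

Lemma emi_lmin (A B : comAlgType k) (phi : {lrmorphism A -> B}) (P : set B) :
  P 0 -> (forall x y, P x -> P y -> P (x + y)) ->
  (forall a b, ~ invertible a -> P (phi a * b)) ->
  extended_maximal_ideal phi `<=` P.
Proof. exact: emi_min. Qed.

Lemma emi_ksubspace (A B : comAlgType k) (phi : {rmorphism A -> B}) :
  ksubspace (extended_maximal_ideal phi).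
Proof.
split; [exact: emi0|exact: emiD|].
by move=> c u mu; rewrite scale_alg; exact: emiM.
Qed.

Section Residue.
Variables (A B : comAlgType k) (phi : {lrmorphism A -> B}) (chi : {rmorphism A -> k}).
Hypothesis chi_res : residue chi.
Local Notation m := (extended_maximal_ideal phi).

Lemma emi_residue a b : m (phi a * b - chi a *: b).
Proof.
rewrite scale_alg -(lrmorph_alg phi) -mulrBl -rmorphB; apply: emi_gen.
by apply/(residue_noninvertible _ chi_res); rewrite rmorphB chi_res.1 subrr.
Qed.

Lemma emi_residue_sum I (a : I -> A) (b : I -> B) (r : seq I) :
  m (\sum_(i <- r) phi (a i) * b i - \sum_(i <- r) chi (a i) *: b i).
Proof.
rewrite -sumrB; apply: big_ind => [|x y|i _]; [exact: emi0|exact: emiD|].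
exact: emi_residue.
Qed.

Lemma emi_proper (rho : {rmorphism B -> k}) :
  (forall a, rho (phi a) = chi a) -> m `<=` [set b | rho b = 0].
Proof.
move=> rhophi; apply: emi_min => /= [|x y|a b]; first exact: rmorph0.
  by rewrite rmorphD => -> ->; rewrite addr0.
by move=> /(residue_noninvertible _ chi_res) chia; rewrite rmorphM rhophi chia mul0r.
Qed.

(** Modulo m, a coefficient a in A acts as the scalar chi a, which turns conditions on coefficients
    in A into linear algebra over k. *)
Lemma fiber_dim_kbasis n : fiber_dim phi n <-> exists g : 'I_n -> B, kbasis m g.
Proof.
have sm := emi_ksubspace phi.
split=> -[e [gen ind]]; exists e; split.
- move=> v; have [a ma] := gen v; exists (chi \o a).
  rewrite -[v](subrK (\sum_i phi (a i) * e i)) -addrA.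
  exact: (ksubspaceD sm ma (emi_residue_sum a e _)).
- move=> c mc i; rewrite -[c i]chi_res.1.
  apply/(residue_noninvertible _ chi_res)/(ind (fun i => (c i)%:A)).
  by rewrite (eq_bigr (fun i => c i *: e i)) // => j _; rewrite [RHS]scale_alg -(lrmorph_alg phi).
- move=> v; have [c mc] := gen v; exists (fun i => (c i)%:A).
  by rewrite (eq_bigr (fun i => c i *: e i)) // => j _; rewrite [RHS]scale_alg -(lrmorph_alg phi).
- move=> a ma i; apply/(residue_noninvertible _ chi_res)/(ind (chi \o a)).
  rewrite -[X in m X](subKr (\sum_i phi (a i) * e i)).
  by apply: ksubspaceB => //; exact: (emi_residue_sum a e).
Qed.

End Residue.
End AlgebraMorphisms.

Section FiniteAlgebra.
Variables (k : closedFieldType) (A B : comAlgType k) (phi : {lrmorphism A -> B}).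
Variable chi : {rmorphism A -> k}.
Hypothesis chi_res : residue chi.
Variables (n : nat) (e : 'I_n -> B).
Hypothesis e_gen : forall b, exists a : 'I_n -> A, b = \sum_i phi (a i) * e i.
Local Notation m := (extended_maximal_ideal phi).

Lemma emi_coef b : m b ->
  exists a : 'I_n -> A, (forall i, chi (a i) = 0) /\ b = \sum_i phi (a i) * e i.
Proof.
move: b; apply: emi_min => [|x y [a [a0 ->]] [c [c0 ->]]|a b na].
- exists (fun=> 0); split=> [i|]; first exact: rmorph0.
  by rewrite big1 // => i _; rewrite rmorph0 mul0r.
- exists (fun i => a i + c i); split=> [i|]; first by rewrite rmorphD a0 c0 addr0.
  by rewrite -big_split; apply: eq_bigr => i _; rewrite rmorphD mulrDl.
- have [c ->] := e_gen b; exists (fun i => a * c i); split=> [i|].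
    by rewrite rmorphM (iffLR (residue_noninvertible _ chi_res) na) mul0r.
  by rewrite mulr_sumr; apply: eq_bigr => i _; rewrite rmorphM mulrA.
Qed.

(** Determinant trick: e i - j i has coordinates a i l in the maximal ideal, so N = 1 - a sends the
    e l to elements j i of J. Its determinant has residue 1, hence is a unit, and the adjugate of N
    expresses the e i through the j l. *)
Lemma nakayama (J : set B) : J 0 -> (forall x y, J x -> J y -> J (x + y)) ->
  (forall a x, J x -> J (phi a * x)) ->
  (forall b, exists2 j, J j & m (b - j)) -> forall b, J b.
Proof.
move=> J0 JD JA Jm.
have Jsum (I : finType) (F : I -> B) : (forall i, J (F i)) -> J (\sum_i F i).
  by move=> JF; apply: big_ind.
have /choice[j jP] : forall i, exists j, J j /\ m (e i - j).
  by move=> i; have [j Jj mj] := Jm (e i); exists j.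
have /choice[a aP] := fun i => emi_coef (jP i).2.
pose N : 'M[A]_n := \matrix_(i, l) ((i == l)%:R - a i l).
have Ne i : \sum_l phi (N i l) * e l = j i.
  under eq_bigr do rewrite mxE rmorphB mulrBl.
  rewrite sumrB -(aP i).2 (bigD1 i) //= eqxx rmorph1 mul1r big1 ?addr0 ?subKr //.
  by move=> l /negPf li; rewrite eq_sym li rmorph0 mul0r.
have [u detu] : invertible (\det N).
  apply: chi_res.2; rewrite -det_map_mx (_ : map_mx _ _ = 1%:M) ?det1 ?oner_eq0 //.
  by apply/matrixP => i l; rewrite !mxE rmorphB rmorph_nat (aP i).1 subr0.
have Je i : J (e i).
  have -> : e i = phi u * \sum_l phi (\adj N i l) * j l.
    under eq_bigr do rewrite -Ne mulr_sumr; rewrite exchange_big /=.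
    have -> : \sum_l \sum_l' phi (\adj N i l') * (phi (N l' l) * e l) =
        \sum_l phi ((\adj N *m N) i l) * e l.
      apply: eq_bigr => l _; rewrite mxE rmorph_sum mulr_suml.
      by apply: eq_bigr => l' _; rewrite mulrA rmorphM.
    rewrite mul_adj_mx (bigD1 i) //= mxE eqxx mulr1n big1 ?addr0 => [|l /negPf li].
      by rewrite mulrA -rmorphM [u * _]mulrC detu rmorph1 mul1r.
    by rewrite mxE eq_sym li rmorph0 mul0r.
  by apply: (JA); apply: (Jsum) => l; apply: (JA); exact: (jP l).1.
by move=> b; have [c ->] := e_gen b; apply: Jsum => i; apply: JA.
Qed.

Lemma spans_gen : spans m e.
Proof.
by move=> b; have [a ->] := e_gen b; exists (chi \o a); exact: (emi_residue_sum phi chi_res).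
Qed.

Lemma polynomial_relation b : exists P : {poly k},
  [/\ P != 0, (size P <= n.+1)%N & m (horner_alg b P)].
Proof.
have : ~ indep m (fun i : 'I_n.+1 => b ^+ i).
  move=> bI; have := indep_leq_spans (emi_ksubspace phi) bI spans_gen.
  by rewrite !card_ord ltnn.
move=> /existsNP[c /not_implyP[mc /existsNP[i /eqP ci]]].
exists (\poly_(i < n.+1) c (inord i)); split; last 2 first.
- exact: size_poly.
- rewrite poly_def raddf_sum /=; congr m: mc; apply: eq_bigr => l _.
  by rewrite inord_val linearZ /= rmorphXn /= horner_algX scale_alg.
- apply: contra_neq ci => /polyP/(_ i).
  by rewrite coef_poly ltn_ord coef0 inord_val.
Qed.

(** The powers 1, b, ..., b^n are dependent modulo m; q is what remains of the relation after
    division by the largest power of X. Since q(0) is nonzero, q(b) is a unit wherever b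
    vanishes. *)
Lemma polynomial_relation0 b : exists (i : nat) (q : {poly k}),
  [/\ (i <= n)%N, q.[0] != 0 & m (horner_alg b q * b ^+ i)].
Proof.
have [P [P0 sP mP]] := polynomial_relation b.
have [i [q q0 Pq]] := multiplicity_XsubC P 0.
move: q0; rewrite P0 /= rootE => q0; rewrite subr0 in Pq.
exists i, q; split=> //; last by move: mP; rewrite Pq rmorphM rmorphXn /= horner_algX.
have qn0 : q != 0 by apply: contraNneq q0 => ->; rewrite horner0.
move: sP; rewrite Pq size_mulXn //; move: qn0; rewrite -size_poly_gt0.
by case: (size q) => // s _; rewrite addnS ltnS => /(leq_trans (leq_addr _ _)).
Qed.

End FiniteAlgebra.

(** * Fibres of finite flat algebras *)

Section Fiber.
Variables (k : closedFieldType) (A B : comAlgType k) (phi : {lrmorphism A -> B}).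
Variable chi : {rmorphism A -> k}.
Hypothesis chi_res : residue chi.
Variables (n : nat) (e : 'I_n -> B).
Hypothesis e_gen : forall b, exists a : 'I_n -> A, b = \sum_i phi (a i) * e i.

(* Y is the fibre over the closed point of A, O y the local ring at y, kappa the
   localization map B -> O y. *)
Variables (Y : Type) (O : Y -> comAlgType k).
Variables (kappa : forall y, {lrmorphism B -> O y}) (mu : forall y, {lrmorphism A -> O y}).
Variable rho : forall y, {rmorphism O y -> k}.
Hypothesis muE : forall y a, mu y a = kappa y (phi a).
Hypothesis rho_res : forall y, residue (rho y).
Hypothesis rho_mu : forall y a, rho y (mu y a) = chi a.
Hypothesis kappa_inj : forall y, injective (kappa y).
Hypothesis kappa_frac : forall y l, exists b t,
  invertible (kappa y t) /\ kappa y t * l = kappa y b.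
Hypothesis kappa_sep : forall y y', y <> y' ->
  exists b, rho y (kappa y b) != 0 /\ rho y' (kappa y' b) = 0.
Hypothesis kappa_cover : forall J : set B, J 0 ->
  (forall x y, J x -> J y -> J (x + y)) -> (forall b x, J x -> J (b * x)) ->
  (forall y, exists2 b, J b & invertible (kappa y b)) -> J 1.
Hypothesis mu_eq : forall y, equational (mu y).

Local Notation m := (extended_maximal_ideal phi).
Local Notation mO y := (extended_maximal_ideal (mu y)).

Lemma emi_kappa y b : m b -> mO y (kappa y b).
Proof.
move: b; apply: emi_lmin => [|b b' mb mb'|a b na].
- by rewrite rmorph0; exact: emi0.
- by rewrite rmorphD; exact: emiD.
- by rewrite rmorphM /= -muE; exact: emi_lgen.
Qed.

Lemma emi_rho y l : mO y l -> rho y l = 0.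
Proof. by move: l; exact: (emi_proper chi_res (rho_mu y)). Qed.

Lemma emi_mem_units y l u : invertible u -> mO y (u * l) -> mO y l.
Proof. by move=> [v uv] /(emiM v); rewrite mulrA [v * u]mulrC uv mul1r. Qed.

(** In q(b) b^i the factor q(b) has residue q(0) at y and can be cancelled. The exponent n is
    uniform in y and b because i <= n. *)
Lemma kappa_nilpotent y b : rho y (kappa y b) = 0 -> mO y (kappa y b ^+ n).
Proof.
move=> rb; have [i [q [lein q0 mq]]] := polynomial_relation0 chi_res e_gen b.
have := emi_kappa y mq; rewrite rmorphM /= lrmorph_horner rmorphXn /=.
move=> /emi_mem_units mi; rewrite -(subnK lein) exprD; apply/emiM/mi/(rho_res y).2.
by rewrite residue_horner // rb.
Qed.

(** Denominators can be removed modulo the extended ideal: for a unit t, the relation q(t) = 0 with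
    q = q(0) + q1 X shows that the inverse of t is - q1(t) / q(0). *)
Lemma kappa_surj y l : exists b, mO y (l - kappa y b).
Proof.
have [b [t [ut tl]]] := kappa_frac l.
have [i [q [lein q0 mq]]] := polynomial_relation0 chi_res e_gen t.
have mq' : mO y (horner_alg (kappa y t) q).
  have := emi_kappa y mq; rewrite rmorphM /= lrmorph_horner rmorphXn /= mulrC.
  apply: emi_mem_units; elim: (i) => [|j IH]; first exact: invertible1.
  by rewrite exprS; exact: invertibleM.
have /factor_theorem[q1 qq1] : root (q - q.[0]%:P) 0.
  by rewrite rootE !hornerE subrr.
rewrite subr0 in qq1; move/eqP: qq1; rewrite subr_eq => /eqP qq1.
exists (- (q.[0])^-1 *: (b * horner_alg t q1)).
have hq : horner_alg (kappa y t) q = horner_alg (kappa y t) q1 * kappa y t + q.[0]%:A.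
  by rewrite {1}qq1 rmorphD rmorphM /= horner_algX horner_algC.
have := emiM (q.[0]^-1%:A * l) mq'; congr (mO y _).
rewrite hq mulrDr addrC.
congr (_ + _).
  by rewrite mulrAC -scale_alg scalerA mulVf // scale1r mul1r.
rewrite scaleNr raddfN /= opprK linearZ /= rmorphM /= lrmorph_horner -tl [RHS]scale_alg.
rewrite -!mulrA; congr (_ * _).
by rewrite [LHS]mulrCA [RHS]mulrA [RHS]mulrC; congr (_ * _); exact: mulrC.
Qed.

(** The t with t b in m form an ideal. Clearing denominators at y puts into it an element invertible
    at y, so [kappa_cover] puts 1 into it. *)
Lemma emi_local b : (forall y, mO y (kappa y b)) -> m b.
Proof.
move=> mb; rewrite -[b]mul1r.
have fracs y l : mO y l -> exists t b', [/\ invertible (kappa y t), kappa y t * l = kappa y b' & m b'].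
  move: l; apply: emi_lmin => [|l l' [t [c [ut tl mc]]] [t' [c' [ut' tl' mc']]]|a l na].
  - exists 1, 0; split; [exact/invertible_rmorph/invertible1| |exact: emi0].
    by rewrite mulr0 rmorph0.
  - exists (t * t'), (t' * c + t * c'); split.
    + by rewrite rmorphM; exact: invertibleM.
    + rewrite rmorphM mulrDr rmorphD !rmorphM /= -tl -tl' mulrAC -mulrA.
      by rewrite [_ * (_ * l)]mulrCA !mulrA; congr (_ + _); rewrite mulrAC.
    + by apply: emiD; exact: emiM.
  - have [c [t [ut tl]]] := kappa_frac l; exists t, (phi a * c); split=> //.
      by rewrite muE rmorphM /= -tl mulrCA.
    exact: emi_lgen.
apply: (kappa_cover (J := [set t | m (t * b)])) => /=.
- by rewrite mul0r; exact: emi0.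
- by move=> x y mx my; rewrite mulrDl; exact: emiD.
- by move=> c x mx; rewrite -mulrA; exact: emiM.
- move=> y; have [t [b' [ut tb mb']]] := fracs y _ (mb y); exists t => //.
  by have -> : t * b = b' by apply: (@kappa_inj y); rewrite rmorphM.
Qed.

(** Substitutes for the idempotents of the fibre algebra. An element that is a unit at z i and
    vanishes at z j has an n-th power in the extended ideal at z j; eps i is the product of these
    powers over j. *)
Lemma separating_family (I : finType) (z : I -> Y) : injective z ->
  exists eps : I -> B, forall i, invertible (kappa (z i) (eps i)) /\
    forall j, j != i -> mO (z j) (kappa (z j) (eps i)).
Proof.
move=> zI.
have /choice[s sP] : forall p : I * I, exists b, p.1 != p.2 ->
    rho (z p.1) (kappa (z p.1) b) != 0 /\ rho (z p.2) (kappa (z p.2) b) = 0.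
  move=> [i j] /=; have [->|ij] := eqVneq i j; first by exists 0.
  have [b bP] : exists b, rho (z i) (kappa (z i) b) != 0 /\ rho (z j) (kappa (z j) b) = 0.
    by apply: kappa_sep => /zI/eqP; apply/negP.
  by exists b.
exists (fun i => \prod_(j | i != j) s (i, j) ^+ n) => i; split.
  apply: (rho_res _).2; rewrite !rmorph_prod; apply/prodf_neq0 => j ij.
  by rewrite !rmorphXn expf_neq0 //; exact: (sP (i, j) ij).1.
move=> j; rewrite eq_sym => ij; rewrite (bigD1 j) //= rmorphM mulrC; apply: emiM.
by rewrite rmorphXn; apply: kappa_nilpotent; exact: (sP (i, j) ij).2.
Qed.

(** The separating elements of s points are independent modulo m, as evaluation at z i isolates the
    i-th coefficient, while the e i span. *)
Lemma fiber_card s (z : 'I_s -> Y) : injective z -> (s <= n)%N.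
Proof.
move=> zI; have [eps epsP] := separating_family zI.
rewrite -[s]card_ord -[n]card_ord.
apply: (@indep_leq_spans _ _ m _ _ eps e (emi_ksubspace phi)); last exact: (spans_gen chi_res e_gen).
move=> c /(emi_kappa) mc i; have := emi_rho (mc (z i)).
rewrite !rmorph_sum (bigD1 i) //= big1 ?addr0 => [|j ji].
  rewrite linearZ /= scale_alg rmorphM (rho_res _).1 => /eqP.
  rewrite mulf_eq0 => /orP[/eqP//|]; apply: contraTeq => _.
  exact/(residue_invertible _ (rho_res _))/(epsP i).1.
rewrite linearZ /= scale_alg rmorphM (rho_res _).1 emi_rho ?mulr0 //.
by apply: (epsP j).2; rewrite eq_sym.
Qed.

Lemma fiber_enum : exists (s : nat) (z : 'I_s -> Y),
  injective z /\ forall y, exists i, z i = y.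
Proof.
have ex : exists s, `[< exists z : 'I_s -> Y, injective z >].
  by exists 0%N; apply/asboolP; exists (fun i : 'I_0 => False_rect Y (notF (ltn_ord i))); case.
have bd s : `[< exists z : 'I_s -> Y, injective z >] -> (s <= n)%N.
  by move=> /asboolP[z /fiber_card].
case: (ex_maxnP ex bd) => s /asboolP[z zI] smax; exists s, z; split=> // y.
apply: contrapT => ny; suff : (s.+1 <= s)%N by rewrite ltnn.
apply/smax/asboolP; exists (fun i => if unlift ord_max i is Some j then z j else y).
move=> i j; case: unliftP => [i' ->|->]; case: unliftP => [j' ->|->] //.
- by move=> /zI ->.
- by move=> zy; case: ny; exists i'.
- by move=> zy; case: ny; exists j'.
Qed.

Lemma fiber_basis y : exists (d : nat) (g : 'I_d -> B), kbasis (mO y) (kappa y \o g).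
Proof.
pose S := [set b | mO y (kappa y b)].
have sO := emi_ksubspace (mu y).
have sS : ksubspace S.
  split=> [|u v Su Sv|c u Su]; rewrite /S /= ?rmorph0 ?rmorphD ?linearZ /=.
  - exact: emi0.
  - exact: emiD.
  - exact: ksubspaceZ.
have eS : spans S e.
  by move=> b; have [c mc] := spans_gen chi_res e_gen b; exists c; exact: emi_kappa.
have [d [g [gS gI]]] := basis_of_spans sS eS; exists d, g; split=> [l|c mc].
  have [b lb] := kappa_surj l; have [c Sc] := gS b; exists c.
  rewrite -[l](subrK (kappa y b)) -addrA; apply: emiD => //.
  by move: Sc; rewrite /S /= raddfB raddf_sum /=; congr (mO y (_ - _));
    apply: eq_bigr => i _; rewrite linearZ.
apply: gI; rewrite /S /= raddf_sum /=; congr (mO y _): mc.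
by apply: eq_bigr => i _; rewrite linearZ.
Qed.

(** Chinese remainder theorem: B / m is the product of the local fibre algebras, and the eps i g i j
    form a basis. Counting them yields the sum formula for multiplicities. *)
Lemma fiber_kbasis s (z : 'I_s -> Y) (d : 'I_s -> nat) (g : forall i, 'I_(d i) -> B) :
  injective z -> (forall y, exists i, z i = y) ->
  (forall i, kbasis (mO (z i)) (kappa (z i) \o g i)) ->
  exists b : {i : 'I_s & 'I_(d i)} -> B, kbasis m b.
Proof.
move=> zI zS gB; have [eps epsP] := separating_family zI.
pose b (x : {i : 'I_s & 'I_(d i)}) := eps (tag x) * g (tag x) (tagged x).
have bE c i : mO (z i) (kappa (z i) (\sum_x c x *: b x) -
    kappa (z i) (eps i) * \sum_j c (Tagged (fun i => 'I_(d i)) j) *: kappa (z i) (g i j)).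
  have -> : \sum_x c x *: b x = \sum_i' eps i' * \sum_j c (Tagged (fun i => 'I_(d i)) j) *: g i' j.
    rewrite sum_tagged.
    apply: eq_bigr => i' _; rewrite mulr_sumr; apply: eq_bigr => j _.
    by rewrite -scalerAr.
  rewrite (bigD1 i) //= rmorphD rmorphM /= raddf_sum /=.
  under [X in _ - _ * X]eq_bigr do rewrite -linearZ.
  rewrite addrAC subrr add0r raddf_sum /=.
  apply: (ksubspace_sum (emi_ksubspace (mu (z i)))) => i' i'i.
  by rewrite rmorphM mulrC; apply/emiM/(epsP i').2; rewrite eq_sym.
exists b; split=> [v|c mc [i j]].
  pose u i := sval (cid (epsP i).1).
  have uP i : kappa (z i) (eps i) * u i = 1 by exact: svalP (cid (epsP i).1).
  pose c i := sval (cid ((gB i).1 (u i * kappa (z i) v))).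
  have cP i : mO (z i) (u i * kappa (z i) v - \sum_j c i j *: kappa (z i) (g i j)).
    exact: svalP (cid ((gB i).1 (u i * kappa (z i) v))).
  exists (fun x => c (tag x) (tagged x)); apply: emi_local => y.
  have [i <-] := zS y; rewrite raddfB /=.
  have := emiD (emiM (kappa (z i) (eps i)) (cP i)) (emiN (bE (fun x => c (tag x) (tagged x)) i)).
  by rewrite mulrBr mulrA uP mul1r opprB addrA subrK.
have := emiD (emiN (bE c i)) (emi_kappa (z i) mc).
rewrite opprB subrK => /(emi_mem_units (epsP i).1) mg.
exact: (gB i).2 _ mg j.
Qed.

Lemma common_denominator y (J : finType) (l : J -> O y) :
  exists t (b : J -> B), invertible (kappa y t) /\ forall j, kappa y t * l j = kappa y (b j).
Proof.
have /choice[c cP] := fun j => kappa_frac (l j).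
have {cP}/choice[t tP] := cP.
exists (\prod_j t j), (fun j => (\prod_(i | i != j) t i) * c j); split=> [|j].
  rewrite rmorph_prod; apply: big_ind => [||j _]; [exact: invertible1|exact: invertibleM|].
  exact: (tP j).1.
by rewrite (bigD1 j) //= !rmorphM /= mulrAC (tP j).2 mulrC.
Qed.

(** Generation is Nakayama's lemma. For freeness, flatness is available only at the points y; the
    local trivializations of a relation are glued by [kappa_cover], and a relation that follows from
    relations in A must be zero by a determinant argument. *)
Lemma kbasis_free r (b : 'I_r -> B) : kbasis m b ->
  (forall v, exists a : 'I_r -> A, v = \sum_i phi (a i) * b i) /\
  (forall a : 'I_r -> A, \sum_i phi (a i) * b i = 0 -> forall i, a i = 0).
Proof.
move=> [bS bI].
have gen : forall v, exists a : 'I_r -> A, v = \sum_i phi (a i) * b i.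
  apply: (nakayama chi_res e_gen).
  - by exists (fun=> 0); rewrite big1 // => i _; rewrite rmorph0 mul0r.
  - move=> x y [a ->] [a' ->]; exists (fun i => a i + a' i); rewrite -big_split.
    by apply: eq_bigr => i _; rewrite rmorphD mulrDl.
  - move=> a x [a' ->]; exists (fun i => a * a' i); rewrite mulr_sumr.
    by apply: eq_bigr => i _; rewrite rmorphM mulrA.
  - move=> v; have [c mc] := bS v; exists (\sum_i c i *: b i) => //.
    by exists (fun i => (c i)%:A); apply: eq_bigr => i _; rewrite lrmorph_alg -scale_alg.
split=> // a ab.
(* The multipliers t for which the relation between the t b i follows from relations in A. They form
   an ideal, and clearing denominators in a trivialization at y gives one that is a unit at y. *)
pose J : set B := [set t | exists q (c : 'I_r -> 'I_q -> A) (b' : 'I_q -> B),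
  (forall j, \sum_i a i * c i j = 0) /\ forall i, t * b i = \sum_j phi (c i j) * b' j].
have [q [c [b' [ac bc]]]] : J 1.
  apply: kappa_cover.
  - exists 0%N, (fun _ _ => 0), (fun=> 0); split=> [[]//|i].
    by rewrite mul0r big_ord0.
  - move=> x y [q [c [b1 [ac xc]]]] [q' [c' [b1' [ac' yc]]]].
    exists (q + q')%N, (fun i j => match fintype.split j with inl l => c i l | inr l => c' i l end),
      (fun j => match fintype.split j with inl l => b1 l | inr l => b1' l end).
    split=> [j|i]; first by case: (fintype.split j) => l; [exact: ac|exact: ac'].
    rewrite mulrDl xc yc big_split_ord /=; congr (_ + _); apply: eq_bigr => j _.
      by rewrite (unsplitK (inl j)).
    by rewrite (unsplitK (inr j)).
  - move=> w x [q [c [b1 [ac xc]]]]; exists q, c, (fun j => w * b1 j); split=> // i.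
    by rewrite -mulrA xc mulr_sumr; apply: eq_bigr => j _; rewrite mulrCA.
  - move=> y; have /mu_eq[q [c [l [ac bl]]]] : \sum_i mu y (a i) * kappa y (b i) = 0.
      transitivity (kappa y (\sum_i phi (a i) * b i)); last by rewrite ab rmorph0.
      by rewrite rmorph_sum; apply: eq_bigr => i _; rewrite muE rmorphM.
    have [t [b' [ut tl]]] := common_denominator l.
    exists t => //; exists q, c, b'; split=> // i.
    apply: (@kappa_inj y); rewrite rmorphM /= bl mulr_sumr rmorph_sum.
    by apply: eq_bigr => j _; rewrite rmorphM /= -muE -tl mulrCA.
have /choice[h hP] := fun j => gen (b' j).
(* Expanding the b' j on the generators b turns the trivialization into b = D b with a D = 0.
   Independence modulo m makes the residue of D the identity, so D is invertible and a = 0. *)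
pose D : 'M[A]_r := \matrix_(i, l) \sum_j c i j * h j l.
have bD i : b i = \sum_l phi (D i l) * b l.
  rewrite -[LHS]mul1r bc; under eq_bigr do rewrite hP mulr_sumr.
  rewrite exchange_big; apply: eq_bigr => l _; rewrite mxE rmorph_sum mulr_suml.
  by apply: eq_bigr => j _; rewrite rmorphM mulrA.
have aD : (\row_i a i) *m D = 0.
  apply/rowP => l; rewrite !mxE; under eq_bigr do rewrite !mxE mulr_sumr.
  rewrite exchange_big big1 //= => j _; under eq_bigr do rewrite mulrA.
  by rewrite -mulr_suml ac mul0r.
have chiD : map_mx chi D = 1%:M.
  apply/matrixP => i l; apply/eqP; rewrite -subr_eq0; apply/eqP; move: l.
  apply: bI; have := emi_residue_sum phi chi_res (D i) b (index_enum _).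
  rewrite -bD -[X in m X -> _]opprB => /emiN; rewrite opprK; congr m.
  rewrite [in LHS](eq_bigr (fun l => chi (D i l) *: b l)) //.
  rewrite [RHS](eq_bigr (fun l => chi (D i l) *: b l - (i == l)%:R *: b l)).
    rewrite sumrB; congr (_ - _); rewrite (bigD1 i) //= eqxx scale1r big1 ?addr0 // => l /negPf li.
    by rewrite eq_sym li scale0r.
  by move=> l _; rewrite !mxE scalerBl.
have [u Du] : invertible (\det D).
  by apply: chi_res.2; rewrite -det_map_mx chiD det1 oner_neq0.
move=> i; have := congr1 (fun v : 'rV_r => (v *m (u *: \adj D)) 0 i) aD.
rewrite mul0mx -mulmxA -scalemxAr mul_mx_adj scale_scalar_mx [u * _]mulrC Du mulmx1.
by rewrite !mxE.
Qed.

End Fiber.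

Lemma fiber_dim_unique (k : fieldType) (A B : comAlgType k) (phi : {lrmorphism A -> B})
    (chi : {rmorphism A -> k}) n n' :
  residue chi -> fiber_dim phi n -> fiber_dim phi n' -> n = n'.
Proof.
move=> rchi /(fiber_dim_kbasis phi rchi)[g gB] /(fiber_dim_kbasis phi rchi)[h hB].
by have := kbasis_card (emi_ksubspace phi) gB hB; rewrite !card_ord.
Qed.

(** * Multiplicativity of fibre dimensions under composition *)

Section FiberComposition.
Variables (k : fieldType) (A B C : comAlgType k).
Variables (phi : {lrmorphism A -> B}) (psi : {lrmorphism B -> C}) (theta : {lrmorphism A -> C}).
Hypothesis thetaE : forall a, theta a = psi (phi a).
Variable chi : {rmorphism B -> k}.
Hypothesis chi_res : residue chi.
Hypothesis psi_eq : equational psi.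
Local Notation mA := (extended_maximal_ideal phi).
Local Notation mB := (extended_maximal_ideal psi).
Local Notation mC := (extended_maximal_ideal theta).

Lemma emi_comp b : mA b -> mC (psi b).
Proof.
move: b; apply: emi_lmin => [|b b' mb mb'|a b na].
- by rewrite rmorph0; exact: emi0.
- by rewrite rmorphD; exact: emiD.
- by rewrite rmorphM /= -thetaE; exact: emi_lgen.
Qed.

Variables (n m : nat) (b : 'I_n -> B) (c : 'I_m -> C).
Hypotheses (b_basis : kbasis mA b) (c_basis : kbasis mB c).

(** Otherwise the n + 1 partial products of the first n entries would be independent modulo [mA]: in
    a relation, the shortest product with nonzero coefficient factors out and the cofactor is a
    unit, which would put that product, hence the full one, in [mA]. *)
Lemma emi_nilpotent (s : seq B) : (n <= size s)%N -> (forall x, x \in s -> chi x = 0) ->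
  mA (\prod_(x <- s) x).
Proof.
move=> ns s0; apply: contrapT => nm.
have prod0 i l : (i < l)%N -> (l <= n)%N -> chi (\prod_(x <- drop i (take l s)) x) = 0.
  move=> il ln; have : (0 < size (drop i (take l s)))%N.
    by rewrite size_drop size_takel ?subn_gt0 // (leq_trans ln).
  have sub x : x \in drop i (take l s) -> x \in s by move=> /mem_drop/mem_take.
  case: (drop i (take l s)) sub => // x r sub _.
  by rewrite big_cons rmorphM s0 ?mul0r // sub ?mem_head.
have : indep mA (fun i : 'I_n.+1 => \prod_(x <- take i s) x).
  move=> d md; suff H j : forall i : 'I_n.+1, (i < j)%N -> d i = 0.
    by move=> i; exact: (H i.+1).
  elim: j => // j IH i; rewrite ltnS leq_eqVlt => /orP[/eqP ij|]; last exact: IH.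
  apply: contrapT => /eqP di; apply: nm.
  pose w := \sum_(l : 'I_n.+1) if (i <= l)%N then d l *: \prod_(x <- drop i (take l s)) x else 0.
  have wE : \sum_(l < n.+1) d l *: \prod_(x <- take l s) x = \prod_(x <- take i s) x * w.
    rewrite mulr_sumr; apply: eq_bigr => l _; case: leqP => il.
      rewrite -scalerAr -{1}(cat_take_drop i (take l s)) take_takel //.
      by rewrite big_cat.
    by rewrite IH ?scale0r ?mulr0 // -ij.
  have [u wu] : invertible w.
    apply: chi_res.2; rewrite rmorph_sum (bigD1 i) //= leqnn [X in _ + X]big1 ?addr0 => [|l li].
      rewrite scale_alg rmorphM chi_res.1 drop_oversize ?big_nil ?rmorph1 ?mulr1 //.
      by rewrite size_take; case: ifP => // /negbT; rewrite -leqNgt.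
    case: ifP => il; last exact: rmorph0.
    have il' : (i < l)%N by rewrite ltn_neqAle il andbT eq_sym (inj_eq val_inj).
    by rewrite scale_alg rmorphM prod0 ?mulr0 // -ltnS.
  rewrite -(cat_take_drop i s) big_cat /= mulrC; apply: emiM.
  by have := emiM u md; rewrite wE mulrCA [u * w]mulrC wu mulr1.
move=> /(indep_leq_spans (emi_ksubspace phi))/(_ b_basis.1).
by rewrite !card_ord ltnn.
Qed.

(** Nilpotency replaces Nakayama here, C not being assumed finite over B: expanding on c leaves an
    error in [mB], which is expanded again. After n rounds the error carries a product of n nonunits
    of B and lies in [mC]. *)
Lemma comp_gen x : exists a : 'I_m -> B, mC (x - \sum_j psi (a j) * c j).
Proof.
pose G y := exists a : 'I_m -> B, mC (y - \sum_j psi (a j) * c j).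
have GD y y' : G y -> G y' -> G (y + y').
  move=> [a ma] [a' ma']; exists (fun j => a j + a' j).
  rewrite (_ : _ - _ = (y - \sum_j psi (a j) * c j) + (y' - \sum_j psi (a' j) * c j)).
    exact: emiD.
  rewrite addrACA -opprD -big_split /=; congr (_ - _); apply: eq_bigr => j _.
  by rewrite rmorphD mulrDl.
have GmC y : mC y -> G y.
  by move=> my; exists (fun=> 0); rewrite big1 ?subr0 // => j _; rewrite rmorph0 mul0r.
have GM t y : G y -> G (psi t * y).
  move=> [a ma]; exists (fun j => t * a j).
  rewrite (_ : _ - _ = psi t * (y - \sum_j psi (a j) * c j)); first exact: emiM.
  rewrite mulrBr mulr_sumr; congr (_ - _); apply: eq_bigr => j _.
  by rewrite rmorphM mulrA.
have Q i (s : seq B) : (n <= size s + i)%N -> (forall x, x \in s -> chi x = 0) ->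
    forall y, G (psi (\prod_(x <- s) x) * y).
  elim: i s => [|i IH] s ns s0 y.
    apply: GmC; rewrite mulrC; apply/emiM/emi_comp/emi_nilpotent => //.
    by rewrite addn0 in ns.
  have [d md] := c_basis.1 y; rewrite -[y](subrK (\sum_j d j *: c j)) mulrDr.
  apply: (GD); last first.
    exists (fun j => \prod_(x <- s) x * (d j)%:A).
    rewrite mulr_sumr -sumrB big1 ?emi0 //; first exact: emi0.
    by move=> j _; rewrite rmorphM /= lrmorph_alg scale_alg mulrA subrr.
  move: md; move: (y - _); apply: emi_lmin => [|z z' Gz Gz'|t z nt].
  - by rewrite mulr0; apply: GmC; exact: emi0.
  - by rewrite mulrDr; apply: (GD).
  - rewrite mulrA -rmorphM /=.
    have := IH (rcons s t) _ _ z; rewrite -cats1 big_cat big_seq1; apply.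
      by rewrite size_cat addn1 addSnnS.
    move=> x'; rewrite mem_cat inE => /orP[/s0//|/eqP->].
    exact/(residue_noninvertible _ chi_res).
have := Q n [::] (leqnn _) (fun x => fun xs => match notF xs with end) x.
by rewrite big_nil rmorph1 mul1r.
Qed.

(** Membership in [mC] is a linear relation over B between the c j and other elements, whose further
    coefficients come from nonunits of A. The equational criterion for psi turns it into relations
    in B between the a j modulo [mA]. *)
Lemma comp_indep (a : 'I_m -> B) : mC (\sum_j psi (a j) * c j) -> forall j, mA (a j).
Proof.
move=> [p [r [v [nr av]]]].
pose co (x : 'I_m + 'I_p) := match x with inl j => a j | inr t => - phi (r t) end.
pose el (x : 'I_m + 'I_p) := match x with inl j => c j | inr t => v t end.
have /psi_eq[q [g [w [ag gw]]]] : \sum_x psi (co x) * el x = 0.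
  rewrite big_sumType /= av -big_split big1 //= => t _.
  by rewrite rmorphN mulNr /= -thetaE addrN.
have ma l : mA (\sum_j a j * g (inl j) l).
  have := ag l; rewrite big_sumType /= => /eqP; rewrite addr_eq0 => /eqP ->.
  apply: emiN; apply: (big_ind (fun x => mA x)) => [||t _]; [exact: emi0|exact: emiD|].
  by rewrite mulNr; apply: emiN; exact: emi_lgen.
pose d l := sval (cid (c_basis.1 (w l))).
have dP l : mB (w l - \sum_i d l i *: c i) by exact: svalP (cid (c_basis.1 (w l))).
(* N rewrites c in terms of itself modulo [mB], so its residue is the identity and it is invertible,
   while the row a N lies in [mA]. *)
pose N : 'M[B]_m := \matrix_(j, i) \sum_l g (inl j) l * (d l i)%:A.
have chiN : map_mx chi N = 1%:M.
  apply/matrixP => j i; apply/eqP; rewrite -subr_eq0; apply/eqP; move: i.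
  apply: (c_basis.2).
  have m1 : mB (c j - \sum_i psi (N j i) * c i).
    rewrite -[c j]/(el (inl j)) (gw (inl j)).
    rewrite (_ : _ - _ = \sum_l psi (g (inl j) l) * (w l - \sum_i d l i *: c i)).
      by apply: (big_ind (fun x => mB x)) => [||l _]; [exact: emi0|exact: emiD|exact: emiM].
    under [RHS]eq_bigr do rewrite mulrBr mulr_sumr.
    rewrite sumrB exchange_big /=; congr (_ - _); apply: eq_bigr => i _.
    rewrite mxE rmorph_sum mulr_suml; apply: eq_bigr => l _.
    by rewrite rmorphM /= lrmorph_alg -mulrA -scale_alg.
  have := emiN (emiD m1 (emi_residue_sum psi chi_res (N j) c (index_enum _))).
  rewrite addrA subrK opprB; congr mB.
  rewrite [in RHS](eq_bigr (fun i => chi (N j i) *: c i - (j == i)%:R *: c i)).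
    rewrite sumrB; congr (_ - _); rewrite (bigD1 j) //= eqxx scale1r big1 ?addr0 //.
    by move=> i /negPf ij; rewrite eq_sym ij scale0r.
  by move=> i _; rewrite !mxE scalerBl.
have [u Nu] : invertible (\det N).
  by apply: chi_res.2; rewrite -det_map_mx chiN det1 oner_neq0.
have maN i : mA (((\row_j a j) *m N) 0 i).
  rewrite mxE; under eq_bigr do rewrite !mxE mulr_sumr.
  rewrite exchange_big; apply: (big_ind (fun x => mA x)) => [||l _]; [exact: emi0|exact: emiD|].
  by under eq_bigr do rewrite mulrA; rewrite -mulr_suml mulrC; exact: emiM.
move=> j; have <- : ((\row_j a j) *m N *m (u *: \adj N)) 0 j = a j.
  rewrite -mulmxA -scalemxAr mul_mx_adj scale_scalar_mx [u * _]mulrC Nu mulmx1.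
  by rewrite mxE.
rewrite mxE; apply: (big_ind (fun x => mA x)) => [||l _]; [exact: emi0|exact: emiD|].
by rewrite mulrC; exact: emiM.
Qed.

Lemma kbasis_comp : kbasis mC (fun x : 'I_n * 'I_m => psi (b x.1) * c x.2).
Proof.
split=> [x|d md [i j]].
  have [a ma] := comp_gen x.
  pose d j := sval (cid (b_basis.1 (a j))).
  have dP j : mA (a j - \sum_i d j i *: b i) by exact: svalP (cid (b_basis.1 (a j))).
  exists (fun x => d x.2 x.1).
  rewrite -[x](subrK (\sum_j psi (a j) * c j)) -addrA; apply: emiD => //.
  rewrite -(pair_bigA _ (fun i j => d j i *: (psi (b i) * c j))) exchange_big /= -sumrB.
  apply: (big_ind (fun x => mC x)) => [||j _]; [exact: emi0|exact: emiD|].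
  have := emi_comp (dP j); rewrite raddfB /= raddf_sum => /(emiM (c j)).
  rewrite mulrC mulrBl mulr_suml; congr (mC (_ - _)); apply: eq_bigr => i _.
  by rewrite /= linearZ /= scalerAl.
apply: (b_basis.2 (fun i => d (i, j))); move: j.
apply: comp_indep; congr mC: md.
transitivity (\sum_i \sum_j d (i, j) *: (psi (b i) * c j)).
  by rewrite pair_bigA; apply: eq_bigr => -[].
rewrite exchange_big /=.
apply: eq_bigr => j _; rewrite raddf_sum mulr_suml; apply: eq_bigr => i' _.
by rewrite /= linearZ /= scalerAl.
Qed.

End FiberComposition.

Lemma fiber_dim_comp (k : fieldType) (A B C : comAlgType k)
    (phi : {lrmorphism A -> B}) (psi : {lrmorphism B -> C}) (theta : {lrmorphism A -> C})
    (chiA : {rmorphism A -> k}) (chi : {rmorphism B -> k}) n m :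
  (forall a, theta a = psi (phi a)) -> residue chiA -> residue chi ->
  equational psi -> fiber_dim phi n -> fiber_dim psi m -> fiber_dim theta (n * m)%N.
Proof.
move=> thE rA rB eqp /(fiber_dim_kbasis phi rA)[b bB] /(fiber_dim_kbasis psi rB)[c cB].
apply/(fiber_dim_kbasis theta rA).
have e : #|{: 'I_n * 'I_m}| = (n * m)%N by rewrite card_prod !card_ord.
exact: kbasis_ord e (kbasis_comp thE rB eqp bB cB).
Qed.

(** * Function field and specialization *)

Record ideal (A : comPzRingType) (J : set A) : Prop := Ideal {
  ideal0 : J 0;
  idealD : forall a b, J a -> J b -> J (a + b);
  idealM : forall a b, J b -> J (a * b) }.

Lemma krull (A : comPzRingType) (M J : set A) : ideal J -> M 1 ->
  (forall a b, M a -> M b -> M (a * b)) -> (forall a, J a -> ~ M a) ->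
  exists p, [/\ prime_ideal p, J `<=` p & forall a, p a -> ~ M a].
Proof.
move=> iJ M1 MM JM.
(* The conditions bear on the union of J and Q because Zorn's lemma is also applied to the empty
   chain, whose union is empty. *)
pose P : set (set A) := [set Q | ideal (J `|` Q) /\ forall a, (J `|` Q) a -> ~ M a].
have [|Q [[iQ QM] Qmax]] := @Zorn_bigcup A P.
  move=> F FP Ftot.
  have pick2 a b : (J `|` \bigcup_(Q in F) Q) a -> (J `|` \bigcup_(Q in F) Q) b ->
      (exists2 Q, F Q & (J `|` Q) a /\ (J `|` Q) b) \/ (J a /\ J b).
    move=> [Ja|[Q FQ Qa]] [Jb|[Q' FQ' Q'b]].
    - by right.
    - by left; exists Q' => //; split; [left|right].
    - by left; exists Q => //; split; [right|left].
    - case: (Ftot _ _ FQ FQ') => QQ; left.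
        by exists Q' => //; split; right => //; exact: QQ.
      by exists Q => //; split; right => //; exact: QQ.
  have up Q : F Q -> J `|` Q `<=` J `|` \bigcup_(Q in F) Q.
    by move=> FQ a [Ja|Qa]; [left|right; exists Q].
  split; last first.
    by move=> a [Ja|[Q FQ Qa]]; [exact: JM|apply: (FP _ FQ).2; right].
  split; first by left; exact: ideal0.
    move=> a b aU bU; case: (pick2 _ _ aU bU) => [[Q FQ [Qa Qb]]|[Ja Jb]].
      by apply: (up _ FQ); apply: idealD => //; exact: (FP _ FQ).1.
    by left; exact: idealD.
  move=> a b [Jb|[Q FQ Qb]]; first by left; exact: idealM.
  by apply: (up _ FQ); apply: idealM; [exact: (FP _ FQ).1|right].
exists (J `|` Q); split; [|by move=> a; left|exact: QM].
have big K : ideal K -> J `|` Q `<=` K -> (exists2 a, K a & ~ (J `|` Q) a) ->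
    exists2 a, K a & M a.
  move=> iK QK [a Ka nQa]; apply: contrapT => nM; apply: (Qmax K).
    split; first by move=> b Qb; apply: QK; right.
    by move=> KQ; apply: nQa; right; exact: KQ.
  have JK : J `|` K = K by apply/setUidPr => b Jb; apply: QK; left.
  split; first by rewrite JK.
  by move=> b; rewrite JK => Kb Mb; apply: nM; exists b.
have adj a : ~ (J `|` Q) a -> exists q r, (J `|` Q) q /\ M (q + r * a).
  move=> na; have [|||y [q [r [qQ ->]]] Mqr] := big [set y | exists q r, (J `|` Q) q /\ y = q + r * a].
  - split=> [|x y [q [r [qQ ->]]] [q' [r' [qQ' ->]]]|x y [q [r [qQ ->]]]].
    + by exists 0, 0; rewrite mul0r addr0; split=> //; exact: ideal0.
    + by exists (q + q'), (r + r'); rewrite mulrDl addrACA; split=> //; exact: idealD.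
    + by exists (x * q), (x * r); rewrite mulrDr mulrA; split=> //; exact: idealM.
  - by move=> q qQ; exists q, 0; rewrite mul0r addr0.
  - by exists a => //; exists 0, 1; rewrite add0r mul1r; split=> //; exact: ideal0.
  - by exists q, r.
split; [exact: ideal0|exact: idealD|exact: idealM|by move=> /QM|].
move=> a b Qab; apply: contrapT => /not_orP[na nb].
have [q [r [qQ Mq]]] := adj _ na; have [q' [r' [qQ' Mq']]] := adj _ nb.
apply: (QM _ _ (MM _ _ Mq Mq')).
have -> : (q + r * a) * (q' + r' * b) = (q' + r' * b) * q + r * a * q' + r * r' * (a * b).
  by rewrite mulrDl [q * _]mulrC -addrA; congr (_ + _); rewrite mulrDr mulrACA.
by apply: idealD => //; [apply: idealD => //|]; exact: idealM.
Qed.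

Section Local.
Variable A : comPzRingType.
Hypothesis A_local : forall a : A, invertible a \/ invertible (1 - a).

Lemma local_noninvertibleD (a b : A) : ~ invertible a -> ~ invertible b -> ~ invertible (a + b).
Proof.
move=> na nb [u abu]; case: (A_local (a * u)) => [/invertibleMl//|].
by rewrite -abu mulrDl addrC addKr => /invertibleMl.
Qed.

End Local.

(** The relation phi(a) 1 = 0 gives 1 = sum of phi(c j) b' j with a c j = 0. As B is local, some
    phi(c j) is a unit; hence so is c j, and a = 0. *)
Lemma equational_injective (A B : comNzRingType) (phi : {rmorphism A -> B}) :
  (forall b : B, invertible b \/ invertible (1 - b)) ->
  (forall a, invertible (phi a) -> invertible a) -> equational phi ->
  forall a, phi a = 0 -> a = 0.
Proof.
move=> Bloc philoc phieq a phia0.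
have [m [c [b' [ac bc]]]] := phieq _ (fun _ : 'I_1 => a) (fun=> 1)
  (etrans (big_ord1 _ _) (etrans (mulr1 _) phia0)).
have [[j [u cu]]|nc] := pselect (exists j, invertible (c ord0 j)).
  by have := ac j; rewrite big_ord1 => acj; rewrite -[a]mulr1 -cu mulrA acj mul0r.
have n0 : ~ invertible (0 : B) by move=> [b]; rewrite mul0r => /eqP; rewrite eq_sym oner_eq0.
suff : ~ invertible (1 : B) by move=> n1; case: n1; exact: invertible1.
rewrite (bc ord0); apply: (big_ind (fun x : B => ~ invertible x)) => // [x y|j _].
  exact: local_noninvertibleD.
by move=> /invertibleMl/philoc cj; apply: nc; exists j.
Qed.

Lemma generic_open (T : topologicalType) (eta : T) (U : set T) :
  generic_point eta -> open U -> U !=set0 -> U eta.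
Proof.
move=> geta oU [x Ux]; have : closure [set eta] x by rewrite geta.
by move=> /(_ U (open_nbhs_nbhs (conj oU Ux)))[y [->]].
Qed.

Section Localization.
Variables (A L : comPzRingType) (p : set A) (h : A -> L).
Hypotheses (pp : prime_ideal p) (hL : localization_at p h).

Lemma localization0 : h 0 = 0. Proof. exact: (localization_nmod hL).1. Qed.
Lemma localization1 : h 1 = 1. Proof. exact: (localization_monoid hL).1. Qed.
Lemma localizationD : {morph h : a b / a + b}.
Proof. exact: (localization_nmod hL).2. Qed.
Lemma localizationM : {morph h : a b / a * b}.
Proof. exact: (localization_monoid hL).2. Qed.
Lemma localization_sum I (r : seq I) (F : I -> A) :
  h (\sum_(i <- r) F i) = \sum_(i <- r) h (F i).
Proof. exact: (big_morph h localizationD localization0). Qed.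

Lemma localizationB : {morph h : a b / a - b}.
Proof.
move=> a b; apply/eqP; rewrite eq_sym subr_eq -localizationD; apply/eqP.
by rewrite subrK.
Qed.

Lemma localization_invertibleP a : invertible (h a) <-> ~ p a.
Proof.
split=> [[l hal] pa|]; last exact: localization_invertible.
have [c [b [nb bl]]] := localization_fraction hL l.
have : h (b - a * c) = 0.
  rewrite localizationB localizationM -bl mulrA [h a * _]mulrC -mulrA hal mulr1.
  exact: subrr.
move=> /(localization_kernel hL)[t [nt tb]].
have : p (t * (b - a * c)) by rewrite tb; exact: prime_ideal0.
case/(prime_ideal_prime pp) => // pb; apply: nb.
rewrite -(subrK (a * c) b); apply: prime_idealD => //.
by rewrite mulrC; exact: prime_idealM.
Qed.

End Localization.

Section Scheme.
Variables (k : fieldType) (X : kspace k).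

Section Chart.
Variables (U : set X) (A : comPzRingType) (pt : X -> set A) (theta : forall x : X, A -> stalk x).
Hypothesis ch : affine_chart U pt theta.

Lemma chart_prime x : U x -> prime_ideal (pt x).
Proof. by have [f _ _] := chart_bij ch; exact: f. Qed.

Lemma chart_surj p : prime_ideal p -> exists2 x, U x & pt x = p.
Proof. by have [_ _ f] := chart_bij ch; move=> /f[x Ux <-]; exists x. Qed.

Lemma chart_inj x y : U x -> U y -> pt x = pt y -> x = y.
Proof.
by have [_ f _] := chart_bij ch => Ux Uy; apply: f; rewrite inE.
Qed.

Lemma chart_basic_open a : open [set x | U x /\ ~ pt x a].
Proof.
have sub : [set x | U x /\ ~ pt x a] `<=` U by move=> x [].
apply/(chart_topology ch sub); exists [set a]; apply/seteqP; split=> x /= [Ux nx].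
  by split=> // /(_ a erefl).
by split=> // pa; apply: nx => b ->.
Qed.

Lemma chart_open_basic (V : set X) x : open V -> U x -> V x ->
  exists a, ~ pt x a /\ forall y, U y -> ~ pt y a -> V y.
Proof.
move=> oV Ux Vx; have oVU : open (V `&` U) by apply: openI => //; exact: chart_open ch.
have [E VE] := (chart_topology ch (@subIsetr _ V U)).1 oVU.
have : (V `&` U) x by [].
rewrite VE => -[_ /existsNP[a /not_implyP[Ea na]]]; exists a; split=> // y Uy ny.
have : (V `&` U) y by rewrite VE; split=> // /(_ a Ea).
by case.
Qed.

Lemma chart_global_section a : is_section U (fun x => theta x a).
Proof.
apply/(chart_section ch _ (chart_open ch)) => // x Ux; exists U; split=> //.
  exact: chart_open ch.
exists a, 1 => y Uy; split; first exact: prime_ideal1 (chart_prime Uy).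
by rewrite (localization1 (chart_stalk ch Uy)) mul1r.
Qed.

Lemma chart_eq0 a : (forall x, U x -> theta x a = 0) -> a = 0.
Proof.
move=> a0; apply: contrapT => na.
pose J := [set t | t * a = 0].
have iJ : ideal J.
  split; rewrite /J /=; first exact: mul0r.
    by move=> b c bJ cJ; rewrite mulrDl bJ cJ addr0.
  by move=> b c cJ; rewrite -mulrA cJ mulr0.
have [||p [pp Jp _]] := krull (M := [set 1]) iJ erefl.
- by move=> _ _ -> ->; rewrite /= mulr1.
- by move=> t Jt /= t1; move: Jt; rewrite t1 /J /= mul1r => /na.
have [x Ux xp] := chart_surj pp.
have [t [nt ta]] := localization_kernel (chart_stalk ch Ux) (a0 x Ux).
by apply: nt; rewrite xp; exact: Jp.
Qed.

Hypotheses (Xred : reduced X).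
Variable eta : X.
Hypothesis eta_gen : generic_point eta.

Lemma chart_generic x : U x -> U eta.
Proof.
by move=> Ux; apply: (generic_open eta_gen); [exact: chart_open ch|exists x].
Qed.

(** The generic point meets every nonempty open set, so a lies in all primes of the chart; it is
    then nilpotent, and reducedness applies to the section it defines. *)
Lemma chart_generic_eq0 x a : U x -> pt eta a -> a = 0.
Proof.
move=> Ux etaa.
have all y : U y -> pt y a.
  move=> Uy; apply: contrapT => ny.
  have : [set x | U x /\ ~ pt x a] eta.
    by apply: (generic_open eta_gen); [exact: chart_basic_open|exists y].
  by case.
have [n an] : exists n : nat, a ^+ n = 0.
  apply: contrapT => nn.
  have [||||p [pp _ pM]] := krull (M := [set b | exists n : nat, b = a ^+ n]) (J := [set 0]).
  - by split=> [//|b c -> ->|b c ->]; rewrite /= ?addr0 ?mulr0.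
  - by exists 0%N; rewrite expr0.
  - by move=> _ _ [n ->] [m ->]; exists (n + m)%N; rewrite exprD.
  - by move=> _ -> [n /esym a0]; apply: nn; exists n.
  - have [y Uy yp] := chart_surj pp.
    by apply: (pM a); [rewrite -yp; exact: all|exists 1%N; rewrite expr1].
apply: chart_eq0; apply: (Xred (chart_open ch) (chart_global_section a) (n := n)) => y Uy.
have hM := chart_stalk ch Uy.
have -> : theta y a ^+ n = theta y (a ^+ n).
  elim: n {an} => [|n IH]; first by rewrite !expr0 (localization1 hM).
  by rewrite !exprS (localizationM hM) IH.
by rewrite an (localization0 hM).
Qed.

Lemma chart_generic_ideal x : U x -> pt eta = [set 0].
Proof.
move=> Ux; apply/seteqP; split=> [a|_ ->]; first exact: chart_generic_eq0 Ux.
exact: prime_ideal0 (chart_prime (chart_generic Ux)).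
Qed.

Lemma chart_domain x (a b : A) : U x -> a * b = 0 -> a = 0 \/ b = 0.
Proof.
move=> Ux ab; have Ue := chart_generic Ux.
have : pt eta (a * b) by rewrite ab; exact: prime_ideal0 (chart_prime Ue).
by case/(prime_ideal_prime (chart_prime Ue)) => /(chart_generic_eq0 Ux) ->; [left|right].
Qed.

Lemma chart_stalk_inj x a : U x -> theta x a = 0 -> a = 0.
Proof.
move=> Ux /(localization_kernel (chart_stalk ch Ux))[t [nt ta]].
case: (chart_domain Ux ta) => // t0; case: nt; rewrite t0.
exact: prime_ideal0 (chart_prime Ux).
Qed.

End Chart.

(** The elements of a chart that vanish at all its points form a prime by irreducibility, and the
    point of this prime lies in every nonempty open set. *)
Lemma generic_exists : is_scheme X -> irreducible_space X -> exists eta : X, generic_point eta.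
Proof.
move=> Xsch [[x _] irr]; have [U [A [pt [theta [Ux ch]]]]] := Xsch x.
pose p0 := [set a | forall y, U y -> pt y a].
have pp : prime_ideal p0.
  split=> [y Uy|a b pa pb y Uy|a b pb y Uy||a b pab].
  - exact: prime_ideal0 (chart_prime ch Uy).
  - by apply: (prime_idealD (chart_prime ch Uy)); [exact: pa|exact: pb].
  - by apply: (prime_idealM (chart_prime ch Uy)); exact: pb.
  - by move=> /(_ x Ux); exact: prime_ideal1 (chart_prime ch Ux).
  - apply: contrapT => /not_orP[/existsNP[y /not_implyP[Uy ya]] /existsNP[z /not_implyP[Uz zb]]].
    have [||w [[Uw wa] [_ wb]]] := irr _ _ (chart_basic_open ch a) (chart_basic_open ch b).
    - by exists y.
    - by exists z.
    - by case: (prime_ideal_prime (chart_prime ch Uw) (pab w Uw)).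
have [eta Ue etap] := chart_surj ch pp; exists eta; apply/seteqP; split=> // y _ W.
rewrite nbhsE => -[W' [oW' W'y] W'W].
have [w [W'w Uw]] : (W' `&` U) !=set0.
  by apply: irr => //; [exact: chart_open ch|exists y|exists x].
have [a [na aW]] := chart_open_basic ch oW' Uw W'w.
by exists eta; split=> //; apply/W'W/aW => //; rewrite etap => /(_ w Uw).
Qed.

End Scheme.

Section Specialization.
Variables (k : fieldType) (X : kspace k).
Hypotheses (Xsch : is_scheme X) (Xred : reduced X).
Variable eta : X.
Hypothesis eta_gen : generic_point eta.

(** Every neighbourhood of y contains eta, so a germ at y determines a germ at eta. This relation
    becomes the embedding [sp] of each stalk in the function field. *)
Definition specializes (y : X) (a : stalk y) (l : stalk eta) :=
  exists U s, [/\ open U, U y, is_section U s, s y = a & s eta = l].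

Lemma specializes_exists y (a : stalk y) : exists l, specializes a l.
Proof. by have [U [s [oU Uy Us sy]]] := germ_surj a; exists (s eta), U, s. Qed.

Lemma specializes_unique y (a : stalk y) l l' : specializes a l -> specializes a l' -> l = l'.
Proof.
move=> [U [s [oU Uy Us sy <-]]] [U' [s' [oU' Uy' Us' sy' <-]]].
have oI := openI oU oU'.
have [V [oV Vy VU eV]] := germ_inj oI (conj Uy Uy')
  (section_restr oU oI (@subIsetl _ _ _) Us) (section_restr oU' oI (@subIsetr _ _ _) Us')
  (etrans sy (esym sy')).
by apply: eV; apply: (generic_open eta_gen oV); exists y.
Qed.

Lemma specializes0 y (a : stalk y) : specializes a 0 -> a = 0.
Proof.
move=> [U [s [oU Uy Us <- se]]].
have [W [A [pt [theta [Wy ch]]]]] := Xsch y.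
have oI := openI oU (chart_open ch).
have [V [oV Vy VU [a' [b sab]]]] := (chart_section ch s oI (@subIsetr _ _ _)).1
  (section_restr oU oI (@subIsetl _ _ _) Us) y (conj Uy Wy).
have Ve : V eta by apply: (generic_open eta_gen oV); exists y.
have We : W eta by have [] := VU _ Ve.
have [_] := sab eta Ve; rewrite se mulr0 => /esym/(chart_stalk_inj ch Xred eta_gen We) a0.
have [nb] := sab y Vy; rewrite a0 (localization0 (chart_stalk ch Wy)) => sb.
have [u bu] := localization_invertible (chart_stalk ch Wy) nb.
by rewrite -[s y]mul1r -bu mulrAC sb mul0r.
Qed.

Lemma specialization_exists y : exists sp : {lrmorphism stalk y -> stalk eta},
  injective sp /\
  forall (U : set X) s, open U -> is_section U s -> U y -> sp (s y) = s eta.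
Proof.
have [f fP] := choice (@specializes_exists y).
have fE a l : specializes a l -> f a = l by exact: specializes_unique (fP a).
have fB : zmod_morphism f.
  move=> a b; apply: fE; have [U [s [oU Uy Us sa sl]]] := fP a.
  have [V [t [oV Vy Vt tb tl]]] := fP b; have oI := openI oU oV.
  exists (U `&` V), (fun x => s x - t x); rewrite sa sl tb tl; split=> //.
  by apply: section_sub => //;
    [exact: (section_restr oU oI (@subIsetl _ _ _))|exact: (section_restr oV oI (@subIsetr _ _ _))].
have fM : monoid_morphism f.
  split.
    apply: fE; exists setT, (fun x => 1%:A); split; rewrite ?scale1r //; first exact: openT.
    by apply: section_scalar; exact: openT.
  move=> a b; apply: fE; have [U [s [oU Uy Us sa sl]]] := fP a.
  have [V [t [oV Vy Vt tb tl]]] := fP b; have oI := openI oU oV.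
  exists (U `&` V), (fun x => s x * t x); rewrite sa sl tb tl; split=> //.
  by apply: section_mul => //;
    [exact: (section_restr oU oI (@subIsetl _ _ _))|exact: (section_restr oV oI (@subIsetr _ _ _))].
have fZ : scalable f.
  move=> c a; apply: fE; have [U [s [oU Uy Us sa sl]]] := fP a.
  exists U, (fun x => c%:A * s x); rewrite sa sl -!scale_alg; split=> //.
  by apply: section_mul => //; exact: section_scalar.
pose F : {lrmorphism stalk y -> stalk eta} := HB.pack f
  (GRing.isZmodMorphism.Build _ _ f fB) (GRing.isMonoidMorphism.Build _ _ f fM)
  (GRing.isScalable.Build _ _ _ _ f fZ).
exists F; split=> [a b fab|U s oU Us Uy]; last by apply: fE; exists U, s.
apply/eqP; rewrite -subr_eq0; apply/eqP/specializes0.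
by have := fP (a - b); rewrite fB [f a]fab subrr.
Qed.

Definition sp y : {lrmorphism stalk y -> stalk eta} := sval (cid (specialization_exists y)).

Lemma sp_inj y : injective (sp y).
Proof. exact: (svalP (cid (specialization_exists y))).1. Qed.

Lemma sp_section (U : set X) s y : open U -> is_section U s -> U y -> sp y (s y) = s eta.
Proof. exact: (svalP (cid (specialization_exists y))).2. Qed.

Lemma sp_chart (U : set X) (A : comPzRingType) (pt : X -> set A) (theta : forall x : X, A -> stalk x) a y :
  affine_chart U pt theta -> U y -> sp y (theta y a) = theta eta a.
Proof.
move=> ch Uy; apply: (sp_section (s := fun x => theta x a) (chart_open ch)) => //.
exact: (chart_global_section ch).
Qed.

Lemma sp_spread y (a : stalk y) :
  \forall w \near y, exists a' : stalk w, sp w a' = sp y a.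
Proof.
have [U [s [oU Uy Us <-]]] := germ_surj a.
apply: (filterS _ (open_nbhs_nbhs (conj oU Uy))) => w Uw; exists (s w).
by rewrite (sp_section oU Us Uw) (sp_section oU Us Uy).
Qed.

End Specialization.
Arguments sp {k X} Xsch Xred [eta] eta_gen y.

Section GenericMorphism.
Variables (k : fieldType) (X : kspace k) (f : kmor X X).
Hypotheses (Xsch : is_scheme X) (Xred : reduced X).
Hypotheses (fflat : flat_mor f) (ffin : finite_mor f).

Lemma mor_stalk_eq0 x a : mor_stalk f x a = 0 -> a = 0.
Proof.
apply: equational_injective; first exact: stalk_local.
  exact: mor_local.
exact: (flat_equational (@fflat x)).
Qed.

Variable eta : X.
Hypothesis eta_gen : generic_point eta.

(** A function vanishing at f eta pulls back to a nonunit at eta, that is to 0, and the stalk maps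
    are injective; so f eta corresponds to the zero ideal. *)
Lemma mor_generic : f eta = eta.
Proof.
have [V [A [ptA [thetaA [B [ptB [thetaB [phi [Ve chA chB comp _]]]]]]]]] := ffin (f eta).
have Ve' := chart_generic chA eta_gen Ve.
apply: (chart_inj chA Ve Ve'); rewrite (chart_generic_ideal chA Xred eta_gen Ve').
apply/seteqP; split=> a; last by move=> ->; exact: prime_ideal0 (chart_prime chA Ve).
move=> /= pa; apply: (chart_stalk_inj chA Xred eta_gen Ve).
apply: mor_stalk_eq0; rewrite -comp //.
suff -> : phi a = 0 by exact: localization0 (chart_stalk chB Ve).
apply: (chart_generic_eq0 chB Xred eta_gen (x := eta)) => //.
apply: contrapT => /(localization_invertible (chart_stalk chB Ve)).
rewrite comp // => /mor_local.
by move=> /(localization_invertibleP (chart_prime chA Ve) (chart_stalk chA Ve)).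
Qed.

Lemma sp_mor (g : generic_point (f eta)) y (a : stalk (f y)) :
  mor_stalk f eta (sp Xsch Xred g (f y) a) = sp Xsch Xred eta_gen y (mor_stalk f y a).
Proof.
have [U [s [oU Uy Us <-]]] := germ_surj a.
rewrite (sp_section Xsch Xred g oU Us Uy).
have oV : open (f @^-1` U) by apply: open_comp => // w _; exact: mor_continuous.
by rewrite (sp_section Xsch Xred eta_gen oV (mor_section f oU Us) Uy).
Qed.

End GenericMorphism.

(** * Fibres of a finite flat endomorphism *)

Section SpanSubalgebra.
Variables (k : fieldType) (A L : comAlgType k) (F : {lrmorphism A -> L}).
Variables (n : nat) (e : 'I_n -> L).

Definition in_span (l : L) : Prop := exists a : 'I_n -> A, l = \sum_i F (a i) * e i.

Hypothesis span1 : in_span 1.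
Hypothesis spanM : forall i j, in_span (e i * e j).

Lemma in_spanD l l' : in_span l -> in_span l' -> in_span (l + l').
Proof.
move=> [a ->] [b ->]; exists (fun i => a i + b i); rewrite -big_split.
by apply: eq_bigr => i _; rewrite rmorphD mulrDl.
Qed.

Lemma in_spanZ a l : in_span l -> in_span (F a * l).
Proof.
move=> [b ->]; exists (fun i => a * b i); rewrite mulr_sumr.
by apply: eq_bigr => i _; rewrite rmorphM mulrA.
Qed.

Lemma in_span0 : in_span 0.
Proof. by exists (fun=> 0); rewrite big1 // => i _; rewrite rmorph0 mul0r. Qed.

Lemma in_span_gen i : in_span (e i).
Proof.
exists (fun j => (j == i)%:R); rewrite (bigD1 i) //= eqxx rmorph1 mul1r big1 ?addr0 //.
by move=> j /negPf ->; rewrite rmorph0 mul0r.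
Qed.

Lemma in_span_mul l l' : in_span l -> in_span l' -> in_span (l * l').
Proof.
move=> [a ->] [b ->]; rewrite mulr_suml.
apply: (big_ind in_span) => [||i _]; [exact: in_span0|exact: in_spanD|].
rewrite mulr_sumr; apply: (big_ind in_span) => [||j _]; [exact: in_span0|exact: in_spanD|].
by rewrite mulrACA -rmorphM; exact: in_spanZ.
Qed.

Definition span_pred : {pred L} := fun l => `[< in_span l >].

Lemma span_closed : subalg_closed span_pred.
Proof.
split=> [|c u v /asboolP su /asboolP sv|u v /asboolP su /asboolP sv]; apply/asboolP => //.
  by rewrite scale_alg -(lrmorph_alg F); apply: in_spanD => //; exact: in_spanZ.
exact: in_span_mul.
Qed.
HB.instance Definition _ := GRing.isSubalgClosed.Build k L span_pred span_closed.

Definition span_type := {l : L | l \in span_pred}.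
HB.instance Definition _ := SubChoice.on span_type.
HB.instance Definition _ := [SubChoice_isSubComNzRing of span_type by <:].
HB.instance Definition _ := [SubNmodule_isSubLSemiModule of span_type by <:].
HB.instance Definition _ := [SubNzRing_SubLmodule_isSubLalgebra of span_type by <:].
HB.instance Definition _ := [SubLalgebra_isSubAlgebra of span_type by <:].

Lemma lrmorph_factor (B C : comAlgType k) (i : {lrmorphism C -> L}) (v : {lrmorphism B -> L}) :
  injective i -> (forall b, exists c, i c = v b) ->
  exists g : {lrmorphism B -> C}, forall b, i (g b) = v b.
Proof.
move=> iI /choice[g gP].
have gB : zmod_morphism g by move=> a b; apply: iI; rewrite rmorphB /= !gP rmorphB.
have gM : monoid_morphism g.
  by split=> [|a b]; apply: iI; rewrite ?rmorphM /= ?gP ?rmorph1 ?rmorphM.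
have gZ : scalable g by move=> c a; apply: iI; rewrite linearZ /= !gP linearZ.
pose G : {lrmorphism B -> C} := HB.pack g (GRing.isZmodMorphism.Build _ _ g gB)
  (GRing.isMonoidMorphism.Build _ _ g gM) (GRing.isScalable.Build _ _ _ _ g gZ).
by exists G.
Qed.

Lemma span_algebra : exists (B : comAlgType k) (v : {lrmorphism B -> L})
    (phi : {lrmorphism A -> B}) (e' : 'I_n -> B),
  [/\ injective v, forall a, v (phi a) = F a, forall i, v (e' i) = e i &
      forall b, exists a : 'I_n -> A, b = \sum_i phi (a i) * e' i].
Proof.
have vB : zmod_morphism (val : span_type -> L) by move=> a b; rewrite raddfB.
have vM : monoid_morphism (val : span_type -> L) by split=> [|a b]; rewrite ?rmorph1 ?rmorphM.
have vZ : scalable (val : span_type -> L) by move=> c a; rewrite linearZ.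
pose v : {lrmorphism span_type -> L} := HB.pack (val : span_type -> L)
  (GRing.isZmodMorphism.Build _ _ (val : span_type -> L) vB)
  (GRing.isMonoidMorphism.Build _ _ (val : span_type -> L) vM)
  (GRing.isScalable.Build _ _ _ _ (val : span_type -> L) vZ).
have vS l : in_span l -> exists b : span_type, v b = l.
  move=> sl; have pl : l \in span_pred by exact/asboolP.
  by exists (exist _ l pl).
have [|phi phiP] := @lrmorph_factor A span_type v F val_inj.
  by move=> a; apply: vS; rewrite -[F a]mulr1; exact: in_spanZ.
have /choice[e' e'P] := fun i => vS _ (in_span_gen i).
exists span_type, v, phi, e'; split=> // b.
have /asboolP[a ba] := valP b; exists a; apply: val_inj; rewrite ba.
rewrite [RHS](rmorph_sum v); apply: eq_bigr => i _.
by rewrite -phiP -e'P -rmorphM.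
Qed.

End SpanSubalgebra.

Lemma common_fraction (A L : comPzRingType) (p : set A) (h : A -> L) (I : finType) (l : I -> L) :
  prime_ideal p -> localization_at p h ->
  exists s (a : I -> A), ~ p s /\ forall i, h s * l i = h (a i).
Proof.
move=> pp hL; have /choice[a aP] := fun i => localization_fraction hL (l i).
have {aP}/choice[s sP] := aP.
exists (\prod_i s i), (fun i => (\prod_(j | j != i) s j) * a i); split=> [|i].
  apply: (big_ind (fun x => ~ p x)) => [||i _]; [exact: prime_ideal1 pp| |exact: (sP i).1].
  by move=> x y nx ny /(prime_ideal_prime pp)[].
by rewrite (bigD1 i) //= !(localizationM hL) -(sP i).2 mulrCA mulrA.
Qed.

(** P splits over k, and a product of units is a unit. This gives the points of a fibre over a
    rational point residue field k. *)
Lemma noninvertible_root (k : closedFieldType) (A : comAlgType k) (x : A) (P : {poly k}) :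
  P != 0 -> ~ invertible (horner_alg x P) -> exists c, ~ invertible (x - c%:A).
Proof.
move=> P0 nP; apply: contrapT => nc; apply: nP.
have [r ->] := closed_field_poly_normal P.
rewrite linearZ /=; apply: invertibleM.
  by apply: scalar_invertible; rewrite lead_coef_eq0.
rewrite rmorph_prod; apply: (big_ind (fun y : A => invertible y)) => [||c _].
- exact: invertible1.
- exact: invertibleM.
rewrite rmorphB /= horner_algX horner_algC.
by apply: contrapT => nx; apply: nc; exists c.
Qed.

(** An equality of points does not convert their stalks. Quantifying over predicates carries every
    property of [mor_stalk f y] to mu without a cast. *)
Lemma stalk_transport (k : fieldType) (X : kspace k) (f : kmor X X) (y z : X) : f y = z ->
  exists mu : {lrmorphism stalk z -> stalk y},
    forall P : (forall w : X, {lrmorphism stalk w -> stalk y} -> Prop),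
      P (f y) (mor_stalk f y) -> P z mu.
Proof. by move=> <-; exists (mor_stalk f y). Qed.

Section FiberData.
Variables (k : closedFieldType) (X : kspace k) (f : kmor X X).
Hypotheses (Xsch : is_scheme X) (Xred : reduced X) (fflat : flat_mor f).
Variable eta : X.
Hypotheses (geta : generic_point eta) (gfeta : generic_point (f eta)).
Variables (V : set X) (A : comPzRingType) (ptA : X -> set A)
  (thA : forall x : X, A -> stalk x).
Variables (B : comPzRingType) (ptB : X -> set B)
  (thB : forall x : X, B -> stalk x) (phi : {rmorphism A -> B}).
Hypotheses (chA : affine_chart V ptA thA) (chB : affine_chart (f @^-1` V) ptB thB).
Hypothesis th_phi : forall x a, V (f x) -> thB x (phi a) = mor_stalk f x (thA (f x) a).
Variables (n : nat) (e : 'I_n -> B).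
Hypothesis e_gen : forall b, exists a : 'I_n -> A, b = \sum_(i < n) phi (a i) * e i.

Definition spA z : {lrmorphism stalk z -> stalk (f eta)} := sp Xsch Xred gfeta z.
Definition spB y : {lrmorphism stalk y -> stalk eta} := sp Xsch Xred geta y.
(** Although f eta = eta, [stalk (f eta)] and [stalk eta] are distinct types. They are the base and
    the top of the extension k(X) / f^* k(X). *)
Definition pullback z : {lrmorphism stalk z -> stalk eta} := mor_stalk f eta \o spA z.
Definition e_eta i : stalk eta := thB eta (e i).

Lemma spA_inj z : injective (spA z). Proof. exact: sp_inj. Qed.
Lemma spB_inj y : injective (spB y). Proof. exact: sp_inj. Qed.

Lemma pullback_mor y a : pullback (f y) a = spB y (mor_stalk f y a).
Proof. exact: sp_mor. Qed.

Section AtPoint.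
Variable z : X.
Hypothesis Vz : V z.

Let Vfeta : V (f eta).
Proof. exact: (chart_generic chA gfeta Vz). Qed.

Lemma pullback_chart a : pullback z (thA z a) = thB eta (phi a).
Proof. by rewrite (th_phi a Vfeta) -(sp_chart Xsch Xred gfeta a chA Vz). Qed.

Lemma chart_in_span b : in_span (pullback z) e_eta (thB eta b).
Proof.
have [a ->] := e_gen b; exists (fun i => thA z (a i)).
rewrite (localization_sum (chart_stalk chB Vfeta)); apply: eq_bigr => i _.
by rewrite (localizationM (chart_stalk chB Vfeta)) pullback_chart.
Qed.

Lemma span_fraction l : in_span (pullback z) e_eta l ->
  exists s b, ~ ptA z s /\ pullback z (thA z s) * l = thB eta b.
Proof.
move=> [a ->]; have [s [c [ns sa]]] := common_fraction a (chart_prime chA Vz) (chart_stalk chA Vz).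
exists s, (\sum_i phi (c i) * e i); split=> //.
rewrite (localization_sum (chart_stalk chB Vfeta)) mulr_sumr; apply: eq_bigr => i _.
transitivity (pullback z (thA z s * a i) * e_eta i); first by rewrite rmorphM mulrA.
by rewrite sa pullback_chart (localizationM (chart_stalk chB Vfeta)).
Qed.

(* fd_ring is the subring of the function field spanned by the e i over the stalk
   at z. For f y = z the stalks at z and at f y are distinct types, so fd_mu y
   stands for mor_stalk f y up to the transport fd_mu_transport. *)
Record fiber_data (chi : {rmorphism stalk z -> k}) : Type := FiberData {
  fd_ring : comAlgType k;
  fd_val : {lrmorphism fd_ring -> stalk eta};
  fd_phi : {lrmorphism stalk z -> fd_ring};
  fd_e : 'I_n -> fd_ring;
  fd_mu : forall y : {y | f y = z}, {lrmorphism stalk z -> stalk (sval y)};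
  fd_kappa : forall y : {y | f y = z}, {lrmorphism fd_ring -> stalk (sval y)};
  fd_rho : forall y : {y | f y = z}, {rmorphism stalk (sval y) -> k};
  fd_val_inj : injective fd_val;
  fd_val_phi : forall a, fd_val (fd_phi a) = pullback z a;
  fd_val_e : forall i, fd_val (fd_e i) = e_eta i;
  fd_gen : forall b, exists a : 'I_n -> stalk z, b = \sum_i fd_phi (a i) * fd_e i;
  fd_muE : forall y a, fd_mu y a = fd_kappa y (fd_phi a);
  fd_mu_eq : forall y, equational (fd_mu y);
  fd_mu_transport : forall (y : {y | f y = z})
    (P : forall w : X, {lrmorphism stalk w -> stalk (sval y)} -> Prop),
    P z (fd_mu y) -> P (f (sval y)) (mor_stalk f (sval y));
  fd_rho_res : forall y, residue (fd_rho y);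
  fd_rho_mu : forall y a, fd_rho y (fd_mu y a) = chi a;
  fd_kappa_inj : forall y, injective (fd_kappa y);
  fd_kappa_chart : forall y b b', fd_val b = thB eta b' -> fd_kappa y b = thB (sval y) b';
  fd_kappa_frac : forall y l, exists b t,
    invertible (fd_kappa y t) /\ fd_kappa y t * l = fd_kappa y b;
  fd_kappa_sep : forall y y', y <> y' ->
    exists b, fd_rho y (fd_kappa y b) != 0 /\ fd_rho y' (fd_kappa y' b) = 0;
  fd_kappa_cover : forall J : set fd_ring, J 0 ->
    (forall x y, J x -> J y -> J (x + y)) -> (forall b x, J x -> J (b * x)) ->
    (forall y, exists2 b, J b & invertible (fd_kappa y b)) -> J 1 }.

Lemma fiber_data_exists (chi : {rmorphism stalk z -> k}) : residue chi ->
  exists D : fiber_data chi, True.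
Proof.
move=> chi_res.
have [||Bs [v [phi' [e' [v_inj vphi ve gen]]]]] := @span_algebra _ _ _ (pullback z) n e_eta.
- by rewrite -(localization1 (chart_stalk chB Vfeta)); exact: chart_in_span.
- by move=> i j; rewrite -(localizationM (chart_stalk chB Vfeta)); exact: chart_in_span.
have spanE l : in_span (pullback z) e_eta l -> exists b, v b = l.
  move=> [a ->]; exists (\sum_i phi' (a i) * e' i).
  by rewrite rmorph_sum; apply: eq_bigr => i _; rewrite rmorphM /= vphi ve.
have spanV b : in_span (pullback z) e_eta (v b).
  have [a ->] := gen b; exists a.
  by rewrite rmorph_sum; apply: eq_bigr => i _; rewrite rmorphM /= vphi ve.
have /choice[j jP] := fun b => spanE _ (chart_in_span b).
have VY (y : {y | f y = z}) : V (f (sval y)) by rewrite (svalP y).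
pose mu (y : {y | f y = z}) := sval (cid (stalk_transport (svalP y))).
have muP (y : {y | f y = z}) : forall P : (forall w : X, {lrmorphism stalk w -> stalk (sval y)} -> Prop),
    P (f (sval y)) (mor_stalk f (sval y)) -> P z (mu y).
  exact: svalP (cid (stalk_transport (svalP y))).
have mu_sp y a : spB (sval y) (mu y a) = pullback z a.
  by apply: (muP y (fun w m => forall a, spB (sval y) (m a) = pullback w a)) => {}a; rewrite pullback_mor.
have mu_th y a : mu y (thA z a) = thB (sval y) (phi a).
  by apply: (muP y (fun w m => m (thA w a) = thB (sval y) (phi a))); rewrite th_phi.
have mu_local y a : invertible (mu y a) -> invertible a.
  by apply: (muP y (fun w m => forall a, invertible (m a) -> invertible a)) => {}a; exact: mor_local.
have mu_equ y : equational (mu y).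
  apply: (muP y (fun w (m : {lrmorphism stalk w -> stalk (sval y)}) => equational m)).
  exact: (flat_equational (@fflat _)).
have mu_transport (y : {y | f y = z})
    (P : forall w : X, {lrmorphism stalk w -> stalk (sval y)} -> Prop) :
    P z (mu y) -> P (f (sval y)) (mor_stalk f (sval y)).
  exact: (muP y (fun w m => P w m -> P (f (sval y)) (mor_stalk f (sval y)))).
have kappa_ex (y : {y | f y = z}) : exists ka : {lrmorphism Bs -> stalk (sval y)},
    forall b, spB (sval y) (ka b) = v b.
  apply: lrmorph_factor; first exact: spB_inj.
  move=> b; have [a ->] := spanV b.
  exists (\sum_i mu y (a i) * thB (sval y) (e i)).
  rewrite rmorph_sum; apply: eq_bigr => i _; rewrite rmorphM /= mu_sp.
  by congr (_ * _); exact: (sp_chart Xsch Xred geta _ chB (VY y)).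
pose ka y := sval (cid (kappa_ex y)).
have kaP y b : spB (sval y) (ka y b) = v b by move: b; exact: svalP (cid (kappa_ex y)).
have ka_chart y b b' : v b = thB eta b' -> ka y b = thB (sval y) b'.
  move=> vb; apply: (@spB_inj (sval y)); rewrite kaP vb; apply/esym.
  exact: (sp_chart Xsch Xred geta _ chB (VY y)).
have muE y a : mu y a = ka y (phi' a).
  by apply: (@spB_inj (sval y)); rewrite kaP mu_sp vphi.
have ka_inj y : injective (ka y).
  by move=> b b' kb; apply: v_inj; rewrite -!(kaP y) kb.
have ka_frac y l : exists b t, invertible (ka y t) /\ ka y t * l = ka y b.
  have [b [t [nt tl]]] := localization_fraction (chart_stalk chB (VY y)) l.
  exists (j b), (j t); rewrite !(ka_chart y _ _ (jP _)); split=> //.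
  exact: (localization_invertible (chart_stalk chB (VY y)) nt).
have loc (y : {y | f y = z}) (a : stalk (sval y)) : invertible a \/ invertible (1 - a).
  exact: stalk_local.
have n0 (y : {y | f y = z}) : ~ invertible (0 : stalk (sval y)).
  by move=> [b]; rewrite mul0r => /eqP; rewrite eq_sym oner_eq0.
have emi_non y l : extended_maximal_ideal (mu y) l -> ~ invertible l.
  move: l; apply: emi_lmin => [|x x'|a b na]; [exact: (n0 y)|exact: (local_noninvertibleD (loc y))|].
  by move=> /invertibleMl/mu_local.
(* b is a root of a nonzero polynomial over k modulo the extended ideal, whose elements are nonunits
   at y. *)
have rat0 y b : exists c, ~ invertible (ka y b - c%:A).
  have [P [P0 _ mP]] := polynomial_relation chi_res gen b.
  apply: (noninvertible_root P0); apply: emi_non; rewrite -lrmorph_horner.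
  exact: (emi_kappa muE).
have rat (y : {y | f y = z}) (l : stalk (sval y)) : exists c, ~ invertible (l - c%:A).
  have [b [t [ut tl]]] := ka_frac y l.
  have [cb nb] := rat0 y b; have [ct nt] := rat0 y t.
  have ct0 : ct != 0.
    by apply/eqP => ct0; apply: nt; rewrite ct0 scale0r subr0.
  exists (cb / ct) => ul; have := invertibleM ut ul.
  have -> : ka y t * (l - (cb / ct)%:A) = (ka y b - cb%:A) + (- (cb / ct)%:A) * (ka y t - ct%:A).
    have qt : (cb / ct)%:A * ct%:A = cb%:A :> stalk (sval y).
      by rewrite -scale_alg scalerA divfK.
    by rewrite mulrBr tl mulNr mulrBr qt opprB addrA subrK mulrC.
  by apply: (local_noninvertibleD (loc y)) => //; move=> /invertibleMr.
pose rho y := sval (cid (residue_exists (loc y) (rat y))).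
have rhoP y : residue (rho y) by exact: svalP (cid (residue_exists (loc y) (rat y))).
have rho_mu y a : rho y (mu y a) = chi a.
  apply/eqP; rewrite -subr_eq0 -[X in _ - X](rhoP y).1 -(lrmorph_alg (mu y)) -rmorphB -rmorphB.
  apply/eqP/(residue_noninvertible _ (rhoP y)) => /mu_local.
  by move=> /(residue_invertible _ chi_res); rewrite rmorphB chi_res.1 subrr eqxx.
have ka_sep (y y' : {y | f y = z}) : y <> y' -> exists b, rho y (ka y b) != 0 /\ rho y' (ka y' b) = 0.
  move=> yy'.
  have key (y0 : {y | f y = z}) b : rho y0 (ka y0 (j b)) != 0 <-> ~ ptB (sval y0) b.
    rewrite -(localization_invertibleP (chart_prime chB (VY y0)) (chart_stalk chB (VY y0))).
    by rewrite (ka_chart y0 _ _ (jP b)); exact: iff_sym (residue_invertible _ (rhoP y0)).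
  have [[b [nb b']]|H] := pselect (exists b, ~ ptB (sval y) b /\ ptB (sval y') b).
    exists (j b); split; first exact/key.
    by apply: contrapT => /eqP/key.
  have [[b [nb b']]|H'] := pselect (exists b, ~ ptB (sval y') b /\ ptB (sval y) b).
    (* Here b vanishes at y and not at y'; subtracting its value at y' exchanges the two roles. *)
    exists (j b - (rho y' (ka y' (j b)))%:A).
    have kaB (y0 : {y | f y = z}) b0 c : rho y0 (ka y0 (b0 - c%:A)) = rho y0 (ka y0 b0) - c.
      by rewrite rmorphB /= lrmorph_alg rmorphB /= (rhoP y0).1.
    rewrite !kaB subrr; split=> //; rewrite (_ : rho y _ = 0) ?sub0r ?oppr_eq0; first exact/key.
    by apply: contrapT => /eqP/key.
  exfalso; apply: yy'; apply: eq_sig_hprop => [? ? ?|]; first exact: Prop_irrelevance.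
  apply: (chart_inj chB (VY y) (VY y')); apply/seteqP; split=> b pb; apply: contrapT => nb.
    by apply: H'; exists b.
  by apply: H; exists b.
have ka_cover (J : set Bs) : J 0 -> (forall x y, J x -> J y -> J (x + y)) ->
    (forall b x, J x -> J (b * x)) -> (forall y, exists2 b, J b & invertible (ka y b)) -> J 1.
  move=> J0 JD JM Jy; apply: contrapT => nJ1.
  (* K is J plus the extended maximal ideal; by Nakayama it is proper if J is. A prime above K
     restricts to a prime of B lying over z, that is to a point of the fibre, where J supplies a
     unit: a contradiction. *)
  pose K := [set b | exists2 x, J x & extended_maximal_ideal phi' (b - x)].
  have iK : ideal K.
    split; first by exists 0 => //; rewrite subr0; exact: emi0.
      move=> a b [x Jx mx] [x' Jx' mx']; exists (x + x'); first exact: JD.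
      by rewrite opprD addrACA; exact: emiD.
    move=> a b [x Jx mx]; exists (a * x); first exact: JM.
    by rewrite -mulrBr; exact: emiM.
  have [||p [pp Kp _]] := krull (M := [set 1]) iK erefl.
  - by move=> _ _ -> ->; rewrite /= mulr1.
  - move=> a Ka /= a1; move: Ka; rewrite a1 => -[x Jx mx]; apply: nJ1.
    apply: (nakayama chi_res gen (J := J)) => //; first by move=> a' b; exact: JM.
    by move=> b; exists (b * x); [exact: JM|rewrite -{1}[b]mulr1 -mulrBr; exact: emiM].
  have jD a b : j (a + b) = j a + j b.
    by apply: v_inj; rewrite rmorphD /= !jP (localizationD (chart_stalk chB Vfeta)).
  have jM a b : j (a * b) = j a * j b.
    by apply: v_inj; rewrite rmorphM /= !jP (localizationM (chart_stalk chB Vfeta)).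
  have j0 : j 0 = 0.
    by apply: v_inj; rewrite rmorph0 jP (localization0 (chart_stalk chB Vfeta)).
  have j1 : j 1 = 1.
    by apply: v_inj; rewrite rmorph1 jP (localization1 (chart_stalk chB Vfeta)).
  have jphi a : j (phi a) = phi' (thA z a).
    by apply: v_inj; rewrite jP vphi pullback_chart.
  have pq : prime_ideal [set b | p (j b)].
    split=> /= [|a b pa pb|a b pb||a b]; rewrite ?j0 ?j1 ?jD ?jM.
    - exact: prime_ideal0 pp.
    - exact: prime_idealD.
    - exact: prime_idealM.
    - exact: prime_ideal1 pp.
    - exact: prime_ideal_prime.
  have punit b : invertible b -> ~ p b.
    by move=> [u bu] /(prime_idealM pp u); rewrite mulrC bu; exact: prime_ideal1.
  have [y0 Vy0 y0q] := chart_surj chB pq.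
  have fy0 : f y0 = z.
    apply: (chart_inj chA) => //.
    have toB a : ptA (f y0) a <-> p (phi' (thA z a)).
      rewrite -jphi -[p (j _)]/([set b | p (j b)] (phi a)) -y0q.
      suff H : ~ ptA (f y0) a <-> ~ ptB y0 (phi a) by split=> pa; apply: contrapT => /H.
      rewrite -(localization_invertibleP (chart_prime chA Vy0) (chart_stalk chA Vy0)).
      rewrite -(localization_invertibleP (chart_prime chB Vy0) (chart_stalk chB Vy0)).
      rewrite th_phi //; split; first exact: (invertible_rmorph (mor_stalk f y0)).
      exact: mor_local.
    apply/seteqP; split=> a; last first.
      move=> za; apply/toB/Kp; exists 0 => //; rewrite subr0 -[phi' _]mulr1.
      by apply: emi_lgen => /(localization_invertibleP (chart_prime chA Vz) (chart_stalk chA Vz)).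
    move=> /toB pa; apply: contrapT => /(localization_invertible (chart_stalk chA Vz)).
    by move=> /(invertible_rmorph phi')/punit.
  pose y : {y | f y = z} := exist _ y0 fy0.
  have [b Jb ub] := Jy y.
  have [s [b' [ns sb]]] := span_fraction (spanV b).
  have sbE : phi' (thA z s) * b = j b' by apply: v_inj; rewrite rmorphM /= vphi sb jP.
  have : p (j b').
    rewrite -sbE; apply: (prime_idealM pp); apply: Kp; exists b => //.
    by rewrite subrr; exact: emi0.
  rewrite -[p (j _)]/([set b | p (j b)] b') -y0q.
  apply/(localization_invertibleP (chart_prime chB Vy0) (chart_stalk chB Vy0)).
  rewrite -(ka_chart y _ _ (jP b')) -sbE rmorphM /= -muE; apply: invertibleM => //.
  exact/(invertible_rmorph (mu y))/(localization_invertible (chart_stalk chA Vz)).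
by exists (@FiberData chi Bs v phi' e' mu ka rho v_inj vphi ve gen muE mu_equ mu_transport rhoP
  rho_mu ka_inj ka_chart ka_frac ka_sep ka_cover).
Qed.

End AtPoint.
End FiberData.

Section FiberStructure.
Variables (k : closedFieldType) (X : kspace k) (f : kmor X X).
Hypotheses (Xsch : is_scheme X) (Xred : reduced X) (fflat : flat_mor f).
Variable eta : X.
Hypotheses (geta : generic_point eta) (gfeta : generic_point (f eta)).
Variables (V : set X) (A : comPzRingType) (ptA : X -> set A)
  (thA : forall x : X, A -> stalk x).
Variables (B : comPzRingType) (ptB : X -> set B)
  (thB : forall x : X, B -> stalk x) (phi : {rmorphism A -> B}).
Hypotheses (chA : affine_chart V ptA thA) (chB : affine_chart (f @^-1` V) ptB thB).
Hypothesis th_phi : forall x a, V (f x) -> thB x (phi a) = mor_stalk f x (thA (f x) a).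
Variables (n : nat) (e : 'I_n -> B).
Hypothesis e_gen : forall b, exists a : 'I_n -> A, b = \sum_(i < n) phi (a i) * e i.
Variable z : X.
Hypothesis Vz : V z.
Variable chi : {rmorphism stalk z -> k}.
Hypothesis chi_res : residue chi.

Local Notation F := (pullback Xsch Xred gfeta z).
Local Notation eL := (e_eta eta thB e).

(** The interface between algebra and geometry. [fs_vanish] and [fs_nonvanish] read the vanishing of
    h on the fibre off the coordinates of h^n and serve openness; [fs_cover] serves closedness and
    [fs_quotient] generic unramifiedness. *)
Record fiber_structure (r : nat) (b : 'I_r -> stalk eta) (s : nat) (zz : 'I_s -> X)
    (mult : 'I_s -> nat) : Prop := FiberStructure {
  fs_span : forall i, in_span F b (eL i);
  fs_free : forall a : 'I_r -> stalk z, \sum_i F (a i) * b i = 0 -> forall i, a i = 0;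
  fs_inj : injective zz;
  fs_fiber : forall i, f (zz i) = z;
  fs_surj : forall y, f y = z -> exists i, zz i = y;
  fs_rational : forall i, exists rho : {rmorphism stalk (zz i) -> k}, residue rho;
  fs_dim : forall i, fiber_dim (mor_stalk f (zz i)) (mult i);
  fs_pos : forall i, (0 < mult i)%N;
  fs_rank : (\sum_i mult i)%N = r;
  fs_vanish : forall h, (forall y, f y = z -> ptB y h) ->
    exists a : 'I_n -> stalk z,
      (forall i, ~ invertible (a i)) /\ thB eta h ^+ n = \sum_i F (a i) * eL i;
  fs_nonvanish : forall h y (a : 'I_r -> stalk z), f y = z -> ~ ptB y h ->
    thB eta h ^+ n = \sum_i F (a i) * b i -> exists i, invertible (a i);
  fs_cover : forall J : set B, ideal J -> (forall y, f y = z -> exists2 b, J b & ~ ptB y b) ->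
    exists s, ~ ptA z s /\ J (phi s);
  fs_quotient : forall y l, f y = z -> exists a : 'I_n -> stalk (f y),
    extended_maximal_ideal (mor_stalk f y)
      (l - \sum_i mor_stalk f y (a i) * thB y (e i)) }.

Lemma fiber_structure_exists : exists r b s zz mult, @fiber_structure r b s zz mult.
Proof.
have [D _] := fiber_data_exists Xsch Xred fflat geta gfeta chA chB th_phi e_gen Vz chi_res.
have Vfeta : V (f eta) by exact: (chart_generic chA gfeta Vz).
have VY (y : {y | f y = z}) : V (f (sval y)) by rewrite (svalP y).
pose v := fd_val D; pose ka := fd_kappa D; pose mu := fd_mu D.
have gen b : exists a : 'I_n -> stalk z, b = \sum_i fd_phi D (a i) * fd_e D i by exact: fd_gen.
have muE y a : mu y a = ka y (fd_phi D a) by exact: fd_muE.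
have rhoP y : residue (fd_rho D y) by exact: fd_rho_res.
have rho_mu y a : fd_rho D y (mu y a) = chi a by exact: fd_rho_mu.
have ka_inj y : injective (ka y) by exact: fd_kappa_inj.
have ka_frac y l : exists b t, invertible (ka y t) /\ ka y t * l = ka y b by exact: fd_kappa_frac.
have ka_sep y y' : y <> y' ->
    exists b, fd_rho D y (ka y b) != 0 /\ fd_rho D y' (ka y' b) = 0 by exact: fd_kappa_sep.
have cov (J : set (fd_ring D)) : J 0 -> (forall x y, J x -> J y -> J (x + y)) ->
  (forall b x, J x -> J (b * x)) -> (forall y, exists2 b, J b & invertible (ka y b)) -> J 1.
  exact: fd_kappa_cover.
have transp := @fd_mu_transport _ _ _ _ _ _ _ _ _ _ _ _ _ D.
have mu_eq y : equational (mu y) by exact: fd_mu_eq.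
have v_inj : injective v by exact: fd_val_inj.
have vphi a : v (fd_phi D a) = F a by exact: fd_val_phi.
have ve i : v (fd_e D i) = eL i by exact: fd_val_e.
have ka_chart y b b' : v b = thB eta b' -> ka y b = thB (sval y) b' by exact: fd_kappa_chart.
have ku (y : {y | f y = z}) b : ~ ptB (sval y) b <-> invertible (thB (sval y) b).
  exact: iff_sym (localization_invertibleP (chart_prime chB (VY y)) (chart_stalk chB (VY y)) b).
have vsum (I : finType) (a : I -> stalk z) (b : I -> fd_ring D) :
    v (\sum_i fd_phi D (a i) * b i) = \sum_i F (a i) * v (b i).
  by rewrite rmorph_sum; apply: eq_bigr => i _; rewrite rmorphM /= vphi.
have spanE l : in_span F eL l -> exists b, v b = l.
  move=> [a ->]; exists (\sum_i fd_phi D (a i) * fd_e D i).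
  by rewrite vsum; apply: eq_bigr => i _; rewrite ve.
have spanV b : in_span F eL (v b).
  have [a ->] := gen b; exists a.
  by rewrite vsum; apply: eq_bigr => i _; rewrite ve.
have /choice[j jP] := fun b => spanE _ (chart_in_span Xsch Xred gfeta chA chB th_phi e_gen Vz b).
have vjX h m : v (j h ^+ m) = thB eta h ^+ m by rewrite rmorphXn /= jP.
have [s [zz0 [zI zS]]] := fiber_enum chi_res gen muE rhoP rho_mu ka_sep.
pose bas i := fiber_basis chi_res gen muE ka_frac (zz0 i).
pose d i := sval (cid (bas i)); pose g i := sval (cid (svalP (cid (bas i)))).
have gB i : kbasis (extended_maximal_ideal (mu (zz0 i))) (ka (zz0 i) \o g i).
  exact: svalP (cid (svalP (cid (bas i)))).
have [b0 b0B] := fiber_kbasis chi_res gen muE rhoP ka_inj ka_frac ka_sep cov zI zS gB.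
have cardr : #|{: {i : 'I_s & 'I_(d i)}}| = (\sum_i d i)%N.
  by rewrite card_tagged sumnE big_map big_enum; apply: eq_bigr => i _; rewrite card_ord.
have [b bB] := kbasis_ord cardr b0B.
have [bgen bfree] := kbasis_free chi_res gen muE ka_inj ka_frac cov mu_eq bB.
exists (\sum_i d i)%N, (v \o b), s, (fun i => sval (zz0 i)), d; split.
- by move=> i; have [a ea] := bgen (fd_e D i); exists a; rewrite -ve ea vsum.
- by move=> a ab; apply: bfree; apply: v_inj; rewrite vsum rmorph0.
- move=> i i' ii'; apply: zI; apply: eq_sig_hprop ii' => ? ? ?; exact: Prop_irrelevance.
- by move=> i; exact: svalP (zz0 i).
- move=> y fy; have [i zi] := zS (exist _ y fy); exists i; by rewrite zi.
- by move=> i; exists (fd_rho D (zz0 i)).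
- move=> i; apply: (transp (zz0 i)
    (fun w (m : {lrmorphism stalk w -> stalk (sval (zz0 i))}) => fiber_dim m (d i))).
  by apply/(fiber_dim_kbasis _ chi_res); exists (ka (zz0 i) \o g i); exact: gB.
- move=> i; rewrite lt0n; apply/eqP => di.
  have [c] := (gB i).1 1; rewrite big1 ?subr0 => [|l _]; last first.
    by have ld : (l < d i)%N := ltn_ord l; rewrite di in ld.
  by move=> /(emi_rho chi_res rho_mu) /eqP; rewrite rmorph1 oner_eq0.
- by [].
- move=> h hz.
  have : extended_maximal_ideal (fd_phi D) (j h ^+ n).
    apply: (emi_local muE ka_inj ka_frac cov) => y; rewrite rmorphXn /=.
    apply: (kappa_nilpotent chi_res gen muE rhoP).
    apply/(residue_noninvertible _ (rhoP y)); rewrite (ka_chart y _ _ (jP h)).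
    by move=> /ku; apply; apply: hz; exact: svalP y.
  move=> /(emi_coef chi_res gen)[a [a0 ha]]; exists a; split=> [i|].
    exact/(residue_noninvertible _ chi_res).
  by rewrite -vjX ha vsum; apply: eq_bigr => i _; rewrite ve.
- move=> h y a fy nh hb; apply: contrapT => nu.
  pose y' : {y | f y = z} := exist _ y fy.
  have jb : j h ^+ n = \sum_i fd_phi D (a i) * b i by apply: v_inj; rewrite vjX hb vsum.
  have : extended_maximal_ideal (fd_phi D) (j h ^+ n).
    rewrite jb; apply: (big_ind (fun x => extended_maximal_ideal (fd_phi D) x)) => [||i _].
    + exact: emi0.
    + exact: emiD.
    + by apply: emi_lgen => ua; apply: nu; exists i.
  move=> /(emi_kappa muE y')/(emi_rho chi_res rho_mu)/eqP; apply/negP.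
  rewrite rmorphXn /= rmorphXn /= expf_neq0 //.
  by apply/(residue_invertible _ (rhoP y')); rewrite (ka_chart y' _ _ (jP h)); exact/ku.
- move=> J iJ Jy.
  (* The extension of J to the localization along the fibre. That it contains 1 means that J
     contains the image of some s outside the prime of z. *)
  pose J' := [set l : fd_ring D | exists s b, [/\ ~ ptA z s, J b & fd_phi D (thA z s) * l = j b]].
  have jD x y : j (x + y) = j x + j y.
    by apply: v_inj; rewrite rmorphD /= !jP (localizationD (chart_stalk chB Vfeta)).
  have jM x y : j (x * y) = j x * j y.
    by apply: v_inj; rewrite rmorphM /= !jP (localizationM (chart_stalk chB Vfeta)).
  have j0 : j 0 = 0 by apply: v_inj; rewrite rmorph0 jP (localization0 (chart_stalk chB Vfeta)).
  have jphi a : j (phi a) = fd_phi D (thA z a).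
    by apply: v_inj; rewrite jP vphi (pullback_chart Xsch Xred gfeta chA th_phi Vz).
  have ppz := chart_prime chA Vz.
  have phiM x y : fd_phi D (thA z (x * y)) = fd_phi D (thA z x) * fd_phi D (thA z y).
    by rewrite (localizationM (chart_stalk chA Vz)) rmorphM.
  have [] : J' 1.
    apply: cov.
    + by exists 1, 0; rewrite j0 mulr0; split=> //; [exact: prime_ideal1 ppz|exact: ideal0].
    + move=> x y [s1 [b1 [n1 J1 e1]]] [s2 [b2 [n2 J2 e2]]].
      exists (s1 * s2), (phi s2 * b1 + phi s1 * b2); split.
      * by move=> /(prime_ideal_prime ppz)[].
      * by apply: idealD => //; exact: idealM.
      * rewrite jD !jM !jphi -e1 -e2 phiM mulrDr !mulrA; congr (_ + _).
        by rewrite [fd_phi D (thA z s1) * _]mulrC.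
    + move=> x y [s1 [b1 [n1 J1 e1]]].
      have [s2 [b2 [n2 e2]]] := span_fraction chA chB th_phi Vz (spanV x).
      exists (s1 * s2), (b2 * b1); split.
      * by move=> /(prime_ideal_prime ppz)[].
      * exact: idealM.
      * have e2' : fd_phi D (thA z s2) * x = j b2 by apply: v_inj; rewrite rmorphM /= vphi e2 jP.
        by rewrite phiM [X in X * _]mulrC mulrACA e1 e2' jM.
    + move=> y; have [b1 J1 nb1] := Jy _ (svalP y); exists (j b1).
        exists 1, b1; split=> //; first exact: prime_ideal1 ppz.
        by rewrite (localization1 (chart_stalk chA Vz)) rmorph1 mul1r.
      by rewrite (ka_chart y _ _ (jP b1)); exact/ku.
  move=> s1 [b1 [n1 J1]]; rewrite mulr1 -jphi => e1; exists s1; split=> //.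
  suff -> : phi s1 = b1 by [].
  have := congr1 v e1; rewrite !jP => /eqP; rewrite -subr_eq0 => /eqP.
  rewrite -(localizationB (chart_stalk chB Vfeta)).
  by move=> /(chart_stalk_inj chB Xred geta Vfeta)/eqP; rewrite subr_eq0 => /eqP.
- move=> y l fy; pose y' : {y | f y = z} := exist _ y fy.
  move: l; apply: (transp y' (fun w (m : {lrmorphism stalk w -> stalk y}) =>
    forall l, exists a : 'I_n -> stalk w,
      extended_maximal_ideal m (l - \sum_i m (a i) * thB y (e i)))) => l.
  have [c mc] := kappa_surj chi_res gen muE ka_frac (y := y') l.
  have [a ca] := gen c; exists a; congr (extended_maximal_ideal _ (_ - _)): mc.
  rewrite ca rmorph_sum; apply: eq_bigr => i _; rewrite rmorphM /= -muE.
  by rewrite (ka_chart y' _ (e i)) // ve.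
Qed.

End FiberStructure.

Lemma field_degree_unique (A B : comNzRingType) (phi : {rmorphism A -> B}) n n' :
  field_degree phi n -> field_degree phi n' -> n = n'.
Proof.
suff H m m' : field_degree phi m -> field_degree phi m' -> (m <= m')%N.
  by move=> d d'; apply/eqP; rewrite eqn_leq !H.
move=> [e eB] [e' eB'].
have /choice[P PP] : forall i, exists a : {ffun 'I_m' -> A}, e i = \sum_j phi (a j) * e' j.
  by move=> i; have [a [ea _]] := eB' (e i); exists a.
have /choice[Q QP] : forall i, exists a : {ffun 'I_m -> A}, e' i = \sum_j phi (a j) * e j.
  by move=> i; have [a [ea _]] := eB (e' i); exists a.
pose MP : 'M[A]_(m, m') := \matrix_(i, j) P i j.
pose MQ : 'M[A]_(m', m) := \matrix_(i, j) Q i j.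
apply: (@mulmx1_min _ m m' MP MQ); apply/matrixP => i l; rewrite !mxE.
have [a [_ aU]] := eB (e i).
have a1 : a = [ffun l => (i == l)%:R].
  apply: aU; rewrite (bigD1 i) //= ffunE eqxx rmorph1 mul1r big1 ?addr0 // => j /negPf ji.
  by rewrite ffunE eq_sym ji rmorph0 mul0r.
have a2 : a = [ffun l => \sum_j MP i j * MQ j l].
  apply: aU; rewrite {1}PP; under eq_bigr do rewrite QP mulr_sumr.
  rewrite exchange_big; apply: eq_bigr => j _; rewrite ffunE rmorph_sum mulr_suml.
  by apply: eq_bigr => l' _; rewrite !mxE rmorphM mulrA.
by have := congr1 (fun g : {ffun 'I_m -> A} => g l) (etrans (esym a2) a1); rewrite !ffunE.
Qed.

Lemma rational_residue (k : fieldType) (X : kspace k) (z : X) :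
  rational_point z <-> exists chi : {rmorphism stalk z -> k}, residue chi.
Proof.
split; first by apply: residue_exists; exact: stalk_local.
move=> [chi rchi] a; exists (chi a); apply/(residue_noninvertible _ rchi).
by rewrite rmorphB rchi.1 subrr.
Qed.

(** * Degree, closedness and openness of the endomorphism *)

Section Geometry.
Variables (k : closedFieldType) (X : kspace k) (f : kmor X X).
Hypotheses (Xsch : is_scheme X) (Xred : reduced X).
Hypothesis fsep : separable_mor f.
Variable eta : X.
Hypothesis geta : generic_point eta.

Lemma generic_unique (eta' : X) : generic_point eta' -> eta' = eta.
Proof.
move=> geta'; have [U [A [pt [theta [Ux ch]]]]] := Xsch eta.
have U' := chart_generic ch geta' Ux.
apply: (chart_inj ch U' Ux).
by rewrite (chart_generic_ideal ch Xred geta' Ux) (chart_generic_ideal ch Xred geta Ux).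
Qed.

Hypothesis gfeta : generic_point (f eta).

Let K := stalk (f eta).
Let sA z : {lrmorphism stalk z -> K} := spA Xsch Xred gfeta z.

Lemma generic_stalk_field (a : K) : a != 0 -> invertible a.
Proof.
move=> a0; have [U [A [pt [theta [Ux ch]]]]] := Xsch (f eta).
have [b [s [ns sa]]] := localization_fraction (chart_stalk ch Ux) a.
have us := localization_invertible (chart_stalk ch Ux) ns.
apply: (@invertibleMr _ (theta (f eta) s)); rewrite sa.
apply: (localization_invertible (chart_stalk ch Ux)).
rewrite (chart_generic_ideal ch Xred gfeta Ux) => /= b0.
case/eqP: a0; apply: (invertible_lreg us).
by rewrite sa b0 mulr0 (localization0 (chart_stalk ch Ux)).
Qed.

Section Chart.
Variables (V : set X) (A : comPzRingType) (ptA : X -> set A)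
  (thA : forall x : X, A -> stalk x).
Variables (B : comPzRingType) (ptB : X -> set B)
  (thB : forall x : X, B -> stalk x) (phi : {rmorphism A -> B}).
Hypotheses (chA : affine_chart V ptA thA) (chB : affine_chart (f @^-1` V) ptB thB).
Hypothesis th_phi : forall x a, V (f x) -> thB x (phi a) = mor_stalk f x (thA (f x) a).
Variables (n : nat) (e : 'I_n -> B).
Hypothesis e_gen : forall b, exists a : 'I_n -> A, b = \sum_(i < n) phi (a i) * e i.
Variable z : X.
Hypothesis Vz : V z.
Variables (r : nat) (b : 'I_r -> stalk eta) (s : nat) (zz : 'I_s -> X) (mult : 'I_s -> nat).
Hypothesis fs : @fiber_structure k X f Xsch Xred eta gfeta A ptA B ptB thB phi n e z r b s zz mult.

Let Vfeta : V (f eta).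
Proof. exact: (chart_generic chA gfeta Vz). Qed.

(** A common denominator from the chart turns a relation over the function field into one over the
    stalk at z, where b is free. *)
Lemma structure_indep (c : 'I_r -> K) : \sum_i mor_stalk f eta (c i) * b i = 0 -> forall i, c i = 0.
Proof.
move=> cb i.
have [t [a [nt ta]]] := common_fraction c (chart_prime chA Vfeta) (chart_stalk chA Vfeta).
have a0 : forall i, thA z (a i) = 0.
  apply: (fs_free fs).
  transitivity (mor_stalk f eta (thA (f eta) t) * \sum_i mor_stalk f eta (c i) * b i);
    last by rewrite cb mulr0.
  rewrite mulr_sumr.
  apply: eq_bigr => j _; rewrite mulrA -rmorphM ta.
  by congr (mor_stalk f eta _ * _); exact: (sp_chart Xsch Xred gfeta _ chA Vz).
apply: (invertible_lreg (localization_invertible (chart_stalk chA Vfeta) nt)).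
rewrite ta mulr0 (chart_stalk_inj chA Xred gfeta Vz (a0 i)).
exact: (localization0 (chart_stalk chA Vfeta)).
Qed.

(** Only the denominators of the chart algebra have to be inverted. If P = Q X + P(0) is the minimal
    polynomial of t, then P(0) is nonzero by minimality and the inverse of t is - Q(t) / P(0), which
    stays in the span. *)
Lemma structure_span l : in_span (mor_stalk f eta) b l.
Proof.
pose E := e_eta eta thB e.
have up c l' : in_span (pullback Xsch Xred gfeta z) c l' -> in_span (mor_stalk f eta) c l'.
  by move=> [a ->]; exists (fun i => sA z (a i)).
have thBE x : in_span (mor_stalk f eta) E (thB eta x).
  exact/up/(chart_in_span Xsch Xred gfeta chA chB th_phi e_gen Vz).
have EM x y : in_span (mor_stalk f eta) E x -> in_span (mor_stalk f eta) E y ->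
    in_span (mor_stalk f eta) E (x * y).
  apply: in_span_mul => i j.
  by rewrite -(localizationM (chart_stalk chB Vfeta)); exact: thBE.
have E1 : in_span (mor_stalk f eta) E 1.
  by rewrite -(localization1 (chart_stalk chB Vfeta)); exact: thBE.
have EK c x : in_span (mor_stalk f eta) E x -> in_span (mor_stalk f eta) E (mor_stalk f eta c * x).
  exact: in_spanZ.
have Ehorner x (Q : {poly K}) : in_span (mor_stalk f eta) E x ->
    in_span (mor_stalk f eta) E (map_poly (mor_stalk f eta) Q).[x].
  move=> Ex; elim/poly_ind: Q => [|Q c IH]; first by rewrite rmorph0 horner0; exact: in_span0.
  rewrite rmorphD rmorphM /= map_polyX map_polyC /= !hornerE.
  by apply: in_spanD; [exact: EM|rewrite -[mor_stalk f eta c]mulr1; exact: EK].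
suff El : in_span (mor_stalk f eta) E l.
  have [a ->] := El; apply: (big_ind (in_span (mor_stalk f eta) b)) => [||i _].
  - exact: in_span0.
  - exact: in_spanD.
  - by apply: in_spanZ; apply: up; exact: (fs_span fs).
have [x [t [nt tl]]] := localization_fraction (chart_stalk chB Vfeta) l.
have ut := localization_invertible (chart_stalk chB Vfeta) nt.
have [P [[Pmon P0 Pmin] _]] := fsep geta (thB eta t).
have [Q PQ] : exists Q, P = Q * 'X + (P`_0)%:P.
  exists (\poly_(i < (size P).-1) P`_i.+1); apply/polyP => -[|i].
    by rewrite coefD coefMX coefC add0r.
  rewrite coefD coefMX coefC addr0 /= coef_poly; case: ltnP => // szi.
  by rewrite nth_default // (leq_trans (leqSpred _)).
have PE : (map_poly (mor_stalk f eta) Q).[thB eta t] * thB eta t = - mor_stalk f eta P`_0.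
  apply/eqP; rewrite -addr_eq0 -P0 {2}PQ rmorphD rmorphM /= map_polyX map_polyC /=.
  by rewrite !hornerE.
have P00 : P`_0 != 0.
  apply/eqP => p0; have Qn0 : Q != 0.
    by apply: contraTneq Pmon => Q0; rewrite PQ Q0 p0 mul0r addr0 monicE lead_coef0 eq_sym oner_eq0.
  have : (size P <= size Q)%N.
    apply: Pmin => //; apply: (invertible_lreg ut).
    by rewrite mulrC PE p0 rmorph0 oppr0 mulr0.
  by rewrite PQ p0 addr0 size_mulX // ltnn.
have [u pu] := generic_stalk_field P00.
have -> : l = mor_stalk f eta (- u) * ((map_poly (mor_stalk f eta) Q).[thB eta t] * thB eta x).
  apply: (invertible_lreg ut); rewrite tl mulrCA [thB eta t * _]mulrA [thB eta t * _]mulrC PE.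
  by rewrite mulrA mulrN -mulNr -rmorphN opprK -rmorphM [u * _]mulrC pu rmorph1 mul1r.
by apply: EK; apply: EM; [apply: Ehorner|]; exact: thBE.
Qed.

Lemma structure_degree : field_degree (mor_stalk f eta) r.
Proof.
exists b => l; have [a la] := structure_span l; exists [ffun i => a i]; split.
  by rewrite la; apply: eq_bigr => i _; rewrite ffunE.
move=> c lc; apply/ffunP => i; rewrite ffunE; apply/eqP; rewrite -subr_eq0; apply/eqP.
apply: (structure_indep (c := fun i => a i - c i)).
under eq_bigr do rewrite rmorphB mulrBl.
by rewrite sumrB -la -lc subrr.
Qed.

(** The set searched by [xget] is inhabited, so the default 0 does not arise; uniqueness of the
    generic point and of the degree identify the value. *)
Lemma structure_topological_degree : topological_degree f = r.
Proof.
have ex : [set d | exists2 eta' : X, generic_point eta' & field_degree (mor_stalk f eta') d] r.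
  by exists eta => //; exact: structure_degree.
have [eta' geta' deg] := xgetPex 0%N (ex_intro _ r ex).
rewrite /topological_degree; move: deg; rewrite (generic_unique geta') => deg.
exact: field_degree_unique deg structure_degree.
Qed.

End Chart.

End Geometry.

Section Fibers.
Variables (k : closedFieldType) (X : kspace k) (f : kmor X X).
Hypotheses (Xsch : is_scheme X) (Xred : reduced X).
Hypotheses (fflat : flat_mor f) (ffin : finite_mor f) (fsep : separable_mor f).
Variable eta : X.
Hypothesis geta : generic_point eta.

Let gfeta : generic_point (f eta).
Proof. by rewrite (mor_generic Xred fflat ffin geta). Qed.

Lemma multiplicity_eq (g : kmor X X) y d : rational_point (g y) ->
  fiber_dim (mor_stalk g y) d -> multiplicity g y = d.
Proof.
move=> /rational_residue[chi rchi] gd.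
have gd' : fiber_dim (mor_stalk g y) (multiplicity g y) := xgetPex 0%N (ex_intro _ d gd).
exact: fiber_dim_unique rchi gd' gd.
Qed.

Lemma rational_fiber z : rational_point z -> exists (s : nat) (zz : 'I_s -> X),
  [/\ injective zz, forall y, f y = z <-> exists i, zz i = y,
      forall i, rational_point (zz i),
      forall i, fiber_dim (mor_stalk f (zz i)) (multiplicity f (zz i)) &
      (forall i, (0 < multiplicity f (zz i))%N) /\
      (\sum_i multiplicity f (zz i))%N = topological_degree f].
Proof.
move=> zrat; have [chi rchi] := (rational_residue z).1 zrat.
have [V [A [ptA [thA [B [ptB [thB [phi [Vz chA chB th_phi [n [e e_gen]]]]]]]]]]] := ffin z.
have [r [b [s [zz [mult fs]]]]] :=
  fiber_structure_exists Xsch Xred fflat geta gfeta chA chB th_phi e_gen Vz rchi.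
have mE i : multiplicity f (zz i) = mult i.
  by apply: multiplicity_eq (fs_dim fs i); rewrite (fs_fiber fs).
exists s, zz; split.
- exact: (fs_inj fs).
- move=> y; split; first by move=> fy; exact: (fs_surj fs fy).
  by move=> [i <-]; exact: (fs_fiber fs).
- by move=> i; apply/rational_residue; exact: (fs_rational fs).
- by move=> i; rewrite mE; exact: (fs_dim fs).
- split; first by move=> i; rewrite mE; exact: (fs_pos fs).
  under eq_bigr do rewrite mE; rewrite (fs_rank fs); apply/esym.
  by rewrite (structure_topological_degree fsep geta chA chB th_phi e_gen Vz fs).
Qed.

Lemma rational_preimage y : rational_point (f y) -> rational_point y.
Proof.
move=> /rational_fiber[s [zz [_ zP zrat _ _]]].
by have [i <-] := (zP y).1 erefl.
Qed.

Lemma rational_image y : rational_point y -> rational_point (f y).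
Proof.
move=> yrat a; have [c nc] := yrat (mor_stalk f y a); exists c => ua; apply: nc.
by rewrite -(lrmorph_alg (mor_stalk f y)) -rmorphB; exact: (invertible_rmorph (mor_stalk f y)).
Qed.

Lemma fiber_dim_multiplicity y : rational_point (f y) ->
  fiber_dim (mor_stalk f y) (multiplicity f y) /\ (0 < multiplicity f y)%N.
Proof.
move=> /rational_fiber[s [zz [_ zP _ zd [zpos _]]]].
by have [i <-] := (zP y).1 erefl.
Qed.

(** The ideal of functions vanishing on C has, at each point over z, an element not vanishing there.
    By [fs_cover] it contains phi t for some t with t(z) nonzero, and the locus where t does not
    vanish avoids f(C). *)
Lemma closed_image (C : set X) z : closed C -> rational_point z ->
  (forall y, f y = z -> ~ C y) ->
  exists N, [/\ open N, N z & forall y, N (f y) -> ~ C y].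
Proof.
move=> cC zrat zC; have [chi rchi] := (rational_residue z).1 zrat.
have [V [A [ptA [thA [B [ptB [thB [phi [Vz chA chB th_phi [n [e e_gen]]]]]]]]]]] := ffin z.
have [r [b [s [zz [mult fs]]]]] :=
  fiber_structure_exists Xsch Xred fflat geta gfeta chA chB th_phi e_gen Vz rchi.
pose J := [set x | forall y, V (f y) -> C y -> ptB y x].
have iJ : ideal J.
  split=> [y Vy _|x x' Jx Jx' y Vy Cy|x x' Jx' y Vy Cy].
  - exact: prime_ideal0 (chart_prime chB Vy).
  - by apply: (prime_idealD (chart_prime chB Vy)); [exact: Jx|exact: Jx'].
  - by apply: (prime_idealM (chart_prime chB Vy)); exact: Jx'.
have [y fy|t [nt Jt]] := fs_cover fs iJ.
  have Vy : (f @^-1` V) y by rewrite /= fy.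
  have [x [nx xC]] := chart_open_basic chB (closed_openC cC) Vy (zC y fy).
  exists x => // y' Vy' Cy'; apply: contrapT => ny'.
  exact: xC Vy' ny' Cy'.
exists [set w | V w /\ ~ ptA w t]; split=> //; first exact: (chart_basic_open chA).
move=> y [Vy nty] Cy; suff : ~ ptB y (phi t) by apply; exact: Jt.
apply/(localization_invertibleP (chart_prime chB Vy) (chart_stalk chB Vy)).
rewrite th_phi //; apply: (invertible_rmorph (mor_stalk f y)).
exact: (localization_invertible (chart_stalk chA Vy)).
Qed.

Lemma sum_noninvertible (W : X) (I : finType) (F : I -> stalk W) :
  (forall i, ~ invertible (F i)) -> ~ invertible (\sum_i F i).
Proof.
move=> nF; apply: (big_ind (fun x : stalk W => ~ invertible x)) => //.
  by move=> [u]; rewrite mul0r => /eqP; rewrite eq_sym oner_eq0.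
exact: (local_noninvertibleD (@stalk_local _ X W)).
Qed.

(** Choose h nonzero at y and vanishing outside U on the chart. A coordinate of h^n on the basis
    over f y is a unit. If the fibre over a nearby w missed U, the coefficients of h^n on the e i
    over w could be taken nonunits, making that same coordinate, unique in the function field, a
    nonunit. *)
Lemma open_image (U : set X) y : open U -> U y -> rational_point (f y) ->
  exists N, [/\ open N, N (f y) &
    forall w, N w -> rational_point w -> exists y', f y' = w /\ U y'].
Proof.
move=> oU Uy zrat; have [chi rchi] := (rational_residue (f y)).1 zrat.
have [V [A [ptA [thA [B [ptB [thB [phi [Vz chA chB th_phi [n [e e_gen]]]]]]]]]]] := ffin (f y).
have [r [b [s [zz [mult fs]]]]] :=
  fiber_structure_exists Xsch Xred fflat geta gfeta chA chB th_phi e_gen Vz rchi.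
have [h [nh hU]] := chart_open_basic chB oU Vz Uy.
pose sA z : {lrmorphism stalk z -> stalk (f eta)} := spA Xsch Xred gfeta z.
pose m := mor_stalk f eta.
have Vfeta : V (f eta) by exact: (chart_generic chA gfeta Vz).
have [g gP] := choice (fs_span fs).
have [a ha] : exists a : 'I_r -> stalk (f y), thB eta h ^+ n = \sum_i m (sA _ (a i)) * b i.
  have hn : thB eta h ^+ n = thB eta (h ^+ n).
    elim: (n) => [|j IH]; first by rewrite !expr0 (localization1 (chart_stalk chB Vfeta)).
    by rewrite !exprS (localizationM (chart_stalk chB Vfeta)) IH.
  have [c hc] := chart_in_span Xsch Xred gfeta chA chB th_phi e_gen Vz (h ^+ n).
  exists (fun j => \sum_l c l * g l j); rewrite hn hc.
  under eq_bigr do rewrite gP mulr_sumr.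
  rewrite exchange_big; apply: eq_bigr => j _; rewrite !rmorph_sum mulr_suml.
  by apply: eq_bigr => l _; rewrite mulrA -!rmorphM.
have [i0 [u au]] := fs_nonvanish fs erefl nh ha.
have near_a : \forall w \near f y, forall i : 'I_r, exists a', sA w a' = sA _ (a i).
  by apply: filter_forall => i; exact: sp_spread.
have near_g : \forall w \near f y, forall p : 'I_n * 'I_r, exists a', sA w a' = sA _ (g p.1 p.2).
  by apply: filter_forall => p; exact: sp_spread.
(* The inverse u is spread out as well, so that the chosen coordinate remains a unit at w. *)
have near_u : \forall w \near f y, exists a', sA w a' = sA _ u by exact: sp_spread.
have near_V : \forall w \near f y, V w by apply: open_nbhs_nbhs; split=> //; exact: (chart_open chA).
have near_all : \forall w \near f y, [/\ V w, exists a', sA w a' = sA _ u,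
    forall i : 'I_r, exists a', sA w a' = sA _ (a i) &
    forall p : 'I_n * 'I_r, exists a', sA w a' = sA _ (g p.1 p.2)].
  by near=> w; split; near: w.
move: near_all; rewrite /prop_near1 nbhsE => -[N [oN Ny] NP]; exists N; split=> // w Nw wrat.
have [Vw [u' uE] /choice[a' aE] /choice[g' gE]] := NP _ Nw.
have [chiw rchiw] := (rational_residue w).1 wrat.
have [rw [bw [sw [zw [multw fsw]]]]] :=
  fiber_structure_exists Xsch Xred fflat geta gfeta chA chB th_phi e_gen Vw rchiw.
apply: contrapT => nw.
have [y' fy'|c [nc hc]] := fs_vanish fsw (h := h).
  apply: contrapT => nhy; apply: nw; exists y'; split=> //.
  by apply: hU => //=; rewrite fy'.
have hb : thB eta h ^+ n = \sum_j m (sA w (\sum_l c l * g' (l, j))) * b j.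
  rewrite hc; under eq_bigr do rewrite gP mulr_sumr.
  rewrite exchange_big; apply: eq_bigr => j _; rewrite !rmorph_sum mulr_suml.
  by apply: eq_bigr => l _; rewrite mulrA !rmorphM /= gE.
have a'0 : a' i0 = \sum_l c l * g' (l, i0).
  apply: (@spA_inj _ _ f Xsch Xred eta gfeta w); apply/eqP; rewrite -subr_eq0; apply/eqP.
  apply: (structure_indep chA Vz fs
    (c := fun j => sA w (a' j) - sA w (\sum_l c l * g' (l, j)))).
  under eq_bigr do rewrite rmorphB mulrBl; rewrite sumrB -hb ha.
  by apply/eqP; rewrite subr_eq0; apply/eqP/eq_bigr => j _; rewrite aE.
have : ~ invertible (a' i0).
  by rewrite a'0; apply: sum_noninvertible => l /invertibleMl; exact: nc.
apply; exists u'; apply: (@spA_inj _ _ f Xsch Xred eta gfeta w).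
by rewrite rmorphM /= -/(sA w) aE uE -rmorphM au !rmorph1.
Unshelve. all: by end_near. Qed.

End Fibers.

Lemma sp_generic_id (k : fieldType) (X : kspace k) (Xsch : is_scheme X) (Xred : reduced X)
    (eta : X) (geta : generic_point eta) a : sp Xsch Xred geta eta a = a.
Proof.
have [U [s [oU Ue Us <-]]] := germ_surj a.
exact: (sp_section Xsch Xred geta oU Us Ue).
Qed.

Lemma poly_spread (k : fieldType) (X : kspace k) (Xsch : is_scheme X) (Xred : reduced X)
    (eta : X) (geta : generic_point eta) (P : {poly stalk eta}) :
  \forall w \near eta, exists P' : {poly stalk w}, map_poly (sp Xsch Xred geta w) P' = P.
Proof.
have near_P : \forall w \near eta, forall i : 'I_(size P), exists a', sp Xsch Xred geta w a' = P`_i.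
  by apply: filter_forall => i; rewrite -[P`_i](sp_generic_id Xsch Xred geta); exact: sp_spread.
apply: filterS near_P => w /choice[a aP]; exists (\poly_(i < size P) if insub i is Some j then a j else 0).
apply/polyP => i; rewrite coef_map coef_poly.
case: ltnP => [ilt|ige]; last by rewrite /= rmorph0 nth_default.
by rewrite insubT /= aP.
Qed.

Lemma emi_horner (k : fieldType) (A B : comAlgType k) (phi : {lrmorphism A -> B})
    (chi : {rmorphism A -> k}) x (P : {poly A}) : residue chi ->
  extended_maximal_ideal phi (horner_alg x (map_poly chi P) - (map_poly phi P).[x]).
Proof.
move=> rchi; elim/poly_ind: P => [|P c IH]; first by rewrite !rmorph0 horner0 subr0; exact: emi0.
rewrite !rmorphD !rmorphM /= !map_polyX !map_polyC /= horner_algX horner_algC !hornerE.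
rewrite opprD addrACA -mulrBl; apply: emiD; first by rewrite mulrC; exact: emiM.
rewrite -opprB; apply: emiN; have := emi_residue phi rchi c 1.
by rewrite mulr1.
Qed.

(** * Generic unramifiedness *)

Section Unramified.
Variables (k : closedFieldType) (X : kspace k) (f : kmor X X).
Hypotheses (Xsch : is_scheme X) (Xred : reduced X).
Hypotheses (fflat : flat_mor f) (ffin : finite_mor f) (fsep : separable_mor f).
Variable eta : X.
Hypothesis geta : generic_point eta.

Let gfeta : generic_point (f eta).
Proof. by rewrite (mor_generic Xred fflat ffin geta). Qed.

(** Each generator e l is a root of a polynomial P with u P + v P' = 1 over the generic stalk, and
    these data extend to a neighbourhood of f eta. At y above it the value of e l is a simple root
    of the reduction of P, so e l is a scalar modulo m and the fibre algebra at y is k. *)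
Lemma generically_unramified : exists U, [/\ open U, U eta &
  forall y, U y -> rational_point (f y) -> multiplicity f y = 1%N].
Proof.
have [V [A [ptA [thA [B [ptB [thB [phi [Vz chA chB th_phi [n [e e_gen]]]]]]]]]]] := ffin (f eta).
have /choice[Q QP] : forall l : 'I_n,
    exists q : {poly stalk (f eta)} * {poly stalk (f eta)} * {poly stalk (f eta)},
    (map_poly (mor_stalk f eta) q.1.1).[thB eta (e l)] = 0 /\
    q.1.2 * q.1.1 + q.2 * q.1.1^`() = 1.
  move=> l; have [P [[_ P0 _] [u [v uv]]]] := fsep geta (thB eta (e l)).
  by exists (P, u, v).
pose sA w := sp Xsch Xred gfeta w.
have near_Q : \forall w \near f eta, V w /\ forall l : 'I_n,
    exists q : {poly stalk w} * {poly stalk w} * {poly stalk w},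
      [/\ map_poly (sA w) q.1.1 = (Q l).1.1, map_poly (sA w) q.1.2 = (Q l).1.2 &
          map_poly (sA w) q.2 = (Q l).2].
  apply: filterI; first by apply: open_nbhs_nbhs; split=> //; exact: (chart_open chA).
  apply: filter_forall => l.
  have n1 := poly_spread Xsch Xred gfeta (Q l).1.1.
  have n2 := poly_spread Xsch Xred gfeta (Q l).1.2.
  have n3 := poly_spread Xsch Xred gfeta (Q l).2.
  near=> w.
  have [q1 q1E] : exists P', map_poly (sA w) P' = (Q l).1.1 by near: w.
  have [q2 q2E] : exists P', map_poly (sA w) P' = (Q l).1.2 by near: w.
  have [q3 q3E] : exists P', map_poly (sA w) P' = (Q l).2 by near: w.
  by exists (q1, q2, q3).
move: near_Q; rewrite /prop_near1 nbhsE => -[N [oN Ne] NQ].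
exists (f @^-1` N); split=> //.
  by apply: open_comp => // x _; exact: mor_continuous.
move=> y Ny zrat; have [chi rchi] := (rational_residue (f y)).1 zrat.
have [Vy /choice[q qP]] := NQ _ Ny.
have yrat := rational_preimage Xsch Xred fflat ffin fsep geta zrat.
have [rho rrho] := (rational_residue y).1 yrat.
have [r [b [s [zz [mult fs]]]]] :=
  fiber_structure_exists Xsch Xred fflat geta gfeta chA chB th_phi e_gen Vy rchi.
pose mu := mor_stalk f y.
have rho_mu a : rho (mu a) = chi a.
  apply/eqP; rewrite -subr_eq0 -[X in _ - X]rrho.1 -(lrmorph_alg mu) -rmorphB -rmorphB.
  apply/eqP/(residue_noninvertible _ rrho) => /mor_local.
  by move=> /(residue_invertible _ rchi); rewrite rmorphB rchi.1 subrr eqxx.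
have mrho := @emi_proper _ _ _ mu _ rchi rho rho_mu.
have sAinj w : injective (sA w) by exact: sp_inj.
have smu (P : {poly stalk (f y)}) : map_poly (sp Xsch Xred geta y) (map_poly mu P) =
    map_poly (mor_stalk f eta) (map_poly (sA _) P).
  rewrite -!map_poly_comp; apply: eq_map_poly => a /=.
  by rewrite -(sp_mor Xsch Xred geta gfeta).
have el l : extended_maximal_ideal mu (thB y (e l) - (rho (thB y (e l)))%:A).
  set eps := thB y (e l); have [q1E q2E q3E] := qP l.
  have q0 : (map_poly mu (q l).1.1).[eps] = 0.
    apply: (@sp_inj _ _ Xsch Xred eta geta y); rewrite rmorph0 -horner_map /= smu q1E.
    by rewrite (sp_chart Xsch Xred geta (e l) chB Vy) (QP l).1.
  have quv : (q l).1.2 * (q l).1.1 + (q l).2 * (q l).1.1^`() = 1.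
    apply: (map_inj_poly (@sAinj (f y))); first exact: rmorph0.
    rewrite rmorphD !rmorphM /= -deriv_map q1E q2E q3E rmorph1; exact: (QP l).2.
  pose p := map_poly chi (q l).1.1.
  have puv : map_poly chi (q l).1.2 * p + map_poly chi (q l).2 * p^`() = 1.
    by rewrite /p deriv_map -!rmorphM -rmorphD quv rmorph1.
  have mp : extended_maximal_ideal mu (horner_alg eps p).
    by rewrite -[horner_alg eps p]subr0 -q0; exact: emi_horner.
  have pc : p.[rho eps] = 0.
    by have := mrho _ mp; rewrite /= residue_horner.
  have /factor_theorem[p' pE] : root p (rho eps) by apply/eqP.
  (* Evaluating the Bezout identity at the root shows that it is simple, so the cofactor p' is a
     unit at eps and can be cancelled. *)
  have p'c : p'.[rho eps] != 0.
    apply/eqP => p'0; have := congr1 (fun P => P.[rho eps]) puv.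
    rewrite hornerD !hornerM pc mulr0 add0r pE derivM derivXsubC mulr1 hornerD hornerM.
    rewrite hornerXsubC subrr mulr0 add0r p'0 mulr0 hornerC => /eqP.
    by rewrite eq_sym oner_eq0.
  have [u pu] : invertible (horner_alg eps p').
    by apply: rrho.2; rewrite residue_horner.
  have := emiM u mp; rewrite pE rmorphM rmorphB /= horner_algX horner_algC mulrA.
  by rewrite [u * _]mulrC pu mul1r.
have xk x : exists c : k, extended_maximal_ideal mu (x - c%:A).
  have [a ma] := fs_quotient fs x erefl.
  exists (\sum_i chi (a i) * rho (thB y (e i))).
  rewrite -[x](subrK (\sum_i mu (a i) * thB y (e i))) -addrA; apply: emiD => //.
  rewrite scaler_suml -sumrB.
  apply: (big_ind (fun x => extended_maximal_ideal mu x)) => [||i _]; [exact: emi0|exact: emiD|].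
  rewrite -(subrK (chi (a i) *: thB y (e i)) (mu (a i) * _)) -addrA.
  apply: emiD; first exact: emi_residue.
  by rewrite -scalerA -scalerBr scale_alg; apply: emiM; exact: el.
apply: multiplicity_eq => //; apply/(fiber_dim_kbasis _ rchi); exists (fun=> 1); split=> [x|c mc i].
  by have [c mc] := xk x; exists (fun=> c); rewrite big_ord1.
move: mc; rewrite big_ord1 => /mrho /=; rewrite rrho.1.
by rewrite [i]ord1.
Unshelve. all: by end_near.
Qed.

End Unramified.

(** * Multiplicities of the iterates *)

Section Iterates.
Variables (k : closedFieldType) (X : kspace k) (f : kmor X X).
Hypotheses (Xsch : is_scheme X) (Xred : reduced X).
Hypotheses (fflat : flat_mor f) (ffin : finite_mor f) (fsep : separable_mor f).
Variable eta : X.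
Hypothesis geta : generic_point eta.

Lemma iter_morE n y : iter_mor n f y = iter n f y.
Proof. by elim: n => //= n ->. Qed.

(** Flatness of an iterate enters only through the equational criterion, which composes directly. *)
Lemma iter_equational n y : equational (mor_stalk (iter_mor n f) y).
Proof.
elim: n => [|n IH]; first exact: equational_id.
apply: (equational_comp (phi := mor_stalk f (iter_mor n f y)) (psi := mor_stalk (iter_mor n f) y)).
  exact: (flat_equational (@fflat _)).
exact: IH.
Qed.

Lemma iter_rational n y : rational_point (iter_mor n f y) -> rational_point y.
Proof. by elim: n => // n IH /= /(rational_preimage Xsch Xred fflat ffin fsep geta)/IH. Qed.

Lemma iter_fiber_dim n y : rational_point (iter_mor n f y) ->
  fiber_dim (mor_stalk (iter_mor n f) y) (\prod_(i < n) multiplicity f (iter i f y))%N.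
Proof.
elim: n => [|n IH] yrat.
  have [chi rchi] := (rational_residue y).1 yrat.
  rewrite big_ord0; exists (fun=> 1); split=> [b|a ma i].
    by exists (fun=> b); rewrite big_ord1 mulr1 subrr; exact: emi0.
  move: ma; rewrite big_ord1 mulr1 [i]ord1 => ma.
  apply/(residue_noninvertible _ rchi).
  exact: (@emi_proper _ _ _ (mor_stalk (iter_mor 0 f) y) _ rchi chi (fun=> erefl) _ ma).
have nrat := rational_preimage Xsch Xred fflat ffin fsep geta yrat.
have [chi rchi] := (rational_residue _).1 nrat.
have [chi' rchi'] := (rational_residue _).1 yrat.
rewrite big_ord_recr /= mulnC -iter_morE.
apply: (fiber_dim_comp (phi := mor_stalk f (iter_mor n f y)) (psi := mor_stalk (iter_mor n f) y)
  (theta := mor_stalk (iter_mor n.+1 f) y) _ rchi' rchi).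
- by [].
- exact: iter_equational.
- exact: (fiber_dim_multiplicity Xsch Xred fflat ffin fsep geta yrat).1.
- exact: IH.
Qed.

Lemma iter_multiplicity n y : rational_point (iter n f y) ->
  multiplicity (iter_mor n f) y = (\prod_(i < n) multiplicity f (iter i f y))%N.
Proof.
by rewrite -iter_morE => yrat; apply: multiplicity_eq => //; exact: iter_fiber_dim.
Qed.

End Iterates.

(** * Noetherianity *)

Definition noetherian (R : comPzRingType) : Prop :=
  forall J : nat -> set R, (forall i, ideal (J i)) -> (forall i, J i `<=` J i.+1) ->
    exists N, forall i, (N <= i)%N -> J i `<=` J N.

Lemma chain_le (T : Type) (J : nat -> set T) : (forall i, J i `<=` J i.+1) ->
  forall i j, (i <= j)%N -> J i `<=` J j.
Proof.
move=> Jinc i j /subnKC <-; elim: (j - i)%N => [|m IH]; first by rewrite addn0.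
by rewrite addnS; apply: subset_trans IH (Jinc _).
Qed.

Lemma noetherian_field (k : fieldType) : noetherian k.
Proof.
move=> J iJ Jinc; have [[N [a Ja a0]]|H] := pselect (exists N, exists2 a, J N a & a != 0).
  exists N => i _ b _; rewrite -[b]mulr1 -(mulVf a0) mulrA.
  exact: (idealM (iJ N)).
exists 0%N => i _ a Ja; have [->|a0] := eqVneq a 0; first exact: (ideal0 (iJ 0%N)).
by case: H; exists i, a.
Qed.

Lemma noetherian_surj (R S : comPzRingType) (h : {rmorphism R -> S}) :
  (forall y, exists x, h x = y) -> noetherian R -> noetherian S.
Proof.
move=> hS nR J iJ Jinc.
have [||N NP] := nR (fun i => h @^-1` J i).
- move=> i; split=> /= [|a b|a b]; rewrite ?rmorph0 ?rmorphD ?rmorphM.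
  + exact: (ideal0 (iJ i)).
  + exact: (idealD (iJ i)).
  + exact: (idealM (iJ i)).
- by move=> i x; exact: Jinc.
by exists N => i Ni y; have [x <-] := hS y; exact: (NP i Ni x).
Qed.

(* Hilbert basis: the ideals of degree-d leading coefficients of J_i increase in
   both i and d; stabilizing the diagonal and then finitely many values of d
   stabilizes them uniformly. *)
Lemma noetherian_poly (R : comNzRingType) : noetherian R -> noetherian {poly R}.
Proof.
move=> nR J iJ Jinc.
pose L i d := [set a : R | exists p, [/\ J i p, (size p <= d.+1)%N & p`_d = a]].
have iL i d : ideal (L i d).
  split=> [|a b [p [Jp sp <-]] [q [Jq sq <-]]|a b [p [Jp sp <-]]].
  - by exists 0; rewrite size_poly0 coef0; split=> //; exact: (ideal0 (iJ i)).
  - exists (p + q); rewrite coefD; split=> //; first exact: (idealD (iJ i)).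
    by rewrite (leq_trans (size_polyD _ _)) // geq_max sp.
  - exists (a%:P * p); rewrite coefCM; split=> //; first exact: (idealM (iJ i)).
    by rewrite mul_polyC (leq_trans (size_scale_leq _ _)).
have Li i j d : (i <= j)%N -> L i d `<=` L j d.
  by move=> ij a [p [Jp sp pa]]; exists p; split=> //; exact: (chain_le Jinc ij).
have Ld i d d' : (d <= d')%N -> L i d `<=` L i d'.
  move=> /subnKC <-; elim: (d' - d)%N => [|m IH]; first by rewrite addn0.
  apply: (subset_trans IH) => a [p [Jp sp pa]]; exists (p * 'X).
  rewrite addnS coefMX /=; split=> //; first by rewrite mulrC; exact: (idealM (iJ i)).
  by rewrite (leq_trans (size_mul_leq _ _)) // size_polyX addn2.
have [||N0 N0P] := nR (fun i => L i i).
- by move=> i; exact: iL.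
- by move=> i; apply: (@subset_trans _ (L i i.+1)); [exact: Ld|exact: Li].
have /choice[M MP] : forall d, exists N, forall i, (N <= i)%N -> L i d `<=` L N d.
  by move=> d; apply: (nR (fun i => L i d)) => i; [exact: iL|exact: Li].
pose N := maxn N0 (\max_(d < N0) M d).
have NP i d : (N <= i)%N -> L i d `<=` L N d.
  move=> Ni; have [dN0|N0d] := ltnP d N0.
    have Md : (M d <= N)%N.
      by rewrite leq_max; apply/orP; right; exact: (@leq_bigmax _ (fun d : 'I_N0 => M d) (Ordinal dN0)).
    by apply: (subset_trans (MP d i (leq_trans Md Ni))); exact: Li.
  apply: (@subset_trans _ (L (maxn i d) (maxn i d))).
    by apply: (@subset_trans _ (L (maxn i d) d)); [apply: Li|apply: Ld]; rewrite ?leq_maxl ?leq_maxr.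
  apply: (subset_trans (N0P _ _)); first by rewrite leq_max N0d orbT.
  by apply: (@subset_trans _ (L N N0)); [apply: Li; rewrite leq_maxl|exact: Ld].
exists N => i Ni p; move: {2}(size p) (leqnn (size p)) => d.
elim: d p => [|d IH] p.
  by rewrite leqn0 size_poly_eq0 => /eqP-> _; exact: (ideal0 (iJ N)).
move=> sp Jp; have [|q [Jq sq qp]] := NP i d Ni (p`_d); first by exists p.
rewrite -(subrK q p); apply: (idealD (iJ N)) => //; apply: IH.
  apply/leq_sizeP => j dj; rewrite coefB; move: dj; rewrite leq_eqVlt => /orP[/eqP <-|dj].
    by rewrite qp subrr.
  by rewrite !nth_default ?subrr // (leq_trans _ dj).
rewrite -mulN1r; apply: (idealD (iJ i)) => //; apply: (idealM (iJ i)).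
exact: (chain_le Jinc Ni).
Qed.

(** R is an iterated polynomial ring in one variable at a time, so the one-variable Hilbert basis
    theorem can be applied n times. *)
Lemma noetherian_generators (k : fieldType) (A : comAlgType k) n (t : 'I_n -> A) :
  exists (R : comNzRingType) (h : {rmorphism R -> A}),
    [/\ noetherian R, forall c : k, exists x, h x = c%:A & forall i, exists x, h x = t i].
Proof.
elim: n t => [|n IH] t.
  exists k, (in_alg A); split; [exact: noetherian_field| |by case].
  by move=> c; exists c.
have [R [h [nR hk ht]]] := IH (t \o lift ord_max).
have comm : commr_rmorph h (t ord_max) by move=> x; exact: mulrC.
exists {poly R}, (horner_morph comm); split; first exact: noetherian_poly.
  by move=> c; have [x hx] := hk c; exists x%:P; rewrite /= horner_morphC.
move=> i; case: (unliftP ord_max i) => [j ->|->].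
  by have [x hx] := ht j; exists x%:P; rewrite /= horner_morphC.
by exists 'X; rewrite /= horner_morphX.
Qed.

Lemma noetherian_finitely_generated (k : fieldType) (A : comAlgType k) :
  finitely_generated_algebra A -> noetherian A.
Proof.
move=> [n [t tP]]; have [R [h [nR hk ht]]] := noetherian_generators t.
apply: (noetherian_surj (h := h)) nR => y; have [P ->] := tP y.
rewrite /mpoly.mmap; apply: (big_ind (fun y => exists x, h x = y)) => [|x x' [u <-] [u' <-]|m _].
- by exists 0; rewrite rmorph0.
- by exists (u + u'); rewrite rmorphD.
have [c cE] := hk (mpoly.mcoeff m P).
suff [u uE] : exists u, h u = mpoly.mmap1 t m.
  by exists (c * u); rewrite rmorphM /= cE uE.
rewrite /mpoly.mmap1; apply: (big_ind (fun y => exists x, h x = y)) => [|x x' [u <-] [u' <-]|i _].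
- by exists 1; rewrite rmorph1.
- by exists (u * u'); rewrite rmorphM.
by have [x <-] := ht i; eexists; exact: rmorphXn.
Qed.

Section ClosedSets.
Variables (k : fieldType) (X : kspace k).
Hypothesis Xft : finite_type X.

(** On each chart the vanishing ideals of the C i increase and become stationary; they determine the
    closed sets there, and there are finitely many charts. *)
Lemma closed_chain (C : nat -> set X) : (forall i, closed (C i)) ->
  (forall i, C i.+1 `<=` C i) -> exists N, forall i, (N <= i)%N -> C N `<=` C i.
Proof.
move=> cC Cdec; have [n [U [Ucov UP]]] := Xft.
have /choice[M MP] : forall i : 'I_n, exists N, forall j, (N <= j)%N -> C N `&` U i `<=` C j.
  move=> i; have [A [pt [theta [ch _ fg]]]] := UP i.
  pose J j := [set a : A | forall x, U i x -> C j x -> pt x a].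
  have iJ j : ideal (J j).
    split=> [x Ux _|a b Ja Jb x Ux Cx|a b Jb x Ux Cx].
    - exact: prime_ideal0 (chart_prime ch Ux).
    - by apply: (prime_idealD (chart_prime ch Ux)); [exact: Ja|exact: Jb].
    - by apply: (prime_idealM (chart_prime ch Ux)); exact: Jb.
  have Jinc j : J j `<=` J j.+1 by move=> a Ja x Ux /Cdec; exact: Ja.
  have [N NP] := noetherian_finitely_generated fg iJ Jinc.
  exists N => j Nj x [Cx Ux]; apply: contrapT => nCx.
  have [a [na aC]] := chart_open_basic ch (closed_openC (cC j)) Ux nCx.
  apply: na; apply: (NP j Nj) => // y Uy Cy; apply: contrapT => ny.
  exact: aC Uy ny Cy.
have Cle i j : (i <= j)%N -> C j `<=` C i.
  move=> /subnKC <-; elim: (j - i)%N => [|m IH]; first by rewrite addn0.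
  by rewrite addnS; apply: subset_trans (Cdec _) IH.
exists (\max_i M i)%N => j Nj x Cx; have [i Ux] := Ucov x.
have Mi : (M i <= \max_i M i)%N by exact: leq_bigmax.
by apply: (MP i j (leq_trans Mi Nj)); split=> //; exact: Cle Cx.
Qed.

Lemma closed_minimal (F : set (set X)) : (forall C, F C -> closed C) -> F !=set0 ->
  exists2 C, F C & forall D, F D -> D `<=` C -> D = C.
Proof.
move=> Fcl [C0 FC0]; apply: contrapT => nmin.
have step (C : {C | F C}) : exists D : {D | F D}, sval D `<=` sval C /\ sval D <> sval C.
  apply: contrapT => nD; apply: nmin; exists (sval C); first exact: svalP C.
  move=> D FD DC; apply: contrapT => DnC; apply: nD.
  by exists (exist _ D FD).
have [g gP] := choice step.
pose c i := iter i g (exist _ C0 FC0).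
have [||N NP] := @closed_chain (fun i => sval (c i)).
- by move=> i; apply: Fcl; exact: svalP (c i).
- by move=> i; exact: (gP (c i)).1.
by apply: (gP (c N)).2; apply/seteqP; split; [exact: (gP (c N)).1|exact: (NP N.+1)].
Qed.

End ClosedSets.

(** * Charged closed sets *)

Section ChargedSets.
Variables (R : realType) (X : Type) (f : X -> X) (T : set X) (x : X).
Variables (C : set (set X)) (A : set X -> R) (e : R).
Hypothesis C_sub : forall S, C S -> S `<=` T.
Hypothesis C_setI : forall S S', C S -> C S' -> C (S `&` S').
Hypothesis C_image : forall S, C S -> C (f @` S).
Hypothesis C_preimage : forall S, C S -> C (f @^-1` S).
Hypothesis C_coimage : forall S, C S ->
  C [set z | T z /\ forall y, f y = z -> S y].
Hypothesis C_minimal : forall F : set (set X), F `<=` C -> F !=set0 ->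
  exists2 S, F S & forall S', F S' -> S' `<=` S -> S' = S.
Hypothesis orbit_cover : forall (S : nat -> set X) n, (forall i, C (S i)) ->
  (forall m y, iter m f y = x -> exists2 i, (i < n)%N & S i y) ->
  exists i, S i = T.
Hypothesis e_gt0 : 0 < e.
Hypothesis A_ge0 : forall S, 0 <= A S.
Hypothesis A_le1 : forall S, A S <= 1.
Hypothesis A_le : forall S S', S `<=` S' -> A S <= A S'.
Hypothesis A_split : forall S S', A S = A (S `&` S') + A (S `\` S').
Hypothesis A_preimage : forall S, A (f @^-1` S) = A S.
Hypothesis A_image : forall S, e * A (f @` S) <= A S.
Hypothesis A_orbit : forall S, 0 < A S -> exists n y, S y /\ iter n f y = x.

Let charged := [set S | C S /\ 0 < A S].
Let minimal Z := charged Z /\ forall S, charged S -> S `<=` Z -> S = Z.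

Let A_subpreimage Z : A Z <= A (f @` Z).
Proof. by rewrite -(A_preimage (f @` Z)); apply: A_le => y Zy; exists y. Qed.

(** A charged D inside f(Z) is the image of the part of Z over D. By [A_image] this part is charged,
    hence is all of Z. *)
Let minimal_image Z : minimal Z -> minimal (f @` Z).
Proof.
move=> [[CZ AZ] Zmin]; split; first split; first exact: C_image.
  exact: lt_le_trans AZ (A_subpreimage Z).
move=> D [CD AD] DZ.
have fE : f @` (Z `&` f @^-1` D) = D.
  apply/seteqP; split=> [_ [y [_ Dfy] <-]|z Dz] //.
  by have [y Zy fy] := DZ z Dz; exists y => //; split=> //=; rewrite fy.
have ZD : Z `&` f @^-1` D = Z.
  apply: Zmin; last by move=> y [].
  split; first by apply: C_setI => //; exact: C_preimage.
  by apply: lt_le_trans (A_image _); rewrite fE mulr_gt0.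
by rewrite -ZD fE.
Qed.

Let minimal_disjoint Z W : minimal Z -> minimal W -> Z <> W -> A (Z `&` W) = 0.
Proof.
move=> [[CZ AZ] Zmin] [[CW AW] Wmin] ZW; apply/eqP; rewrite eq_le A_ge0 andbT leNgt.
apply/negP => AZW; apply: ZW.
have ZW : charged (Z `&` W) by split=> //; exact: C_setI.
have ZE : Z `&` W = Z by apply: Zmin => // y [].
by rewrite -ZE; apply: Wmin => // y [].
Qed.

Let A_disjoint_sum (Z : nat -> set X) a : (forall i, a <= A (Z i)) ->
  (forall i j, (i < j)%N -> A (Z i `&` Z j) = 0) ->
  forall n, n%:R * a <= A [set y | exists2 i, (i < n)%N & Z i y].
Proof.
move=> Za Zd n.
have Ad m W : (forall i, (i < m)%N -> A (Z i `&` W) = 0) ->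
    A ([set y | exists2 i, (i < m)%N & Z i y] `&` W) = 0.
  elim: m => [|m IH] Wd.
    (* That the empty set has charge 0 is drawn from [A_orbit]: a charged set has a point. *)
    apply/eqP; rewrite eq_le A_ge0 andbT leNgt; apply/negP => /A_orbit[k [y [[[i i0 _] _] _]]].
    by rewrite ltn0 in i0.
  rewrite (A_split _ (Z m)); apply/eqP; rewrite eq_le addr_ge0 // andbT.
  rewrite -[leRHS]addr0; apply: lerD.
    by rewrite -(Wd m) //; apply: A_le => y [[_ Wy] Zy].
  rewrite -IH; last by move=> i im; apply: Wd; exact: ltnW.
  apply: A_le => y [[[i im Zi] Wy] nZ]; split=> //; exists i => //.
  by move: im; rewrite ltnS leq_eqVlt => /orP[/eqP im|//]; rewrite im in Zi.
elim: n => [|n IH]; first by rewrite mul0r.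
rewrite -addn1 natrD mulrDl mul1r (A_split _ (Z n)) addrC; apply: lerD.
  apply: (le_trans (Za n)); apply: A_le => y Zy; split=> //.
  by exists n => //; rewrite addn1.
apply: (le_trans IH); rewrite (A_split _ (Z n)) Ad ?add0r; last by move=> i; exact: Zd.
by apply: A_le => y [[i im Zi] nZ]; split=> //; exists i => //; rewrite addn1 ltnS ltnW.
Qed.

Let orbit Z i := iter i (fun S => f @` S) Z.

Let minimal_orbit Z i : minimal Z -> minimal (orbit Z i).
Proof. by move=> Zmin; elim: i => [//|i IH]; exact: minimal_image. Qed.

Let A_orbit_le Z i j : (i <= j)%N -> A (orbit Z i) <= A (orbit Z j).
Proof.
move=> /subnKC <-; elim: (j - i)%N => [|n IH]; first by rewrite addn0.
by rewrite addnS; apply: (le_trans IH); exact: A_subpreimage.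
Qed.

(** Distinct members of the forward orbit of Z0 meet in charge 0, and each has charge at least
    A(Z0). If all were distinct, more than 1 / A(Z0) of them would exceed total charge 1. *)
Let minimal_periodic Z0 : minimal Z0 -> exists Z p,
  [/\ minimal Z, (0 < p)%N & orbit Z p = Z].
Proof.
move=> Zmin; apply: contrapT => nper.
have Zneq i j : (i < j)%N -> orbit Z0 i <> orbit Z0 j.
  move=> ij Zij; apply: nper; exists (orbit Z0 i), (j - i)%N; split.
  - exact: minimal_orbit.
  - by rewrite subn_gt0.
  - by rewrite /orbit -iterD subnK ?(ltnW ij).
have Zd i j : (i < j)%N -> A (orbit Z0 i `&` orbit Z0 j) = 0.
  by move=> ij; apply: minimal_disjoint (Zneq i j ij); exact: minimal_orbit.
have Zb n := A_disjoint_sum (fun i => A_orbit_le Z0 (leq0n i)) Zd n.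
have AZ : 0 < A Z0 by case: Zmin => -[].
have := le_trans (Zb (Num.truncn (A Z0)^-1).+1) (A_le1 _).
rewrite leNgt => /negP; apply; rewrite -ltr_pdivrMr // div1r.
exact: truncnS_gt.
Qed.

Lemma charged_closed S : C S -> 0 < A S -> C T -> S = T.
Proof.
move=> CS AS CT.
have [||Z0 FZ0 Z0min] := @C_minimal charged.
- by move=> ? [].
- by exists S.
have [Z [p [Zmin p0 Zp]]] := minimal_periodic (conj FZ0 Z0min).
have Zper l : orbit Z (l + p) = orbit Z l by rewrite /orbit iterD -/(orbit Z p) Zp.
(* Charges do not decrease along the orbit, and the orbit is periodic. *)
have Acst l : A (orbit Z l.+1) = A (orbit Z l).
  apply/eqP; rewrite eq_le [X in _ && X]A_orbit_le // andbT -(Zper l).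
  by apply: A_orbit_le; rewrite -addn1 leq_add2l.
(* With W = f(V), let G be the set of points whose whole fibre lies in V. If W meets G in positive
   charge, minimality gives W inside G. Otherwise W minus G is charged and each of its points has a
   preimage outside V, so f^-1(W) minus V is charged; but V lies in f^-1(W) and both have charge
   A(W). *)
have pre l y : orbit Z l.+1 (f y) -> orbit Z l y.
  have [[CW AW] Wmin] := minimal_orbit l.+1 Zmin.
  have [[CV _] _] := minimal_orbit l Zmin.
  set W := orbit Z l.+1 in CW AW Wmin *; set V := orbit Z l in CV *.
  set G := [set z | T z /\ forall y, f y = z -> V y].
  have CG : C G by exact: C_coimage.
  have [AWG|AWG] := ltP 0 (A (W `&` G)).
    have WG : W `&` G = W by apply: Wmin; [split=> //; exact: C_setI|move=> ? []].
    by rewrite -WG => -[_ [_]]; exact.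
  have AWnG : 0 < A (W `\` G).
    by move: AW; rewrite (A_split _ G) => /lt_le_trans; apply; rewrite -[leRHS]add0r lerD2r.
  suff : 0 < A (f @^-1` W `\` V).
    move=> AD; have := A_split (f @^-1` W) V.
    have VE : f @^-1` W `&` V = V.
      by apply/seteqP; split=> [z []|z Vz] //; split=> //; exists z.
    have AWV : A W = A V := Acst l.
    rewrite VE A_preimage AWV => AE.
    by move: AD; rewrite -(ltrDl (A V)) -AE ltxx.
  apply: lt_le_trans (A_image _); rewrite mulr_gt0 //; apply: (lt_le_trans AWnG).
  apply: A_le => z [Wz nGz].
  have [y' [fy' nVy']] : exists y', f y' = z /\ ~ V y'.
    apply: contrapT => nex; apply: nGz; split; first exact: C_sub CW _ Wz.
    by move=> y' fy'; apply: contrapT => nV; apply: nex; exists y'.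
  by exists y' => //; split=> //=; rewrite fy'.
(* E is stable under f and f^-1. It contains x because a charged set meets the backward orbit of x,
   and then it contains this whole orbit. *)
pose E := [set y | exists l, orbit Z l y].
have fE n y : E y -> E (iter n f y).
  elim: n => [//|n IH] /IH[l El] /=; exists l.+1; by exists (iter n f y).
have preE n y : E (iter n f y) -> E y.
  elim: n => [//|n IH] /= [l El]; apply: IH; exists (l + p.-1)%N; apply: pre.
  by rewrite -addnS prednK // Zper.
have Ex : E x.
  have [n [y [Zy <-]]] : exists n y, Z y /\ iter n f y = x.
    by apply: A_orbit; case: Zmin => -[].
  by apply: fE; exists 0%N.
(* Periodicity leaves only p closed sets, as the finite cover in [orbit_cover] demands. *)
have redp l y : orbit Z l y -> exists2 i, (i < p)%N & orbit Z i y.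
  move=> Zy; exists (l %% p)%N; first by rewrite ltn_mod.
  move: Zy; rewrite {1}(divn_eq l p); elim: (l %/ p)%N => [//|q IH].
  by rewrite mulSn addnC addnCA addnC Zper addnC.
have [i|m y my|i ZT] := @orbit_cover (orbit Z) p.
- by have [[]] := minimal_orbit i Zmin.
- have [|l] := preE m y; first by rewrite my.
  exact: redp.
have [_ Tmin] := minimal_orbit i Zmin; rewrite ZT in Tmin.
by apply: Tmin; [|exact: C_sub].
Qed.

End ChargedSets.

(** * The backward random walk *)

Lemma indic_ge0 (R : realType) (X : Type) (S : set X) y : 0 <= \1_S y :> R.
Proof. by rewrite indicE ler0n. Qed.

Lemma indic_le (R : realType) (X : Type) (S S' : set X) y : (S y -> S' y) -> \1_S y <= \1_S' y :> R.
Proof.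
rewrite !indicE => SS'; have [Sy|_] := boolP (y \in S); last by rewrite ler0n.
by rewrite mem_set //; apply: SS'; exact: set_mem.
Qed.

Lemma indic_le1 (R : realType) (X : Type) (S : set X) y : \1_S y <= 1 :> R.
Proof. by rewrite indicE lern1 leq_b1. Qed.

Lemma ultra_bounded_cvg (R : realType) (I : Type) (U : set_system I)
    (g : I -> R) a b :
  UltraFilter U -> (forall i, a <= g i <= b) -> cvg (g i @[i --> U]).
Proof.
move=> UU gab.
have [|p [_ clp]] := @segment_compact R a b (g i @[i --> U]) _.
  suff : U (g @^-1` `[a, b]%classic) by [].
  by apply: filterE => i; rewrite /= in_itv /= gab.
apply/cvg_ex; exists p => B nB.
have [//|nB'] := in_ultra_setVsetC (g @^-1` B) UU.
by have [y [nBy By]] := clp (~` B) B nB' nB.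
Qed.

Section Walk.
Variables (R : realType) (X : eqType) (f : X -> X) (T : set X) (x : X).
Variables (fib : X -> seq X) (w : X -> R) (e : R).
Hypothesis T_image : forall y, T y -> T (f y).
Hypothesis T_preimage : forall y, T (f y) -> T y.
Hypothesis Tx : T x.
Hypothesis fibP : forall z, T z -> forall y, y \in fib z <-> f y = z.
Hypothesis e_gt0 : 0 < e.
Hypothesis w_ge : forall y, T y -> e <= w y.
Hypothesis w_sum : forall z, T z -> \sum_(y <- fib z) w y = 1.

Definition back (phi : X -> R) (z : X) : R := \sum_(y <- fib z) w y * phi y.
Definition law n (phi : X -> R) : R := iter n back phi x.
Definition avg (S : set X) N : R := harmonic N * \sum_(n < N.+1) law n \1_S.

Let fibT z y : T z -> y \in fib z -> T y.
Proof. by move=> Tz /(fibP Tz) fy; apply: T_preimage; rewrite fy. Qed.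

Let w_ge0 y : T y -> 0 <= w y.
Proof. by move=> /w_ge; apply: le_trans; exact: ltW. Qed.

Lemma iter_back_le n phi psi : (forall y, T y -> phi y <= psi y) ->
  forall z, T z -> iter n back phi z <= iter n back psi z.
Proof.
move=> le_phi; elim: n => [//|n IH] z Tz /=; rewrite /back big_seq [leRHS]big_seq.
apply: ler_sum => y /(fibT Tz) Ty; apply: ler_wpM2l; [exact: w_ge0|exact: IH].
Qed.

Lemma law_le n phi psi : (forall y, T y -> phi y <= psi y) -> law n phi <= law n psi.
Proof. by move=> /iter_back_le; exact. Qed.

Lemma law_eq n phi psi : (forall y, T y -> phi y = psi y) -> law n phi = law n psi.
Proof. by move=> E; apply/eqP; rewrite eq_le !law_le // => y Ty; rewrite E. Qed.

Lemma lawD n phi psi : law n (fun y => phi y + psi y) = law n phi + law n psi.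
Proof.
rewrite /law; elim: n x => [//|n IH] z /=; rewrite /back -big_split /=.
by apply: eq_bigr => y _; rewrite IH mulrDr.
Qed.

Lemma lawZ n a phi : law n (fun y => a * phi y) = a * law n phi.
Proof.
rewrite /law; elim: n x => [//|n IH] z /=; rewrite /back mulr_sumr.
by apply: eq_bigr => y _; rewrite IH mulrCA.
Qed.

Lemma law_cst n a : law n (fun=> a) = a.
Proof.
rewrite /law; elim: n x Tx => [//|n IH] z Tz /=.
rewrite -[RHS]mul1r -(w_sum Tz) mulr_suml /back !big_seq; apply: eq_bigr => y /(fibT Tz) Ty.
by rewrite IH.
Qed.

Lemma law_sum n m (phi : nat -> X -> R) :
  law n (fun y => \sum_(i < m) phi i y) = \sum_(i < m) law n (phi i).
Proof.
elim: m => [|m IH].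
  by rewrite big_ord0 -[RHS](law_cst n 0); apply: law_eq => y _; rewrite big_ord0.
rewrite big_ord_recr /= -IH -lawD; apply: law_eq => y _.
by rewrite big_ord_recr.
Qed.

Lemma law_comp n phi : law n.+1 (phi \o f) = law n phi.
Proof.
rewrite /law iterSr; apply: law_eq => z Tz; rewrite /back.
rewrite -[RHS]mul1r -(w_sum Tz) mulr_suml big_seq [RHS]big_seq.
by apply: eq_bigr => y /(fibP Tz) <-.
Qed.

Lemma law_comp_iter n i phi : law (i + n) (phi \o iter i f) = law n phi.
Proof.
elim: i n => [//|i IH] n; rewrite -(IH n) addSn -[RHS]law_comp.
by apply: law_eq => y _ /=; rewrite -iterSr.
Qed.

Lemma law_support n phi : (forall y, iter n f y = x -> phi y = 0) -> law n phi = 0.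
Proof.
rewrite /law; elim: n x Tx => [|n IH] z Tz phi0 /=; first exact: phi0.
rewrite /back big_seq big1 // => y yz; rewrite IH ?mulr0 //; first exact: fibT yz.
by move=> u uy; apply: phi0; rewrite /= uy; exact/fibP.
Qed.

Lemma law_indic_ge0 n (S : set X) : 0 <= law n \1_S.
Proof. by rewrite -(law_cst n 0); apply: law_le => y _; exact: indic_ge0. Qed.

Lemma law_indic_le1 n (S : set X) : law n \1_S <= 1.
Proof. by rewrite -(law_cst n 1); apply: law_le => y _; exact: indic_le1. Qed.

(** A point of f(S) has a preimage in S, to which the walk moves with probability at least e. *)
Lemma law_image n (S : set X) : e * law n \1_(f @` S) <= law n.+1 \1_S.
Proof.
rewrite -lawZ /law iterSr; apply: iter_back_le => // z Tz.
have back_ge0 : 0 <= back \1_S z.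
  rewrite /back big_seq; apply: sumr_ge0 => y /(fibT Tz) Ty.
  by rewrite mulr_ge0 ?indic_ge0 // w_ge0.
rewrite indicE; have [/set_mem[y Sy fy]|_] := boolP (z \in _); last by rewrite mulr0.
have yz : y \in fib z by exact/fibP.
rewrite mulr1 /back (big_rem y) //= indicE mem_set // mulr1.
rewrite -[leLHS]addr0; apply: lerD; first by apply: w_ge; exact: fibT yz.
rewrite big_seq; apply: sumr_ge0 => u /mem_rem/(fibT Tz) Tu.
by rewrite mulr_ge0 ?indic_ge0 // w_ge0.
Qed.

Lemma avg_ge0 (S : set X) N : 0 <= avg S N.
Proof.
by rewrite mulr_ge0 ?invr_ge0 //; apply: sumr_ge0 => n _; exact: law_indic_ge0.
Qed.

Lemma avg_le1 (S : set X) N : avg S N <= 1.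
Proof.
rewrite /avg /harmonic ler_pdivrMl ?ltr0n // mulr1.
apply: (@le_trans _ _ (\sum_(n < N.+1) 1)); last by rewrite sumr_const card_ord.
by apply: ler_sum => n _; exact: law_indic_le1.
Qed.

Lemma avg_le (S S' : set X) N : S `<=` S' -> avg S N <= avg S' N.
Proof.
move=> SS'; rewrite ler_wpM2l ?invr_ge0 //; apply: ler_sum => n _.
by apply: law_le => y _; apply: indic_le; exact: SS'.
Qed.

Lemma avg_split (S S' : set X) N : avg S N = avg (S `&` S') N + avg (S `\` S') N.
Proof.
rewrite /avg -mulrDr -big_split /=; congr (_ * _); apply: eq_bigr => n _.
rewrite -lawD; apply: law_eq => y _; rewrite !indicE in_setI in_setD.
by case: (y \in S); case: (y \in S'); rewrite ?addr0 ?add0r.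
Qed.

(** Shifting the times by one leaves a single boundary term, of order [harmonic N]; it disappears in
    the limit. *)
Lemma avg_image (S : set X) N : e * avg (f @` S) N <= avg S N + e * harmonic N.
Proof.
rewrite /avg mulrCA [e * harmonic N]mulrC -mulrDr ler_wpM2l ?invr_ge0 //.
rewrite big_ord_recr mulrDr /=; apply: lerD; last first.
  by rewrite -[leRHS]mulr1 ler_wpM2l ?law_indic_le1 // ltW.
rewrite big_ord_recl mulr_sumr -[leLHS]add0r; apply: lerD; first exact: law_indic_ge0.
by apply: ler_sum => n _; exact: law_image.
Qed.

Lemma avg_preimage (S : set X) N :
  avg (f @^-1` S) N <= avg S N + harmonic N /\ avg S N <= avg (f @^-1` S) N + harmonic N.
Proof.
have compE n : law n.+1 \1_(f @^-1` S) = law n \1_S.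
  rewrite -[RHS]law_comp; apply: law_eq => y _; rewrite /= !indicE.
  suff -> : (y \in f @^-1` S) = (f y \in S) by [].
  by apply/idP/idP => /set_mem ?; exact/mem_set.
have sumE : \sum_(n < N.+1) law n \1_(f @^-1` S) =
    law 0 \1_(f @^-1` S) + \sum_(n < N) law n \1_S.
  by rewrite big_ord_recl; congr (_ + _); apply: eq_bigr => n _; rewrite -compE.
rewrite /avg sumE big_ord_recr /=; set u := \sum_(n < N) _.
have h_le a b : a <= b + 1 -> N.+1%:R^-1 * a <= N.+1%:R^-1 * b + N.+1%:R^-1.
  by move=> ab; rewrite -[X in _ + X]mulr1 -mulrDr ler_wpM2l ?invr_ge0.
split; apply: h_le.
  by rewrite [leLHS]addrC -[leRHS]addrA lerD2l -[leLHS]add0r lerD ?law_indic_ge0 ?law_indic_le1.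
by rewrite [law 0 _ + u]addrC -[leRHS]addrA lerD2l -[leLHS]add0r lerD ?law_indic_ge0 ?law_indic_le1.
Qed.

Section Limit.
Variable U : set_system nat.
Hypotheses (UU : UltraFilter U) (U_oo : \oo `<=` U).

Let mean (S : set X) : R := lim (avg S N @[N --> U]).

Let avg_cvg S : cvg (avg S N @[N --> U]).
Proof. by apply: (@ultra_bounded_cvg _ _ _ _ 0 1) => N; rewrite avg_ge0 avg_le1. Qed.

Let lim_harmonic_le (u v : nat -> R) a : cvg (u @ U) -> cvg (v @ U) ->
  (forall N, u N <= v N + a * harmonic N) -> lim (u @ U) <= lim (v @ U).
Proof.
move=> cu cv uv; have ch : a * harmonic N @[N --> U] --> 0.
  rewrite -(mulr0 a); apply: cvgM; first exact: cvg_cst.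
  by move=> B /cvg_harmonic; exact: U_oo.
rewrite -[leRHS]addr0 -(cvg_lim _ ch) // -limD //; last by apply/cvg_ex; exists 0.
apply: ler_lim => //; last by apply: filterE.
by apply: is_cvgD => //; apply/cvg_ex; exists 0.
Qed.

Lemma mean_closed (C : set (set X)) :
  (forall S, C S -> S `<=` T) ->
  (forall S S', C S -> C S' -> C (S `&` S')) ->
  (forall S, C S -> C (f @` S)) ->
  (forall S, C S -> C (f @^-1` S)) ->
  (forall S, C S -> C [set z | T z /\ forall y, f y = z -> S y]) ->
  (forall F : set (set X), F `<=` C -> F !=set0 ->
    exists2 S, F S & forall S', F S' -> S' `<=` S -> S' = S) ->
  (forall (S : nat -> set X) n, (forall i, C (S i)) ->
    (forall m y, iter m f y = x -> exists2 i, (i < n)%N & S i y) ->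
    exists i, S i = T) ->
  C T -> forall S, C S -> S <> T -> lim (avg S N @[N --> U]) = 0.
Proof.
move=> C1 C2 C3 C4 C5 C6 C7 CT S CS ST; apply/eqP; rewrite eq_le andbC.
have mean_ge0 W : 0 <= mean W.
  by apply: limr_ge; [exact: avg_cvg|apply: filterE => N; exact: avg_ge0].
rewrite -/(mean S) mean_ge0 leNgt; apply/negP => AS; apply: ST.
apply: (@charged_closed R X f T x C mean e) => //.
- by move=> W; apply: limr_le; [exact: avg_cvg|apply: filterE => N; exact: avg_le1].
- move=> W W' WW'; apply: ler_lim; [exact: avg_cvg|exact: avg_cvg|].
  by apply: filterE => N; exact: avg_le.
- move=> W W'; rewrite /mean -limD; [|exact: avg_cvg|exact: avg_cvg].
  by congr (lim (_ @ U)); apply/funext => N; exact: avg_split.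
- move=> W; apply/eqP; rewrite eq_le; apply/andP.
  by split; apply: (@lim_harmonic_le _ _ 1); try exact: avg_cvg;
    move=> N; rewrite mul1r; have [] := avg_preimage W N.
- move=> W; have cW : e * avg (f @` W) N @[N --> U] --> e * mean (f @` W).
    by apply: cvgM; [exact: cvg_cst|exact: avg_cvg].
  rewrite -(cvg_lim _ cW) //; apply: (@lim_harmonic_le _ _ e); last first.
  - by move=> N; exact: avg_image.
  - exact: avg_cvg.
  - by apply/cvg_ex; eexists; exact: cW.
- move=> W AW; apply: contrapT => nW.
  suff W0 : avg W = fun=> 0 by move: AW; rewrite /mean W0 lim_cst ?ltxx.
  apply/funext => N; rewrite /avg big1 ?mulr0 // => n _.
  apply: law_support => y yx; rewrite indicE memNset // => Wy.
  by apply: nW; exists n, y.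
Qed.

End Limit.

(** If the means did not tend to 0, they would be at least some a > 0 for infinitely many N; an
    ultrafilter containing these N would have a limit at least a. *)
Lemma avg_closed_cvg0 (C : set (set X)) :
  (forall S, C S -> S `<=` T) ->
  (forall S S', C S -> C S' -> C (S `&` S')) ->
  (forall S, C S -> C (f @` S)) ->
  (forall S, C S -> C (f @^-1` S)) ->
  (forall S, C S -> C [set z | T z /\ forall y, f y = z -> S y]) ->
  (forall F : set (set X), F `<=` C -> F !=set0 ->
    exists2 S, F S & forall S', F S' -> S' `<=` S -> S' = S) ->
  (forall (S : nat -> set X) n, (forall i, C (S i)) ->
    (forall m y, iter m f y = x -> exists2 i, (i < n)%N & S i y) ->
    exists i, S i = T) ->
  C T -> forall S, C S -> S <> T -> avg S N @[N --> \oo] --> 0.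
Proof.
move=> C1 C2 C3 C4 C5 C6 C7 CT S CS ST; apply/cvgrPdist_lt => a a0.
apply: contrapT => nlt.
pose D := [set N | a <= avg S N].
have DF : ProperFilter (within D \oo).
  apply: Build_ProperFilter => D0; apply: nlt.
  have {}D0 : \forall N \near \oo, D N -> set0 N := D0.
  apply: filterS D0 => N DN.
  rewrite sub0r normrN ger0_norm ?avg_ge0 // ltNge; apply/negP; exact: DN.
have [U [UU DU]] := ultraFilterLemma DF.
have U_oo : \oo `<=` U by move=> B oB; apply: DU; apply: filterS oB.
have := mean_closed UU U_oo C1 C2 C3 C4 C5 C6 C7 CT CS ST.
have : a <= lim (avg S N @[N --> U]).
  apply: limr_ge; first by apply: (@ultra_bounded_cvg _ _ _ _ 0 1) => N; rewrite avg_ge0 avg_le1.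
  suff : \forall N \near \oo, D N -> D N by exact: DU.
  exact: filterE.
by move=> + E; rewrite E leNgt a0.
Qed.

Hypothesis fib_uniq : forall z, T z -> uniq (fib z).

(** The mass of y after n steps: the path from x to y is forced, its points being the iterates of
    y. *)
Definition weight n y : R := \prod_(i < n) w (iter i f y).

Let weightS n y : weight n.+1 y = w y * weight n (f y).
Proof. by rewrite /weight big_ord_recl; congr (_ * _); apply: eq_bigr => i _; rewrite -iterSr. Qed.

Let T_iter n y : T (iter n f y) -> T y.
Proof. by elim: n => [//|n IH] /= /T_preimage. Qed.

Let T_orbit n y i : iter n f y = x -> (i <= n)%N -> T (iter i f y).
Proof. by move=> yx i_n; apply: (@T_iter (n - i)); rewrite -iterD subnK // yx. Qed.

Lemma flatten_fib_uniq (s : seq X) : uniq s -> (forall z, z \in s -> T z) ->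
  uniq (flatten [seq fib z | z <- s]).
Proof.
elim: s => [//|z s IH] /= /andP[zs us] Ts.
have Tz : T z by apply: Ts; rewrite mem_head.
have Ts' z' : z' \in s -> T z' by move=> z's; apply: Ts; rewrite in_cons z's orbT.
rewrite cat_uniq fib_uniq //= IH // andbT.
apply/hasPn => y /flattenP[_ /mapP[z' z's ->] /(fibP (Ts' _ z's)) fy].
by apply/negP => /(fibP Tz) fy'; rewrite -fy' fy z's in zs.
Qed.

Lemma law_fiber n : exists s, [/\ uniq s, forall y, y \in s <-> iter n f y = x &
  forall phi, law n phi = \sum_(y <- s) weight n y * phi y].
Proof.
elim: n => [|n [s [us sP sE]]].
  exists [:: x]; split=> // [y|phi]; first by rewrite mem_seq1; split=> [/eqP|/= ->].
  by rewrite big_seq1 /weight big_ord0 mul1r.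
have sT z : z \in s -> T z by move=> /sP zx; exact: (T_orbit zx (leq0n n)).
exists (flatten [seq fib z | z <- s]); split.
- exact: flatten_fib_uniq.
- move=> y; rewrite iterSr; split.
    by move=> /flattenP[_ /mapP[z zs ->] /(fibP (sT _ zs)) ->]; exact/sP.
  move=> /sP fys; apply/flattenP; exists (fib (f y)); first exact: map_f.
  by apply/fibP => //; exact: sT.
- move=> phi; rewrite big_flatten big_map /law iterSr -/(law n _) sE [LHS]big_seq [RHS]big_seq.
  apply: eq_bigr => z zs; rewrite /back mulr_sumr [LHS]big_seq [RHS]big_seq.
  by apply: eq_bigr => y /(fibP (sT _ zs)) fy; rewrite weightS fy mulrCA mulrA.
Qed.

Lemma law_occupation n (r : set X) :
  law n (fun y => \sum_(i < n) \1_r (iter i f y)) <= n.+1%:R * avg r n.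
Proof.
rewrite (law_sum n n (fun i => \1_r \o iter i f)) /avg mulrA divff ?pnatr_eq0 // mul1r.
(* The i-th iterate of the position at time n is the position at time n - i. The times met are 1 to
   n, so the term of time 0 in the mean is only bounded below by 0. *)
rewrite big_ord_recl (reindex_inj rev_ord_inj) /= -[leLHS]add0r.
apply: lerD; first exact: law_indic_ge0.
apply: ler_sum => i _; rewrite /bump /= add1n.
have -> : law n (\1_r \o iter (n - i.+1) f) = law ((n - i.+1) + i.+1) (\1_r \o iter (n - i.+1) f).
  by rewrite subnK.
by rewrite law_comp_iter.
Qed.

Let w_le1 y : T y -> w y <= 1.
Proof.
move=> Ty; have yf : y \in fib (f y) by apply/fibP => //; exact: T_image.
rewrite -(w_sum (T_image Ty)) (big_rem y) //= -[leLHS]addr0 lerD2l big_seq.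
by apply: sumr_ge0 => u /mem_rem/(fibT (T_image Ty))/w_ge0.
Qed.

Let e_le1 : e <= 1. Proof. exact: le_trans (w_ge Tx) (w_le1 Tx). Qed.

Let weight_ge n y : iter n f y = x -> e ^+ n <= weight n y.
Proof.
move=> yx; rewrite -[n in e ^+ n]card_ord -prodr_const; apply: ler_prod => i _.
by rewrite ltW //= w_ge //; apply: (T_orbit yx); exact: ltnW.
Qed.

(** The masses of the points of the fibre add up to 1, and each is at least e^n. *)
Lemma fiber_size n (s : seq X) : uniq s -> (forall y, y \in s <-> iter n f y = x) ->
  (size s)%:R <= e^-1 ^+ n.
Proof.
move=> us sP; have [s' [us' s'P s'E]] := law_fiber n.
have ss' : perm_eq s s'.
  by apply: uniq_perm => // y; apply/idP/idP => [/sP/s'P|/s'P/sP].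
have -> : (size s)%:R = \sum_(y <- s') 1 :> R.
  by rewrite (perm_size ss') big_const_seq count_predT iter_addr_0.
rewrite exprVn -[leRHS]mul1r ler_pdivlMr ?exprn_gt0 // -[leRHS](law_cst n 1) s'E.
rewrite mulr_suml big_seq [leRHS]big_seq.
by apply: ler_sum => y /s'P yx; rewrite mul1r mulr1; exact: weight_ge.
Qed.

Section Heavy.
Variable r : set X.
Hypothesis w_off : forall y, T y -> ~ r y -> w y = e.

Lemma weight_le n y : iter n f y = x ->
  weight n y <= e^-1 ^+ (\sum_(i < n) (iter i f y \in r)) / e^-1 ^+ n.
Proof.
move=> yx; have -> : (e^-1 ^+ n)^-1 = \prod_(i < n) e by rewrite prodr_const card_ord exprVn invrK.
rewrite -prodrXr -big_split /=; apply: ler_prod => i _.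
have Ti : T (iter i f y) by apply: (T_orbit yx); exact: ltnW.
rewrite w_ge0 //=; have [_|/negP ri] := boolP (_ \in r).
  by rewrite expr1 mulVf ?gt_eqF // w_le1.
by rewrite expr0 mul1r w_off // => ry; apply: ri; exact: mem_set.
Qed.

(* A point of the fibre of the n-th iterate has at least t of its first n
   iterates in r, which Markov's inequality makes rare, or weight at most
   e^(n-t). *)
Lemma heavy_size n t c (s : seq X) : uniq s -> (forall y, y \in s -> iter n f y = x) ->
  0 < t -> c <= \sum_(y <- s) weight n y ->
  c <= n.+1%:R * avg r n / t + (size s)%:R * e^-1 `^ t / e^-1 ^+ n.
Proof.
move=> us sx t0; move/le_trans; apply.
pose tau y := \sum_(i < n) \1_r (iter i f y) : R.
have tau_ge0 y : 0 <= tau y by apply: sumr_ge0 => i _; exact: indic_ge0.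
have wt_ge0 y : iter n f y = x -> 0 <= weight n y.
  by move=> /weight_ge; apply: le_trans; rewrite exprn_ge0 // ltW.
have step y : y \in s -> weight n y <= weight n y * tau y / t + e^-1 `^ t / e^-1 ^+ n.
  move=> /sx yx; have [t_le|t_gt] := leP t (tau y).
    rewrite -[leLHS]addr0; apply: lerD; last by rewrite divr_ge0 ?powR_ge0 // exprn_ge0 // invr_ge0 ltW.
    by rewrite -mulrA ler_peMr ?wt_ge0 // ler_pdivlMr // mul1r.
  rewrite -[leLHS]add0r; apply: lerD; first by rewrite divr_ge0 ?(ltW t0) // mulr_ge0 ?wt_ge0.
  apply: (le_trans (weight_le yx)); rewrite ler_wpM2r ?invr_ge0 ?exprn_ge0 ?invr_ge0 ?(ltW e_gt0) //.
  rewrite -powR_mulrn ?invr_ge0 ?(ltW e_gt0) // ler_powR ?invf_ge1 ?e_le1 // natr_sum.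
  exact: (ltW t_gt).
rewrite big_seq; apply: (le_trans (ler_sum _ step)); rewrite -big_seq big_split /=.
apply: lerD; last first.
  by rewrite big_const_seq count_predT iter_addr_0 -[leLHS]mulr_natl mulrA.
rewrite -mulr_suml ler_wpM2r ?invr_ge0 ?(ltW t0) //.
apply: le_trans (law_occupation n r); have [s' [us' s'P ->]] := law_fiber n.
have ss' : {subset s <= s'} by move=> y /sx/s'P.
rewrite [leRHS](bigID (mem s)) /= -[leLHS]addr0; apply: lerD; last first.
  rewrite big_seq_cond; apply: sumr_ge0 => y /andP[/s'P yx _].
  by rewrite mulr_ge0 ?wt_ge0 // tau_ge0.
have pe : perm_eq s [seq y <- s' | y \in s].
  apply: uniq_perm => // [|y]; first exact: filter_uniq.
  by rewrite mem_filter; case ys: (y \in s); rewrite //= ?ss'.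
by rewrite (perm_big _ pe) big_filter.
Qed.

End Heavy.

End Walk.

(** With t = delta n the first term is eventually at most c / 2, which leaves M n >= (c / 2) D^(n -
    delta n). On the logarithmic scale this differs from the upper bound D^n by delta ln D plus a
    vanishing term. *)
Lemma growth_rate (R : realType) (M : nat -> nat) (D c : R) (a : nat -> R) :
  1 <= D -> 0 < c -> a n @[n --> \oo] --> 0 -> (forall n, (M n)%:R <= D ^+ n) ->
  (forall n t, 0 < t -> c <= n.+1%:R * a n / t + (M n)%:R * D `^ t / D ^+ n) ->
  (M n)%:R `^ (n%:R^-1) @[n --> \oo] --> D.
Proof.
move=> D1 c0 a0 Mle Mge; have D0 : 0 < D by exact: lt_le_trans D1.
have lnD0 : 0 <= ln D by rewrite ln_ge0.
have M0 n : 0 < (M n)%:R :> R.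
  rewrite ltr0n lt0n; apply/eqP => Mn0.
  (* If M n were 0, this t would make the remaining term smaller than c. Positivity is needed to
     take logarithms, also at small n. *)
  pose t := (n.+1%:R * `|a n| + 1) / c.
  have na0 : 0 <= n.+1%:R * `|a n| by rewrite mulr_ge0.
  have t0 : 0 < t by rewrite divr_gt0 // ltr_wpDl.
  have := Mge n t t0; rewrite Mn0 mul0r mul0r addr0 ler_pdivlMr // /t mulrCA divff ?gt_eqF // mulr1.
  apply/negP; rewrite -ltNge; apply: (@le_lt_trans _ _ (n.+1%:R * `|a n|)).
    by rewrite ler_wpM2l // ler_norm.
  by rewrite ltrDl.
have -> : (fun n => (M n)%:R `^ (n%:R^-1)) = expR \o (fun n => n%:R^-1 * ln ((M n)%:R : R)).
  by apply/funext => n /=; rewrite /powR gt_eqF.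
rewrite -[X in _ --> X](lnK (x := D)) ?posrE //.
apply: continuous_cvg; first exact: continuous_expR.
have inv0 : n%:R^-1 @[n --> \oo] --> (0 : R).
  by rewrite -(cvg_shiftS (fun n => n%:R^-1 : R)); exact: cvg_harmonic.
apply/cvgrPdist_le => eps eps0.
(* Then delta ln D <= eps / 2; the summand 1 covers the case D = 1. *)
pose delta := eps / (2 * (ln D + 1)).
have L0 : 0 < ln D + 1 by rewrite ltr_wpDl.
have delta0 : 0 < delta by rewrite divr_gt0 // mulr_gt0.
have deltaD : delta * ln D <= eps / 2.
  rewrite /delta invfM mulrA -mulrA ler_piMr ?divr_ge0 ?ltW // mulrC.
  by rewrite ltr_pdivrMr // mul1r ltrDl.
(* With n + 1 <= 2 n, the constant 4 bounds (n + 1) a n / (delta n) by c / 2. *)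
have a_small : \forall n \near \oo, `|0 - a n| < c * delta / 4.
  by move/cvgrPdist_lt: a0; apply; rewrite divr_gt0 // mulr_gt0.
have ln_small : \forall n \near \oo, `|0 - n%:R^-1 * ln (c / 2)| < eps / 2.
  have : n%:R^-1 * ln (c / 2) @[n --> \oo] --> 0.
    by rewrite -[X in _ --> X](mul0r (ln (c / 2))); apply: cvgM => //; exact: cvg_cst.
  by move/cvgrPdist_lt; apply; rewrite divr_gt0.
near=> n.
have n0 : 0 < n%:R :> R by rewrite ltr0n; near: n; exact: nbhs_infty_gt.
have an : a n < c * delta / 4.
  apply: le_lt_trans (ler_norm _) _; rewrite -normrN -sub0r; near: n; exact: a_small.
have cn : - (eps / 2) < n%:R^-1 * ln (c / 2).
  have : `|0 - n%:R^-1 * ln (c / 2)| < eps / 2 by near: n; exact: ln_small.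
  by rewrite sub0r normrN ltr_norml => /andP[].
have up : n%:R^-1 * ln (M n)%:R <= ln D.
  rewrite mulrC ler_pdivrMr // [leRHS]mulr_natr -lnXn //.
  by rewrite ler_ln ?posrE ?exprn_gt0.
have lo : c / 2 <= (M n)%:R * D `^ (delta * n%:R) / D ^+ n.
  have t0 : 0 < delta * n%:R by rewrite mulr_gt0.
  have := Mge n _ t0; rewrite -lerBlDl; apply: le_trans.
  rewrite lerBrDr -lerBrDl [X in _ <= X](_ : _ = c / 2); last by rewrite [X in X - _]splitr addrK.
  rewrite ler_pdivrMr //; apply: (@le_trans _ _ (n.+1%:R * (c * delta / 4))).
    by rewrite ler_wpM2l // ltW.
  have -> : c / 2 * (delta * n%:R) = (2 * n%:R) * (c * delta / 4) by field.
  have cd0 : 0 <= c * delta / 4 by rewrite divr_ge0 // mulr_ge0 // ltW.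
  rewrite ler_wpM2r //.
  by rewrite -natrM ler_nat mul2n -addnn -addn1 leq_add2l -(ltr_nat R).
have : ln (c / 2) <= ln ((M n)%:R * D `^ (delta * n%:R) / D ^+ n).
  by rewrite ler_ln ?posrE ?divr_gt0 ?mulr_gt0 ?powR_gt0 ?exprn_gt0.
rewrite [leRHS]ln_div ?posrE ?mulr_gt0 ?powR_gt0 ?exprn_gt0 //.
rewrite [ln (_ * D `^ _)]lnM ?posrE ?powR_gt0 // ln_powR lnXn // => lnc.
rewrite ger0_norm ?subr_ge0 //.
have : n%:R^-1 * ln (c / 2) <= n%:R^-1 * ln (M n)%:R + delta * ln D - ln D.
  rewrite ler_pdivrMl // mulrBr mulrDr mulrA divff ?gt_eqF // mul1r.
  by rewrite mulrA [n%:R * delta]mulrC [n%:R * ln D]mulr_natl.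
lra.
Unshelve. all: by end_near.
Qed.

(** * The growth rate *)

Section BackwardOrbit.
Variables (k : closedFieldType) (X : kspace k) (f : kmor X X).
Hypotheses (Xsch : is_scheme X) (Xred : reduced X).
Hypotheses (Xft : finite_type X) (Xirr : irreducible_space X).
Hypotheses (fflat : flat_mor f) (ffin : finite_mor f) (fsep : separable_mor f).
Variables eta x : X.
Hypotheses (geta : generic_point eta) (xrat : rational_point x).
Hypothesis xdense : dense (\bigcup_(i in [set: nat]) preimage_iter f i x).

Let rational_pre := rational_preimage Xsch Xred fflat ffin fsep geta.

Lemma topological_degree_gt0 : (0 < topological_degree f)%N.
Proof.
have [s [zz [_ zP _ _ [zpos <-]]]] :=
  rational_fiber Xsch Xred fflat ffin fsep geta (rational_image (f := f) xrat).
have [i _] := (zP x).1 erefl.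
by rewrite (bigD1 i) //= addn_gt0 zpos.
Qed.

Lemma fiber_seq : exists fib : X -> seq X, forall z, rational_point z ->
  [/\ uniq (fib z), forall y, y \in fib z <-> f y = z &
      (\sum_(y <- fib z) multiplicity f y)%N = topological_degree f].
Proof.
suff /choice[fib fibP] : forall z, exists s : seq X, rational_point z ->
    [/\ uniq s, forall y, y \in s <-> f y = z &
        (\sum_(y <- s) multiplicity f y)%N = topological_degree f] by exists fib.
(* Off the rational points the list is an arbitrary default. *)
move=> z; have [zrat|nz] := pselect (rational_point z); last by exists [::].
have [s [zz [zinj zP _ _ [_ zsum]]]] := rational_fiber Xsch Xred fflat ffin fsep geta zrat.
exists [seq zz i | i <- enum 'I_s] => _; split.
- by rewrite map_inj_uniq // enum_uniq.
- move=> y; rewrite zP; split=> [/mapP[i _ ->]|[i <-]]; first by exists i.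
  by apply: map_f; rewrite mem_enum.
- by rewrite big_map big_enum.
Qed.

(* Closed subsets of the space of rational points, the only part of X on which f
   is shown to be open and closed. *)
Definition rational_closed (S : set X) := S `<=` @rational_point k X /\
  forall z, rational_point z -> ~ S z -> exists N, [/\ open N, N z & forall y, N y -> ~ S y].

Lemma rational_closedP S : rational_closed S -> S = [set y | rational_point y /\ closure S y].
Proof.
move=> [Srat Scl]; apply/seteqP; split=> y.
  by move=> Sy; split; [exact: Srat|exact: subset_closure].
move=> [yrat cly]; apply: contrapT => nSy; have [N [oN Ny NS]] := Scl y yrat nSy.
by have [u [Su Nu]] := cly N (open_nbhs_nbhs (conj oN Ny)); exact: NS Nu Su.
Qed.

Lemma rational_closedI S S' :
  rational_closed S -> rational_closed S' -> rational_closed (S `&` S').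
Proof.
move=> [Srat Scl] [_ Scl']; split=> [y [Sy _]|z zrat nSz]; first exact: Srat.
have [Sz|nSz'] := pselect (S z).
  have [N [oN Nz NS]] : exists N, [/\ open N, N z & forall y, N y -> ~ S' y].
    by apply: Scl' => // Sz'; exact: nSz.
  by exists N; split=> // y Ny [_]; exact: NS.
by have [N [oN Nz NS]] := Scl z zrat nSz'; exists N; split=> // y Ny [Sy _]; exact: NS Ny Sy.
Qed.

(** [closed_image] is applied to the closure of S in X, whose rational points are those of S; the
    points over a rational z are rational. *)
Lemma rational_closed_image S : rational_closed S -> rational_closed (f @` S).
Proof.
move=> Scl; have [Srat _] := Scl; split=> [_ [y Sy <-]|z zrat nSz].
  exact: rational_image (Srat y Sy).
have clS : closed (closure S) by exact: closed_closure.
have [y fy cly|N [oN Nz NS]] := closed_image Xsch Xred fflat ffin geta clS zrat _.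
  apply: nSz; exists y => //; rewrite (rational_closedP Scl); split=> //.
  by apply: rational_pre; rewrite fy.
by exists N; split=> // u Nu [y Sy fy]; apply: (NS y); [rewrite fy|exact: subset_closure].
Qed.

Lemma rational_closed_preimage S : rational_closed S -> rational_closed (f @^-1` S).
Proof.
move=> [Srat Scl]; split=> [y /Srat|z zrat nSz]; first exact: rational_pre.
have [N [oN Nz NS]] := Scl (f z) (rational_image zrat) nSz.
exists (f @^-1` N); split=> //; last by move=> y /NS.
by apply: open_comp => // u _; exact: mor_continuous.
Qed.

(** Among rational points, the complement of this set is the image of the complement of S, which
    [open_image] makes open. *)
Lemma rational_closed_coimage S : rational_closed S ->
  rational_closed [set z | rational_point z /\ forall y, f y = z -> S y].
Proof.
move=> [Srat Scl]; split=> [z []//|z zrat nSz].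
have [y fy nSy] : exists2 y, f y = z & ~ S y.
  apply: contrapT => nex; apply: nSz; split=> // y fy.
  by apply: contrapT => nSy; apply: nex; exists y.
have yrat : rational_point y by apply: rational_pre; rewrite fy.
have [N [oN Ny NS]] := Scl y yrat nSy.
have [|N' [oN' N'z N'P]] := open_image Xsch Xred fflat ffin geta oN Ny _.
  by rewrite fy.
exists N'; split=> [//||w N'w [wrat wS]]; first by rewrite -fy.
by have [y' [fy' /NS]] := N'P w N'w wrat; apply; exact: wS.
Qed.

Lemma rational_closed_minimal (F : set (set X)) : F `<=` rational_closed -> F !=set0 ->
  exists2 S, F S & forall S', F S' -> S' `<=` S -> S' = S.
Proof.
move=> Fcl [S0 FS0].
have [||_ [S FS <-] Smin] := closed_minimal Xft (F := [set closure S | S in F]).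
- by move=> _ [S _ <-]; exact: closed_closure.
- by exists (closure S0), S0.
exists S => // S' FS' S'S; rewrite (rational_closedP (Fcl _ FS')) (rational_closedP (Fcl _ FS)).
by rewrite (Smin (closure S')) //; [exists S'|exact: closure_subset].
Qed.

Lemma orbit_meets (N : set X) : open N -> N !=set0 -> exists n y, N y /\ iter n f y = x.
Proof.
move=> oN N0; have [y [Ny [n _ yx]]] := xdense N0 oN.
by exists n, y; split=> //; rewrite -iter_morE.
Qed.

(** If every S i is proper, nonempty open sets off S 0, ..., S (n-1) have a nonempty intersection by
    irreducibility; the dense backward orbit meets it. *)
Lemma rational_closed_cover (S : nat -> set X) n : (forall i, rational_closed (S i)) ->
  (forall m y, iter m f y = x -> exists2 i, (i < n)%N & S i y) ->
  exists i, S i = @rational_point k X.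
Proof.
move=> Scl Scov; apply: contrapT => nS.
have open_off i : exists N, [/\ open N, N !=set0 & forall y, N y -> ~ S i y].
  have [Srat Sopen] := Scl i.
  have [z [zrat nSz]] : exists z, rational_point z /\ ~ S i z.
    apply: contrapT => nex; apply: nS; exists i; apply/seteqP; split=> // z zrat.
    by apply: contrapT => nSz; apply: nex; exists z.
  by have [N [oN Nz NS]] := Sopen z zrat nSz; exists N; split=> //; exists z.
have [N [oN N0 NS]] : exists N, [/\ open N, N !=set0 &
    forall y i, (i < n)%N -> N y -> ~ S i y].
  elim: n {Scov} => [|m [N [oN N0 NS]]].
    by exists setT; split=> //; [exact: openT|exists x].
  have [N' [oN' N'0 N'S]] := open_off m; exists (N `&` N'); split.
  - exact: openI.
  - exact: Xirr.2.
  - move=> y i; rewrite ltnS leq_eqVlt => /orP[/eqP -> [_ /N'S]//|im [Ny _]].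
    exact: NS im Ny.
have [m [y [Ny yx]]] := orbit_meets oN N0.
by have [i i_n Sy] := Scov m y yx; exact: NS i_n Ny Sy.
Qed.

Lemma min_heavy_card_growth (R : realType) (c : R) : 0 < c -> c <= 1 ->
  (min_heavy_card f x c n)%:R `^ (n%:R^-1) @[n --> \oo]
      --> ((topological_degree f)%:R : R).
Proof.
move=> c0 c1; have d0 := topological_degree_gt0.
have [fib fibP] := fiber_seq.
pose T : set X := @rational_point k X.
pose D : R := (topological_degree f)%:R.
have D0 : 0 < D by rewrite ltr0n.
pose w y : R := (multiplicity f y)%:R / D.
have T_image y : T y -> T (f y) by exact: rational_image.
have T_pre y : T (f y) -> T y by exact: rational_pre.
have fib_mem z : T z -> forall y, y \in fib z <-> f y = z by move=> /fibP[].
have fib_uniq z : T z -> uniq (fib z) by move=> /fibP[].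
have w_sum z : T z -> \sum_(y <- fib z) w y = 1.
  by move=> /fibP[_ _ E]; rewrite -mulr_suml -natr_sum E divff // gt_eqF.
have e0 : 0 < D^-1 by rewrite invr_gt0.
have w_ge y : T y -> D^-1 <= w y.
  move=> yrat; rewrite -[leLHS]mul1r ler_wpM2r ?invr_ge0 ?(ltW D0) // ler1n.
  exact: (fiber_dim_multiplicity Xsch Xred fflat ffin fsep geta (rational_image yrat)).2.
have [U [oU Ueta UP]] := generically_unramified Xsch Xred fflat ffin fsep geta.
(* Off r the multiplicity is 1, that is, the transition probability is exactly 1 / D. *)
pose r : set X := [set y | T y /\ ~ U y].
have rcl : rational_closed r.
  split=> [y []//|z zrat nrz]; exists U; split=> //; last by move=> y Uy [_].
  by apply: contrapT => nUz; apply: nrz.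
(* U need not be known to contain a rational point a priori: density puts a point of the backward
   orbit in it. *)
have rT : r <> T.
  have [n [y [Uy yx]]] := orbit_meets oU (ex_intro _ eta Ueta).
  have yrat : T y.
    by apply: (iter_rational (n := n) Xsch Xred fflat ffin fsep geta); rewrite iter_morE yx.
  by move=> rE; have [_] : r y by rewrite rE.
have w_off y : T y -> ~ r y -> w y = D^-1.
  move=> yrat nry; rewrite /w UP ?mul1r //; last exact: rational_image.
  by apply: contrapT => nUy; apply: nry.
have avg0 : avg x fib w r n @[n --> \oo] --> 0.
  apply: (avg_closed_cvg0 T_pre xrat fib_mem e0 w_ge w_sum (C := rational_closed)) => //.
  - by move=> S [].
  - exact: rational_closedI.
  - exact: rational_closed_image.
  - exact: rational_closed_preimage.
  - exact: rational_closed_coimage.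
  - exact: rational_closed_minimal.
  - exact: rational_closed_cover.
  - by split=> // z zrat [].
have weightE n y : iter n f y = x ->
    weight f w n y = (multiplicity (iter_mor n f) y)%:R / D ^+ n.
  move=> yx; rewrite (iter_multiplicity Xsch Xred fflat ffin fsep geta) ?yx //.
  by rewrite /weight big_split /= natr_prod prodr_const card_ord exprVn.
have heavyE n (S : {fset X}) : [set` S] `<=` preimage_iter f n x ->
    (\sum_(y <- S) multiplicity (iter_mor n f) y)%N%:R = D ^+ n * \sum_(y <- S) weight f w n y.
  move=> Sx; rewrite natr_sum mulr_sumr big_seq [RHS]big_seq; apply: eq_bigr => y yS.
  have yx : iter n f y = x by rewrite -iter_morE; exact: Sx.
  by rewrite weightE // mulrCA divff ?mulr1 // expf_neq0 // gt_eqF.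
(* The whole fibre qualifies because c <= 1. This bounds the minimum from above and shows that it
   exists, so the default 0 of [min_heavy_card] does not arise. *)
have full n : exists2 N, heavy_card f x c n N & N%:R <= D ^+ n.
  have [s [us sP sE]] := law_fiber w T_pre xrat fib_mem fib_uniq n.
  exists (size s); last first.
    have := fiber_size T_pre xrat fib_mem e0 w_ge w_sum fib_uniq us sP.
    by rewrite invrK.
  have sx : [set` [fset y in s]%fset] `<=` preimage_iter f n x.
    by move=> y; rewrite /= inE => /sP; rewrite /preimage_iter /= iter_morE.
  exists [fset y in s]%fset; split=> //.
    rewrite heavyE // mulrC ler_wpM2l ?exprn_ge0 ?(ltW D0) //.
    rewrite (perm_big s) /=; last first.
      by apply: uniq_perm => // [|y]; [exact: fset_uniq|rewrite inE].
    move: (law_cst T_pre xrat fib_mem w_sum n 1); rewrite sE.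
    by rewrite -mulr_suml mulr1 => ->.
  by rewrite card_fseq undup_id.
have minP n : heavy_card f x c n (min_heavy_card f x c n) /\
    forall M, heavy_card f x c n M -> (min_heavy_card f x c n <= M)%N.
  apply: (@xgetPex _ 0%N [set N | heavy_card f x c n N /\
    forall M, heavy_card f x c n M -> (N <= M)%N]).
  have [N hN _] := full n.
  have exN : exists N, `[< heavy_card f x c n N >] by exists N; exact/asboolP.
  exists (ex_minn exN); case: ex_minnP => M /asboolP hM Mmin; split=> // M' hM'.
  by apply: Mmin; exact/asboolP.
apply: (growth_rate (a := fun n => avg x fib w r n) (c := c)) => //.
- by rewrite ler1n.
- move=> n; have [N hN] := full n; apply: le_trans.
  by rewrite ler_nat; exact: (minP n).2.
move=> n t t0; have [[S [Sx Sc ->]] _] := minP n.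
have := @heavy_size R X f T x fib w D^-1 T_image T_pre xrat fib_mem e0 w_ge w_sum fib_uniq
  r w_off n t c (enum_fset S).
rewrite invrK; apply=> //; first exact: fset_uniq.
  by move=> y yS; rewrite -iter_morE; exact: Sx.
by move: Sc; rewrite heavyE // mulrC ler_pM2l // exprn_gt0.
Qed.

End BackwardOrbit.

Theorem theorem1p20 (R : realType) (k : closedFieldType) (X : kspace k)
    (f : kmor X X) (x : X) :
  is_variety X ->
  flat_mor f ->
  finite_mor f ->
  separable_mor f ->
  rational_point x ->
  dense (\bigcup_(i in [set: nat]) preimage_iter f i x) ->
  forall c : R, 0 < c -> c <= 1 ->
    (min_heavy_card f x c n)%:R `^ (n%:R^-1) @[n --> \oo]
      --> ((topological_degree f)%:R : R).
Proof.
move=> [Xsch Xft _ Xred Xirr] fflat ffin fsep xrat xdense c c0 c1.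
have [eta geta] := generic_exists Xsch Xirr.
exact: (min_heavy_card_growth Xsch Xred Xft Xirr fflat ffin fsep geta xrat xdense).
Qed.
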